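(* Let $m$ be a positive integer and let $\mathbb{K}=\mathbb{R}$ or $\mathbb{C}$. If $p\in\left(\frac{2m}{m+1},\infty\right]$, then for every positive integer $n$ and every unimodular $m$-linear form $T:\ell_p^n\times\cdots\times\ell_p^n\to\mathbb{K}$, $$\left(\sum_{j_1,\ldots,j_m=1}^{n}\left|T(e_{j_1},\ldots,e_{j_m})\right|^{\frac{2mp}{mp+p-2m}}\right)^{\frac{mp+p-2m}{2mp}}\le 1.3\,m^{0.365}\,\|T\| .$$ Moreover: (i) for $p\ge 2$ the exponent $\frac{2mp}{mp+p-2m}$ is sharp, i.e. it is the optimal exponent; (ii) for $1<p\le\frac{2m}{m+1}$ the optimal exponent is not smaller than $\frac{mp}{p-1}$; (iii) for $\frac{2m}{m+1}<p\le 2$ the optimal exponent belongs to $\left[\frac{mp}{p-1},\frac{2mp}{mp+p-2m}\right]$.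
   Context: $\ell_p^n$ is $\mathbb{K}^n$ with the $\ell_p$-norm (sup norm if $p=\infty$), and $e_1,\ldots,e_n$ are the canonical vectors. An $m$-linear form $T:\ell_p^n\times\cdots\times\ell_p^n\to\mathbb{K}$ is unimodular if $|T(e_{j_1},\ldots,e_{j_m})|=1$ for all $j_1,\ldots,j_m\in\{1,\ldots,n\}$. $\|T\|=\sup\{|T(x^{(1)},\ldots,x^{(m)})|:\|x^{(k)}\|_p\le 1,\ k=1,\ldots,m\}$. For $p=\infty$ the expressions in $p$ are read as limits, e.g. $\frac{2mp}{mp+p-2m}=\frac{2m}{m+1}$. For fixed $m$, $p$ and $\mathbb{K}$, call $r\in(0,\infty)$ admissible if there is a constant $C>0$, independent of $n$ and $T$, such that $\left(\sum_{j_1,\ldots,j_m=1}^n|T(e_{j_1},\ldots,e_{j_m})|^r\right)^{1/r}\le C\|T\|$ for all positive integers $n$ and all unimodular $m$-linear forms $T:\ell_p^n\times\cdots\times\ell_p^n\to\mathbb{K}$. The optimal exponent is the infimum of the admissible $r$ (with $\inf\emptyset=\infty$). *)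

(* Defs.v *)
From HB Require Import structures.
From mathcomp Require Import all_boot all_order all_algebra.
From mathcomp Require Import complex.
From mathcomp Require Import all_classical all_reals all_analysis.

Set Implicit Arguments.
Unset Strict Implicit.
Unset Printing Implicit Defensive.

Import Order.TTheory GRing.Theory Num.Theory.

Local Open Scope classical_set_scope.
Local Open Scope ring_scope.

Variant scalars := RealScalars | ComplexScalars.

Definition base_field (R : realType) (s : scalars) : numFieldType :=
  match s with
  | RealScalars => R
  | ComplexScalars => R[i]
  end.

(* The norm `|z| of R[i] takes its values in R[i] itself; normc is the
   R-valued modulus. *)
Definition modulus (R : realType) (s : scalars) : base_field R s -> R :=
  match s return base_field R s -> R with
  | RealScalars => fun x : R => `|x|
  | ComplexScalars => @ComplexField.Normc.normc R
  end.

Section UnimodularForms.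
Variables (R : realType) (s : scalars).
Local Notation K := (base_field R s).

(* Only used for 1 < p <= +oo; the value at -oo is irrelevant. *)
Definition lp_norm (n : nat) (p : \bar R) (x : 'rV[K]_n) : R :=
  match p with
  | q%:E => (\sum_(j < n) modulus (x 0 j) `^ q) `^ q^-1
  | +oo%E => \big[Num.max/0]_(j < n) modulus (x 0 j)
  | -oo%E => 0
  end.

(* dfwith x u replaces the k-th argument of x by u. *)
Definition multilinear_form (m n : nat) (T : ('I_m -> 'rV[K]_n) -> K) : Prop :=
  forall (k : 'I_m) (x : 'I_m -> 'rV[K]_n),
    scalar (fun u : 'rV[K]_n => T (@dfwith _ (fun=> 'rV[K]_n) x k u)).

Definition coef (m n : nat) (T : ('I_m -> 'rV[K]_n) -> K)
    (j : {ffun 'I_m -> 'I_n}) : K :=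
  T (fun k => delta_mx 0 (j k)).

Definition unimodular (m n : nat) (T : ('I_m -> 'rV[K]_n) -> K) : Prop :=
  forall j : {ffun 'I_m -> 'I_n}, modulus (coef T j) = 1.

(* For multilinear T and 1 <= p this set is nonempty and bounded (finite
   dimension), so the real-valued sup is the genuine supremum. *)
Definition form_norm (m n : nat) (p : \bar R)
    (T : ('I_m -> 'rV[K]_n) -> K) : R :=
  sup [set modulus (T x) | x in
        [set x : 'I_m -> 'rV[K]_n | forall k, lp_norm p (x k) <= 1]].

Definition coef_sum_norm (m n : nat) (r : R)
    (T : ('I_m -> 'rV[K]_n) -> K) : R :=
  (\sum_(j : {ffun 'I_m -> 'I_n}) modulus (coef T j) `^ r) `^ r^-1.

Definition admissible (m : nat) (p : \bar R) (r : R) : Prop :=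
  0 < r /\
  exists2 C : R, 0 < C &
    forall (n : nat) (T : ('I_m -> 'rV[K]_n) -> K),
      (0 < n)%N -> multilinear_form T -> unimodular T ->
      coef_sum_norm r T <= C * form_norm p T.

(* The infimum in \bar R, so that it is +oo when no r is admissible. *)
Definition optimal_exponent (m : nat) (p : \bar R) : \bar R :=
  ereal_inf [set r%:E | r in admissible m p].

End UnimodularForms.

Arguments admissible {R} s m p r.
Arguments optimal_exponent {R} s m p.

(* 2mp / (mp + p - 2m), and its limit 2m / (m + 1) at p = +oo. *)
Definition HL_exponent (R : realType) (m : nat) (p : \bar R) : R :=
  match p with
  | q%:E => (2 * m%:R * q) / (m%:R * q + q - 2 * m%:R)
  | +oo%E => (2 * m%:R) / (m%:R + 1)
  | -oo%E => 0
  end.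

(* Main.v *)
Require Import Defs.
From mathcomp Require Import all_boot all_order all_algebra.
From mathcomp Require Import complex ring lra.
From mathcomp Require Import all_classical all_reals all_analysis.

Import Order.TTheory GRing.Theory Num.Theory.
Import numFieldNormedType.Exports.
Local Open Scope classical_set_scope.
Local Open Scope ring_scope.

Set Implicit Arguments.
Unset Strict Implicit.
Unset Printing Implicit Defensive.

(** The proof has two halves. Since the coefficients of a unimodular form T have
modulus one, the left-hand side of the inequality is the power n^(m/r) for
the exponent r, and everything depends on how small the norm of T can be.

Lower bound for the norm. Let 1/p be 0 at infinity. The vectors whose entries
have modulus n^(-1/p) lie in the unit ball, so it is enough to know the
Bohnenblust-Hille inequality on vectors with unimodular entries, with a good
constant. That inequality is proved by induction on the number of slots: the
mixed norm inequality of Blei, which rests on the arithmetic-geometric mean and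
on the Loomis-Whitney inequality, reduces the norm of exponent 2m/(m+1) to
mixed norms, and the Khinchine inequality with exponent q = 2(m-1)/m reduces
each mixed norm to a form with one slot less. The constant is the product of
the Khinchine constants exp ((2-q) C / q) = exp (C/(m-1)), so it equals
exp (C H) with H the harmonic number of index m-1, and C = 0.365 gives the
bound 1.3 m^0.365.

The number C comes from the Khinchine inequality near q = 2: by Jensen's
inequality for the weight |f|^2, it is enough that a Rademacher sum f of
variance 1 satisfies E f^2 ln |f| <= 0.365; the Gaussian value is 0.3648...
The idea is to compare characteristic functions. If a signed measure has mass
and second moment 0 and a nonnegative cosine transform, then its integral
against x^2 ln |x| is nonnegative (xlnx2_comparison). The characteristic
function of f is a product of cosines, and the weighted
arithmetic-geometric mean inequality puts it below a mean of powers of single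
cosines. These powers are replaced by polynomials in cos^2, whose terms are
characteristic functions of simple random walks (rad_xlnx2_amgm). For a simple
random walk, E S^2 ln |S| is computed up to small errors, because the logarithm
of an integer is close to a harmonic number and sums of harmonic numbers along a
binomial row have a closed form (binomial_harm, walk_bound). A coefficient with
more than about half of the variance is treated by hand. The complex case is
easier, since four phases and the fourth moment give the smaller value
ln 2 / 2.

Upper bound for the norm. Let e be (m+1)/2 - m/p if p >= 2 and 1 - 1/p if
1 < p <= 2. For every N there are unimodular forms, with signs as coefficients,
whose norm is at most n^(e + (m+1)/N) times a constant depending on m and N.
Random signs satisfy, for all vectors with entries -1, 0, 1, the bound that the
number of nonzero entries suggests, up to a logarithm (random_signs). By multilinearity the bound extends
to vectors that are flat on their support (flat_bound), and a vector of the unit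
ball is a sum of 2(N+1) vectors that are flat up to the factor n^(1/N)
(signed_form_bound). An admissible r therefore satisfies m/r <= e + (m+1)/N for
all N, so r is at least m/e. For p >= 2 this is the exponent of the
inequality, and for p <= 2 it is mp/(p-1). *)

(** * Derivatives and bounds for the logarithm *)

(** The value of the derivative has type R itself, and not the type of the
    normed module it lives in, so that ring normalisation applies to it. *)
Definition has_deriv (R : realType) (f : R -> R) (x l : R) : Prop :=
  is_derive x 1 f l.

Section Derivatives.
Context {R : realType}.
Implicit Types (f g df : R -> R) (x a b c : R).

Lemma has_deriv_ndecr f df a b : a <= b ->
  (forall x, a <= x <= b -> has_deriv f x (df x)) ->
  (forall x, a <= x <= b -> 0 <= df x) -> f a <= f b.
Proof.
move=> ab fdf df0.
have [||c cab E] := @MVT_segment R f df a b ab.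
- by move=> x; rewrite in_itv/= => /andP[/ltW ax /ltW xb]; apply: fdf; rewrite ax.
- apply: derivable_within_continuous => x; rewrite in_itv/= => xab.
  by have [] := fdf _ xab.
rewrite -subr_ge0 E mulr_ge0 ?subr_ge0//; apply: df0.
by move: cab; rewrite in_itv.
Qed.

Lemma has_deriv_eq f x a b : has_deriv f x a -> a = b -> has_deriv f x b.
Proof. by move=> ? <-. Qed.

Lemma has_deriv_cst x c : has_deriv (fun=> c) x 0.
Proof. exact: is_derive_cst. Qed.

Lemma has_deriv_id x : has_deriv (fun u => u) x 1.
Proof. exact: is_derive_id. Qed.

Lemma has_derivD f g x a b : has_deriv f x a -> has_deriv g x b ->
  has_deriv (fun u => f u + g u) x (a + b).
Proof. by move=> fa gb; exact: is_deriveD. Qed.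

Lemma has_derivN f x a : has_deriv f x a -> has_deriv (fun u => - f u) x (- a).
Proof. by move=> fa; exact: is_deriveN. Qed.

Lemma has_derivM f g x a b : has_deriv f x a -> has_deriv g x b ->
  has_deriv (fun u => f u * g u) x (a * g x + f x * b).
Proof.
move=> fa gb; have := @is_deriveM _ _ f g x 1 a b fa gb.
by move/is_derive_eq; apply; rewrite /GRing.scale/=; ring.
Qed.

Lemma has_derivX f x a n : has_deriv f x a ->
  has_deriv (fun u => f u ^+ n) x (n%:R * f x ^+ n.-1 * a).
Proof.
move=> fa; case: n => [|n].
  by under eq_fun do rewrite expr0; rewrite !mul0r; exact: is_derive_cst.
elim: n => [|n IH].
  by under eq_fun do rewrite expr1; rewrite expr0 !mul1r.
have -> : (fun u => f u ^+ n.+2) = (fun u => f u * f u ^+ n.+1).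
  by apply/funext => u; rewrite exprS.
apply: has_deriv_eq (has_derivM fa IH) _ => /=.
by rewrite !exprS -(natr1 n.+1); move: (f x ^+ n) => z; ring.
Qed.

Lemma has_derivV f x a : f x != 0 -> has_deriv f x a ->
  has_deriv (fun u => (f u)^-1) x (- a / f x ^+ 2).
Proof.
move=> f0 fa; have := @is_deriveV _ f x a 1 f0 fa.
by move/is_derive_eq; apply; rewrite /GRing.scale/= !mulNr mulrC.
Qed.

Lemma has_deriv_comp f g x a b : has_deriv f x a -> has_deriv g (f x) b ->
  has_deriv (fun u => g (f u)) x (b * a).
Proof. by move=> fa gb; exact: (@is_derive1_comp _ g f x b a gb fa). Qed.

Lemma has_deriv_ln f x a : 0 < f x -> has_deriv f x a ->
  has_deriv (fun u => ln (f u)) x (a / f x).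
Proof.
move=> f0 fa; have := has_deriv_comp fa (is_derive1_ln f0).
by rewrite mulrC.
Qed.

End Derivatives.

Ltac has_deriv := repeat first [ exact: has_deriv_cst | exact: has_deriv_id
  | notypeclasses refine (has_derivD _ _) | notypeclasses refine (has_derivN _)
  | notypeclasses refine (has_derivM _ _) | notypeclasses refine (has_derivX _ _)
  | notypeclasses refine (has_derivV _ _) | notypeclasses refine (has_deriv_ln _ _) ].

Section LogBounds.
Context {R : realType}.
Implicit Types (x y u : R).

Lemma ln1D_ge x : 0 <= x -> 2 * x / (2 + x) <= ln (1 + x).
Proof.
move=> x0.
pose f u : R := ln (1 + u) - 2 * u / (2 + u).
have := @has_deriv_ndecr _ f (fun u => u ^+ 2 / ((1 + u) * (2 + u) ^+ 2)) 0 x x0.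
rewrite /f addr0 ln1 mulr0 mul0r subr0 subr_ge0; apply.
- move=> u /andP[u0 _].
  have u1 : 0 < 1 + u by lra.
  have u2 : 2 + u != 0 by rewrite gt_eqF//; lra.
  apply: has_deriv_eq; first by has_deriv.
  rewrite /=; field.
  by rewrite u2 gt_eqF.
- move=> u /andP[u0 _]; rewrite divr_ge0 ?sqr_ge0// mulr_ge0 ?sqr_ge0//; lra.
Qed.

(** The logarithm ln (1 + x) is the value 2 artanh z of an odd power series in
    z = x / (2 + x) with positive coefficients; these are its first two terms. *)
Lemma ln1D_ge_cubic x : 0 <= x ->
  2 * x / (2 + x) + 2 / 3 * x ^+ 3 / (2 + x) ^+ 3 <= ln (1 + x).
Proof.
move=> x0.
pose f u : R := ln (1 + u) - (2 * u / (2 + u) + 2 / 3 * u ^+ 3 / (2 + u) ^+ 3).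
have := @has_deriv_ndecr _ f (fun u => u ^+ 4 / ((1 + u) * (2 + u) ^+ 4)) 0 x x0.
rewrite /f addr0 ln1 !expr0n/= !mulr0 !mul0r addr0 subr0 subr_ge0; apply.
- move=> u /andP[u0 _].
  have u1 : 0 < 1 + u by lra.
  have u2 : 2 + u != 0 by rewrite gt_eqF//; lra.
  apply: has_deriv_eq; first by has_deriv; rewrite // expf_neq0.
  rewrite /=; field.
  by rewrite u2 gt_eqF.
- move=> u /andP[u0 _]; rewrite divr_ge0 ?exprn_ge0// mulr_ge0 ?exprn_ge0//; lra.
Qed.

(** The same series with its coefficients from the cubic one on replaced by
    that of the cubic term, so that the tail is geometric. *)
Lemma ln1D_le_cubic x : 0 <= x ->
  ln (1 + x) <= 2 * x / (2 + x) + x ^+ 3 / (6 * (2 + x) * (1 + x)).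
Proof.
move=> x0.
pose f u : R := 2 * u / (2 + u) + u ^+ 3 / (6 * (2 + u) * (1 + u)) - ln (1 + u).
have := @has_deriv_ndecr _ f
  (fun u => u ^+ 4 / (6 * (1 + u) ^+ 2 * (2 + u) ^+ 2)) 0 x x0.
rewrite /f !addr0 ln1 !expr0n/= !mulr0 !mul0r addr0 subr0 subr_ge0; apply.
- move=> u /andP[u0 _].
  have u1 : 0 < 1 + u by lra.
  have u2 : 2 + u != 0 by rewrite gt_eqF//; lra.
  apply: has_deriv_eq; first by has_deriv; rewrite // !mulf_neq0// gt_eqF.
  rewrite /=; field.
  by rewrite u2 gt_eqF.
- move=> u /andP[u0 _]; rewrite divr_ge0 ?mulr_ge0 ?exprn_ge0//; lra.
Qed.

Lemma ln1D_le x : 0 <= x -> ln (1 + x) <= x * (x + 2) / (2 * (1 + x)).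
Proof.
move=> x0; apply: le_trans (ln1D_le_cubic x0) _.
rewrite -subr_ge0.
have -> : x * (x + 2) / (2 * (1 + x)) -
  (2 * x / (2 + x) + x ^+ 3 / (6 * (2 + x) * (1 + x))) = x ^+ 3 / (3 * (2 + x) * (1 + x)).
  by field; rewrite !gt_eqF//; lra.
by rewrite divr_ge0 ?exprn_ge0// ?mulr_ge0//; lra.
Qed.

End LogBounds.

(** * The Taylor remainder of the cosine *)

Section CosineRemainder.
Context {R : realType}.
Implicit Types (x y u t : R).

Lemma has_deriv_sin x : has_deriv (@sin R) x (cos x).
Proof. exact: is_derive_sin. Qed.

Lemma has_deriv_cos x : has_deriv (@cos R) x (- sin x).
Proof. exact: is_derive_cos. Qed.

Lemma sin_le x : 0 <= x -> sin x <= x.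
Proof.
move=> x0.
have := @has_deriv_ndecr _ (fun u : R => u - sin u) (fun u => 1 - cos u) 0 x x0.
rewrite sin0 subr0 subr_ge0; apply.
- by move=> u _; apply: has_derivD (has_deriv_id _) (has_derivN (has_deriv_sin _)).
- by move=> u _; rewrite subr_ge0 cos_le1.
Qed.

Lemma cos_ge x : 0 <= x -> 1 - x ^+ 2 / 2 <= cos x.
Proof.
move=> x0.
have := @has_deriv_ndecr _ (fun u : R => cos u - (1 - u ^+ 2 / 2)) (fun u => u - sin u) 0 x x0.
rewrite cos0 expr0n mul0r subr0 subrr subr_ge0; apply.
- move=> u _; apply: has_deriv_eq.
    by apply: has_derivD (has_deriv_cos _) _; has_deriv.
  by rewrite /=; lra.
- by move=> u /andP[u0 _]; rewrite subr_ge0 sin_le.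
Qed.

Lemma sin_ge x : 0 <= x -> x - x ^+ 3 / 6 <= sin x.
Proof.
move=> x0.
have := @has_deriv_ndecr _ (fun u : R => sin u - (u - u ^+ 3 / 6))
  (fun u => cos u - (1 - u ^+ 2 / 2)) 0 x x0.
rewrite sin0 expr0n mul0r !subr0 subr_ge0; apply.
- move=> u _; apply: has_deriv_eq.
    by apply: has_derivD (has_deriv_sin _) _; has_deriv.
  by rewrite /=; lra.
- by move=> u /andP[u0 _]; rewrite subr_ge0 cos_ge.
Qed.

Lemma cos_le x : 0 <= x -> cos x <= 1 - x ^+ 2 / 2 + x ^+ 4 / 24.
Proof.
move=> x0.
have := @has_deriv_ndecr _ (fun u : R => 1 - u ^+ 2 / 2 + u ^+ 4 / 24 - cos u)
  (fun u => sin u - (u - u ^+ 3 / 6)) 0 x x0.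
rewrite cos0 !expr0n/= !mul0r subr0 addr0 subrr subr_ge0; apply.
- move=> u _; apply: has_deriv_eq.
    apply: has_derivD (has_derivN (has_deriv_cos _)); has_deriv.
  by rewrite /=; lra.
- by move=> u /andP[u0 _]; rewrite subr_ge0 sin_ge.
Qed.

(** For a signed measure with weights w, \sum w |x|^3 cos_rem (t |x|) is
    (\sum w cos (t x)) / t^3 up to terms that have the mass or the second moment
    as a factor; this is the kernel of the comparison principle. *)
Definition cos_rem u : R := (cos u - 1 + u ^+ 2 / 2) / u ^+ 3.

Lemma cos_rem_ge0 u : 0 <= u -> 0 <= cos_rem u.
Proof.
move=> u0; rewrite divr_ge0 ?exprn_ge0//.
by have := cos_ge u0; lra.
Qed.

Lemma cos_rem_le u : 0 <= u -> cos_rem u <= u / 24.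
Proof.
move=> u0; have [->|un0] := eqVneq u 0; first by rewrite /cos_rem !expr0n/= invr0 mulr0 mul0r.
have {un0} u1 : 0 < u by rewrite lt_neqAle eq_sym un0.
rewrite ler_pdivrMr ?exprn_gt0//; have := cos_le u0.
by rewrite (_ : u / 24 * u ^+ 3 = u ^+ 4 / 24); [lra|ring].
Qed.

Lemma cos_remN u : cos_rem (- u) = - cos_rem u.
Proof. by rewrite /cos_rem cosN sqrrN exprNn -signr_odd/= expr1 mulN1r invrN mulrN. Qed.

Lemma norm_cos_rem u : `|cos_rem u| <= `|u|.
Proof.
wlog u0 : u / 0 <= u => [H|].
  have [/H//|/ltW u0] := leP 0 u.
  by rewrite -[u]opprK cos_remN normrN (normrN (- u)); apply: H; rewrite oppr_ge0.
rewrite ger0_norm ?cos_rem_ge0// ger0_norm//; apply: le_trans (cos_rem_le u0) _; lra.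
Qed.

(** At 0 the division by zero gives the value 0, which is also the limit. *)
Lemma cos_rem_continuous : continuous (cos_rem : R -> R).
Proof.
move=> u; have [->|u0] := eqVneq u 0.
  have E0 : cos_rem 0 = 0 by have := norm_cos_rem 0; rewrite normr0 normr_le0 => /eqP.
  apply/cvgrPdist_le => e e0; exists e => //= z /=; rewrite E0 !sub0r !normrN => /ltW.
  exact/le_trans/norm_cos_rem.
apply: cvgM; last first.
  apply: cvgV; first by rewrite expf_neq0.
  exact: exprn_continuous.
apply: cvgD; first (apply: cvgB; [exact: continuous_cos|exact: cvg_cst]).
by apply: cvgM; [exact: exprn_continuous|exact: cvg_cst].
Qed.

Lemma ex_primitive : exists2 F : R -> R, F 0 = 0 &
  forall u, 0 <= u -> has_deriv F u (cos_rem u).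
Proof.
pose G x : R := (\int[lebesgue_measure]_(t in [set` `[-1, x]]) (cos_rem t))%R.
exists (fun x => G x - G 0) => [|u u0]; first by rewrite subrr.
have [||||dG GE] := @continuous_FTC1_closed R cos_rem (-1) u (u + 1).
- by rewrite ltrDl.
- apply: continuous_compact_integrable; first exact: segment_compact.
  by apply: continuous_subspaceT; exact: cos_rem_continuous.
- by apply: lt_le_trans u0; rewrite oppr_lt0.
- exact: cos_rem_continuous.
rewrite -[cos_rem u]subr0; apply: has_derivD; last by apply: has_derivN; exact: has_deriv_cst.
by rewrite -GE derive1E; exact: derivableP.
Qed.

End CosineRemainder.

(** * A comparison principle for x^2 ln |x| *)

Definition xlnx2 {R : realType} (x : R) : R := x ^+ 2 * ln `|x|.

Section LogComparison.
Context {R : realType}.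
Implicit Types (x y u t : R).

Section Primitive.
Variable F : R -> R.
Hypothesis F0 : F 0 = 0.
Hypothesis dF : forall u, 0 <= u -> has_deriv F u (cos_rem u).

Let primitive_bound u : 0 <= u -> 0 <= F u <= u ^+ 2.
Proof.
move=> u0; apply/andP; split.
- rewrite -F0; apply: (@has_deriv_ndecr _ F cos_rem) => // x /andP[x0 _]; first exact: dF.
  exact: cos_rem_ge0.
- rewrite -subr_ge0.
  have <- : 0 ^+ 2 - F 0 = 0 by rewrite F0 expr0n subrr.
  apply: (@has_deriv_ndecr _ (fun v => v ^+ 2 - F v) (fun v => 2 * v - cos_rem v)) => // x /andP[x0 _].
    apply: has_deriv_eq.
      apply: has_derivD; [has_deriv | by apply: has_derivN; apply: dF].
    by rewrite /=; lra.
  by have := cos_rem_le x0; lra.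
Qed.

(** The derivative of K is cos u / u^3, at most that of 1 / (2 u^2) in absolute
    value; hence F u = ln u / 2 + constant + O(u^-2) at infinity. *)
Let K u : R := F u - ln u / 2 - (u ^+ 2)^-1 / 2.

Let K_lip a b : 0 < a -> a <= b ->
  `|K b - K a| <= ((a ^+ 2)^-1 - (b ^+ 2)^-1) / 2.
Proof.
move=> a0 ab.
have H1 : K a - (a ^+ 2)^-1 / 2 <= K b - (b ^+ 2)^-1 / 2.
  apply: (@has_deriv_ndecr _ (fun u => K u - (u ^+ 2)^-1 / 2) (fun u => (cos u + 1) / u ^+ 3)) => //.
    move=> u /andP[au _]; have u0 : 0 < u by lra.
    apply: has_deriv_eq.
      apply: has_derivD; last by has_deriv; rewrite ?expf_neq0 ?gt_eqF.
      rewrite /K; apply: has_derivD; last by has_deriv; rewrite ?expf_neq0 ?gt_eqF.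
      by apply: has_derivD; [apply: dF; lra|has_deriv].
    by rewrite /cos_rem/=; field; rewrite gt_eqF.
  move=> u /andP[au _]; apply: divr_ge0; [by have := cos_geN1 u; lra|by apply: exprn_ge0; lra].
have H2 : - (K a + (a ^+ 2)^-1 / 2) <= - (K b + (b ^+ 2)^-1 / 2).
  apply: (@has_deriv_ndecr _ (fun u => - (K u + (u ^+ 2)^-1 / 2)) (fun u => (1 - cos u) / u ^+ 3)) => //.
    move=> u /andP[au _]; have u0 : 0 < u by lra.
    apply: has_deriv_eq.
      apply: has_derivN; apply: has_derivD; last by has_deriv; rewrite ?expf_neq0 ?gt_eqF.
      rewrite /K; apply: has_derivD; last by has_deriv; rewrite ?expf_neq0 ?gt_eqF.
      by apply: has_derivD; [apply: dF; lra|has_deriv].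
    by rewrite /cos_rem/=; field; rewrite gt_eqF.
  move=> u /andP[au _]; apply: divr_ge0; [by have := cos_le1 u; lra|by apply: exprn_ge0; lra].
by rewrite ler_norml; apply/andP; split; lra.
Qed.

Let K_lip_scale M x : 0 < M -> x != 0 ->
  `|x ^+ 2 * (K (M * `|x|) - K M)| <= (M ^+ 2)^-1 * (1 + x ^+ 2) / 2.
Proof.
move=> M0 x0; have ax0 : 0 < `|x| by rewrite normr_gt0.
have xx : x ^+ 2 * ((M * `|x|) ^+ 2)^-1 = (M ^+ 2)^-1.
  by rewrite exprMn real_normK ?num_real// invfM mulrCA divff ?mulr1// expf_neq0.
have M2 : 0 < (M ^+ 2)^-1 by rewrite invr_gt0 exprn_gt0.
have x2 := sqr_ge0 x.
rewrite normrM ger0_norm//.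
have [x1|/ltW x1] := leP 1 `|x|.
- have /(ler_wpM2l x2) := @K_lip M (M * `|x|) M0 (ler_peMr (ltW M0) x1).
  move/le_trans; apply.
  by rewrite mulrA ler_pM2r// mulrBr xx; nra.
- have /(ler_wpM2l x2) := @K_lip (M * `|x|) M (mulr_gt0 M0 ax0) (ler_piMr (ltW M0) x1).
  rewrite distrC => /le_trans; apply.
  by rewrite mulrA ler_pM2r// mulrBr xx; nra.
Qed.

Let K_scale M x : 0 < M ->
  `|x ^+ 2 * F (M * `|x|) - xlnx2 x / 2 - x ^+ 2 * (F M - (M ^+ 2)^-1 / 2)|
    <= (M ^+ 2)^-1 * (1 + x ^+ 2).
Proof.
move=> M0; have M2 : 0 < (M ^+ 2)^-1 by rewrite invr_gt0 exprn_gt0.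
have [->|x0] := eqVneq x 0.
  rewrite /xlnx2 expr0n/= !mul0r !subr0 normr0; nra.
have ax0 : 0 < `|x| by rewrite normr_gt0.
have xx : x ^+ 2 * ((M * `|x|) ^+ 2)^-1 = (M ^+ 2)^-1.
  by rewrite exprMn real_normK ?num_real// invfM mulrCA divff ?mulr1// expf_neq0.
have -> : x ^+ 2 * F (M * `|x|) - xlnx2 x / 2 - x ^+ 2 * (F M - (M ^+ 2)^-1 / 2)
    = x ^+ 2 * (K (M * `|x|) - K M) + (M ^+ 2)^-1 / 2.
  rewrite /K -xx /xlnx2 lnM//; ring.
have := K_lip_scale M0 x0.
have x2 := sqr_ge0 x.
rewrite !ler_norml => /andP[? ?]; apply/andP; split; nra.
Qed.

(** The function Q t = \sum w x^2 F (t |x|) has derivative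
    (\sum w cos (t x)) / t^3, because the mass and the second moment of the
    signed measure vanish. So Q is nondecreasing; it tends to 0 at 0 and to
    half of the conclusion at infinity. *)
Lemma primitive_comparison (mu : seq (R * R)) :
  \sum_(p <- mu) p.1 = 0 -> \sum_(p <- mu) p.1 * p.2 ^+ 2 = 0 ->
  (forall t, 0 < t -> 0 <= \sum_(p <- mu) p.1 * cos (t * p.2)) ->
  0 <= \sum_(p <- mu) p.1 * xlnx2 p.2.
Proof.
move=> mu0 mu2 mucos.
pose Q t := \sum_(p <- mu) p.1 * (p.2 ^+ 2 * F (t * `|p.2|)).
pose C := \sum_(p <- mu) `|p.1| * (1 + p.2 ^+ 2 + p.2 ^+ 4).
have C0 : 0 <= C.
  by apply: sumr_ge0 => p _; rewrite mulr_ge0// !addr_ge0// ?sqr_ge0// exprn_even_ge0.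
have Qmono a b : 0 < a -> a <= b -> Q a <= Q b.
  move=> a0 ab.
  apply: (@has_deriv_ndecr _ Q (fun t => (\sum_(p <- mu) p.1 * cos (t * p.2)) / t ^+ 3)) => //.
  - move=> t /andP[at_ _]; have t0 : 0 < t by lra.
    have -> : (\sum_(p <- mu) p.1 * cos (t * p.2)) / t ^+ 3 =
       \sum_(p <- mu) p.1 * (p.2 ^+ 2 * (cos_rem (t * `|p.2|) * `|p.2|)).
      transitivity (\sum_(p <- mu) (p.1 * cos (t * p.2) - p.1 + p.1 * p.2 ^+ 2 * (t ^+ 2 / 2)) / t ^+ 3).
        by rewrite -mulr_suml !big_split/= -mulr_suml mu2 mul0r addr0 sumrN mu0 subr0.
      apply: eq_bigr => -[w x] _ /=.
      have [->|x0] := eqVneq x 0.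
        by rewrite normr0 !mulr0 cos0 expr0n/=; ring.
      have cosn : cos (t * `|x|) = cos (t * x).
        by case: (ger0P x) => _; rewrite ?mulrN ?cosN.
      rewrite /cos_rem cosn.
      have ax : `|x| != 0 by rewrite normr_eq0.
      have -> : x ^+ 2 = `|x| ^+ 2 by rewrite real_normK ?num_real.
      by field; rewrite ax gt_eqF.
    rewrite /Q; elim: (mu) => [|p s IH].
      under [in X in has_deriv X]eq_fun do rewrite big_nil.
      rewrite big_nil; exact: has_deriv_cst.
    under [in X in has_deriv X]eq_fun do rewrite big_cons.
    rewrite big_cons; apply: has_derivD => //.
    apply: has_deriv_eq.
      apply: has_derivM; first exact: has_deriv_cst.
      apply: has_derivM; first exact: has_deriv_cst.
      apply: (@has_deriv_comp _ (fun t => t * `|p.2|) F); first by has_deriv.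
      by apply: dF; rewrite mulr_ge0// ltW.
    by rewrite /=; ring.
  - move=> t /andP[at_ _]; have t0 : 0 < t by lra.
    by rewrite divr_ge0 ?mucos// exprn_ge0// ltW.
have Qsmall e : 0 < e -> `|Q e| <= e ^+ 2 * C.
  move=> e0; rewrite (le_trans (ler_norm_sum _ _ _))// mulr_sumr ler_sum// => p _.
  rewrite normrM [leRHS]mulrCA ler_wpM2l// ger0_norm; last first.
    by rewrite mulr_ge0 ?sqr_ge0//; case/andP: (primitive_bound (mulr_ge0 (ltW e0) (normr_ge0 p.2))).
  case/andP: (primitive_bound (mulr_ge0 (ltW e0) (normr_ge0 p.2))) => _.
  rewrite exprMn real_normK ?num_real// => /(ler_wpM2l (sqr_ge0 p.2)) /le_trans; apply.
  have -> : p.2 ^+ 2 * (e ^+ 2 * p.2 ^+ 2) = e ^+ 2 * p.2 ^+ 4 by ring.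
  by rewrite ler_wpM2l ?sqr_ge0// lerDr addr_ge0// sqr_ge0.
have Qlarge M : 0 < M -> Q M <= (\sum_(p <- mu) p.1 * xlnx2 p.2) / 2 + (M ^+ 2)^-1 * C.
  move=> M0; rewrite -lerBlDl.
  have -> : Q M - (\sum_(p <- mu) p.1 * xlnx2 p.2) / 2 =
    \sum_(p <- mu) p.1 * (p.2 ^+ 2 * F (M * `|p.2|) - xlnx2 p.2 / 2 - p.2 ^+ 2 * (F M - (M ^+ 2)^-1 / 2)).
    transitivity (Q M - (\sum_(p <- mu) p.1 * xlnx2 p.2) / 2
       - (\sum_(p <- mu) p.1 * p.2 ^+ 2) * (F M - (M ^+ 2)^-1 / 2)).
      by rewrite mu2 mul0r subr0.
    rewrite /Q !mulr_suml -!sumrB; apply: eq_bigr => p _; ring.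
  rewrite mulr_sumr; apply: ler_sum => p _.
  rewrite (le_trans (ler_norm _))// normrM [leRHS]mulrCA ler_wpM2l//.
  apply: le_trans (K_scale _ M0) _; rewrite ler_wpM2l ?invr_ge0 ?sqr_ge0//.
  by rewrite lerDl exprn_even_ge0.
set S := \sum_(p <- mu) _ in Qlarge *.
have HS e : 0 < e -> e <= 1 -> - (4 * e ^+ 2 * C) <= S.
  move=> e0 e1.
  have H := Qsmall e e0; move: H; rewrite ler_norml => /andP[H _].
  have H2 := Qlarge e^-1; rewrite invr_gt0 exprVn invrK in H2.
  have H3 : Q e <= Q e^-1.
    by apply: Qmono => //; apply: (le_trans e1); rewrite -[leLHS]invr1 lef_pV2 ?posrE.
  by have := H2 e0; lra.
rewrite leNgt; apply/negP => S0.
pose e := Num.min 1 (- S / (8 * (C + 1))).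
have e0 : 0 < e by rewrite lt_min ltr01 divr_gt0//; lra.
have e1 : e <= 1 by rewrite ge_min lexx.
have e2 : e <= - S / (8 * (C + 1)) by rewrite ge_min lexx orbT.
have := HS e e0 e1; rewrite ler_pdivlMr in e2; last lra.
nra.
Qed.

End Primitive.

Lemma xlnx2_comparison (mu : seq (R * R)) :
  \sum_(p <- mu) p.1 = 0 -> \sum_(p <- mu) p.1 * p.2 ^+ 2 = 0 ->
  (forall t, 0 < t -> 0 <= \sum_(p <- mu) p.1 * cos (t * p.2)) ->
  0 <= \sum_(p <- mu) p.1 * xlnx2 p.2.
Proof. by have [F F0 dF] := @ex_primitive R; exact: primitive_comparison F0 dF mu. Qed.

End LogComparison.

(** * Averages over signs and phases *)

Section PhaseAverage.
Context {R : realType} {K : numFieldType}.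
Variable G : seq K.
Implicit Types (s : seq K) (F H : K -> R) (x a : K).

(** The expectation of F (x + g_1 a_1 + ... + g_k a_k) for independent g_i
    uniform on G. The recursion removes one summand at a time, which is how
    all moments below are computed. *)
Fixpoint phase_avg s F x : R :=
  if s is a :: s' then (\sum_(g <- G) phase_avg s' F (x + g * a)) / (size G)%:R
  else F x.

Lemma eq_phase_avg s F H x : F =1 H -> phase_avg s F x = phase_avg s H x.
Proof.
move=> FH; elim: s x => [|a s IH] x /=; first exact: FH.
by congr (_ / _); apply: eq_bigr => g _; exact: IH.
Qed.

Lemma phase_avgD s F H x :
  phase_avg s (fun z => F z + H z) x = phase_avg s F x + phase_avg s H x.
Proof.
elim: s x => [|a s IH] x //=.
by rewrite -mulrDl -big_split; congr (_ / _); apply: eq_bigr.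
Qed.

Lemma phase_avgZ s c F x : phase_avg s (fun z => c * F z) x = c * phase_avg s F x.
Proof.
elim: s x => [|a s IH] x //=.
by rewrite mulrA; congr (_ / _); rewrite mulr_sumr; apply: eq_bigr.
Qed.

Lemma le_phase_avg s F H x : (forall z, F z <= H z) ->
  phase_avg s F x <= phase_avg s H x.
Proof.
move=> FH; elim: s x => [|a s IH] x /=; first exact: FH.
by rewrite ler_wpM2r ?invr_ge0// ler_sum.
Qed.

Hypothesis G0 : (0 < size G)%N.

Lemma phase_avg_cst s c x : phase_avg s (fun=> c) x = c.
Proof.
elim: s x => [|a s IH] x //=.
rewrite (eq_bigr (fun=> c)); last by move=> *; exact: IH.
by rewrite big_const_seq count_predT iter_addr_0 -(mulr_natr c) mulfK// pnatr_eq0 -lt0n.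
Qed.

End PhaseAverage.

Section Rademacher.
Context {R : realType}.
Implicit Types (s : seq R) (F H : R -> R) (x a t : R).

Definition rad s F x : R := phase_avg [:: 1; -1] s F x.
#[global] Arguments rad : simpl never.

Lemma rad_cons a s F x : rad (a :: s) F x = (rad s F (x + a) + rad s F (x - a)) / 2.
Proof. by rewrite /rad/= !big_cons big_nil addr0 mul1r mulN1r. Qed.

Lemma eq_rad s F H x : F =1 H -> rad s F x = rad s H x.
Proof. exact: eq_phase_avg. Qed.

Lemma radD s F H x : rad s (fun z => F z + H z) x = rad s F x + rad s H x.
Proof. exact: phase_avgD. Qed.

Lemma radZ s c F x : rad s (fun z => c * F z) x = c * rad s F x.
Proof. exact: phase_avgZ. Qed.

Lemma le_rad s F H x : (forall z, F z <= H z) -> rad s F x <= rad s H x.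
Proof. exact: le_phase_avg. Qed.

Lemma rad_cst s c x : rad s (fun=> c) x = c.
Proof. exact: phase_avg_cst. Qed.

Lemma rad_cos s t x :
  rad s (fun z => cos (t * z)) x = cos (t * x) * \prod_(a <- s) cos (t * a).
Proof.
elim: s x => [|a s IH] x; first by rewrite big_nil mulr1.
rewrite rad_cons !IH big_cons mulrDr mulrBr cosD cosB; by field.
Qed.

Lemma rad_sqr s x : rad s (fun z => z ^+ 2) x = x ^+ 2 + \sum_(a <- s) a ^+ 2.
Proof.
elim: s x => [|a s IH] x; first by rewrite big_nil addr0.
by rewrite rad_cons !IH big_cons; field.
Qed.

(** The right-hand side is the fourth moment of a Gaussian variable with the
    same mean and variance. *)
Lemma rad_pow4 s x : rad s (fun z => z ^+ 4) x <=
  x ^+ 4 + 6 * x ^+ 2 * (\sum_(a <- s) a ^+ 2) + 3 * (\sum_(a <- s) a ^+ 2) ^+ 2.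
Proof.
elim: s x => [|a s IH] x; first by rewrite big_nil /rad/= expr0n/= !mulr0 !addr0.
rewrite rad_cons big_cons; set V := \sum_(_ <- s) _ in IH *.
have := IH (x + a); have := IH (x - a).
have : 0 <= a ^+ 4 by rewrite exprn_even_ge0.
have -> : (x + a) ^+ 4 = x ^+ 4 + 4 * x ^+ 3 * a + 6 * x ^+ 2 * a ^+ 2 + 4 * x * a ^+ 3 + a ^+ 4 by ring.
have -> : (x - a) ^+ 4 = x ^+ 4 - 4 * x ^+ 3 * a + 6 * x ^+ 2 * a ^+ 2 - 4 * x * a ^+ 3 + a ^+ 4 by ring.
have -> : 6 * (x + a) ^+ 2 * V = 6 * x ^+ 2 * V + 12 * x * a * V + 6 * a ^+ 2 * V by ring.
have -> : 6 * (x - a) ^+ 2 * V = 6 * x ^+ 2 * V - 12 * x * a * V + 6 * a ^+ 2 * V by ring.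
have -> : 6 * x ^+ 2 * (a ^+ 2 + V) = 6 * x ^+ 2 * a ^+ 2 + 6 * x ^+ 2 * V by ring.
have -> : 3 * (a ^+ 2 + V) ^+ 2 = 3 * a ^+ 4 + 6 * a ^+ 2 * V + 3 * V ^+ 2 by ring.
by lra.
Qed.

Lemma rad_swap a b s F x : rad [:: a, b & s] F x = rad [:: b, a & s] F x.
Proof.
by rewrite !rad_cons (addrAC x a b) (addrAC x (- a) b) (addrAC x a (- b)) (addrAC x (- a) (- b)) -!mulrDl; congr (_ / _ / _); rewrite addrACA.
Qed.

Lemma eq_rad_cons a s s' F x : (forall x, rad s F x = rad s' F x) ->
  rad (a :: s) F x = rad (a :: s') F x.
Proof. by move=> E; rewrite !rad_cons !E. Qed.

Lemma rad_move a s1 s2 F x : rad (s1 ++ a :: s2) F x = rad (a :: s1 ++ s2) F x.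
Proof.
elim: s1 x => [//|b s1 IH] x; rewrite !cat_cons (rad_swap a b).
exact: eq_rad_cons.
Qed.

Lemma rad_filter0 s F x : rad [seq a <- s | a != 0] F x = rad s F x.
Proof.
elim: s x => [//|a s IH] x /=; have [->|a0] := eqVneq a 0.
  by rewrite /= rad_cons addr0 subr0 IH; field.
by rewrite /= !rad_cons !IH.
Qed.

(** Signed measures of finite support, given by their integrals. *)
Definition finitary (L : (R -> R) -> R) :=
  exists mu : seq (R * R), forall F, L F = \sum_(p <- mu) p.1 * F p.2.

Lemma finitaryD L M : finitary L -> finitary M -> finitary (fun F => L F + M F).
Proof.
by move=> [m mE] [n nE]; exists (m ++ n) => F; rewrite mE nE big_cat.
Qed.

Lemma finitaryZ c L : finitary L -> finitary (fun F => c * L F).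
Proof.
move=> [m mE]; exists [seq (c * p.1, p.2) | p <- m] => F.
by rewrite mE big_map mulr_sumr; apply: eq_bigr => p _; rewrite mulrA.
Qed.

Lemma finitary_sum (T : Type) (r : seq T) (L : T -> (R -> R) -> R) :
  (forall i, finitary (L i)) -> finitary (fun F => \sum_(i <- r) L i F).
Proof.
move=> LF; elim: r => [|i r IH].
  by exists [::] => F; rewrite !big_nil.
have [m mE] := finitaryD (LF i) IH.
by exists m => F; rewrite big_cons mE.
Qed.

Lemma finitary_rad s x : finitary (fun F => rad s F x).
Proof.
elim: s x => [|a s IH] x; first by exists [:: (1, x)] => F; rewrite big_seq1/= mul1r.
have [m mE] := finitaryZ 2^-1 (finitaryD (IH (x + a)) (IH (x - a))).
by exists m => F; rewrite rad_cons mulrC mE.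
Qed.

Lemma finitary_comparison L : finitary L ->
  L (fun=> 1) = 0 -> L (fun x => x ^+ 2) = 0 ->
  (forall t, 0 < t -> 0 <= L (fun x => cos (t * x))) -> 0 <= L xlnx2.
Proof.
move=> [m mE] L0 L2 Lc; rewrite mE; apply: xlnx2_comparison.
- by rewrite -[RHS]L0 mE; apply: eq_bigr => p _; rewrite mulr1.
- by rewrite -[RHS]L2 mE.
- by move=> t t0; have := Lc t t0; rewrite mE.
Qed.

(** Weighted arithmetic-geometric mean inequality with weights 1 / (2 sigma),
    stated for absolute values so that it applies to a product of cosines: the
    powers that appear are powers of the squares. *)
Lemma amgm_powR (T : Type) (r : seq T) (c sigma : T -> R) :
  (forall i, 0 < sigma i) -> \sum_(i <- r) (2 * sigma i)^-1 = 1 ->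
  \prod_(i <- r) `|c i| <= \sum_(i <- r) (2 * sigma i)^-1 * (c i ^+ 2) `^ sigma i.
Proof.
move=> s0 s1; set P := \prod_(i <- r) _.
have P0 : 0 <= P by apply: prodr_ge0 => i _.
have T0 i : 0 <= (2 * sigma i)^-1 by rewrite invr_ge0 mulr_ge0// ltW.
have [->|/negPf Pn0] := eqVneq P 0.
  by apply: sumr_ge0 => i _; rewrite mulr_ge0// powR_ge0.
have {P0} Ppos : 0 < P by rewrite lt_neqAle eq_sym Pn0.
have cn0 : all (fun i => c i != 0) r.
  move: Pn0; rewrite /P; elim: (r) => [//|i l IH]; rewrite big_cons mulf_eq0 normr_eq0.
  by move/negbT; rewrite negb_or => /andP[ci /negPf /IH]/= ->; rewrite ci.
have lnP : ln P = \sum_(i <- r) ln `|c i|.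
  move: cn0; rewrite /P; elim: (r) => [|i l IH]; first by rewrite !big_nil ln1.
  move=> /= /andP[ci cl]; rewrite !big_cons lnM ?posrE ?normr_gt0// ?IH//.
  have : \prod_(j <- l) `|c j| != 0.
    by move: cl {IH}; elim: l => [|j l IH]; rewrite ?big_nil ?oner_eq0//= big_cons => /andP[cj /IH cl]; rewrite mulf_neq0// normr_eq0.
  by move=> h; rewrite lt_neqAle eq_sym h prodr_ge0.
have -> : P = \sum_(i <- r) (2 * sigma i)^-1 * (P * (1 + (2 * sigma i * ln `|c i| - ln P))).
  have -> : \sum_(i <- r) (2 * sigma i)^-1 * (P * (1 + (2 * sigma i * ln `|c i| - ln P))) =
    \sum_(i <- r) ((2 * sigma i)^-1 * (P * (1 - ln P)) + P * ln `|c i|).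
    by apply: eq_bigr => i _; field; rewrite gt_eqF.
  rewrite big_split/= -mulr_suml s1 -mulr_sumr -lnP; ring.
elim: (r) cn0 => [|i l IH]/=; first by rewrite !big_nil.
move=> /andP[ci cl]; rewrite !big_cons lerD ?IH// ler_wpM2l//.
have -> : (c i ^+ 2) `^ sigma i = P * expR (2 * sigma i * ln `|c i| - ln P).
  rewrite expRB lnK ?posrE// mulrCA divff ?Pn0// mulr1.
  rewrite /powR expf_eq0/= (negPf ci) -(real_normK (num_real (c i))) lnXn ?normr_gt0//.
  by congr expR; rewrite mulr2n; ring.
by rewrite ler_pM2l// expR_ge1Dx.
Qed.

End Rademacher.

(** * Logarithms and harmonic numbers *)

Section Harmonic.
Context {R : realType}.

Definition harm (n : nat) : R := \sum_(i < n) i.+1%:R^-1.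

Lemma harm0 : harm 0 = 0. Proof. exact: big_ord0. Qed.

Lemma harmS n : harm n.+1 = harm n + n.+1%:R^-1.
Proof. exact: big_ord_recr. Qed.

Let h k : R := harm k.-1 + (2 * k%:R)^-1.
(** This sequence and the next tend to the Euler constant. The difference
    harm (k - 1) + 1 / (2 k) - ln k is smaller than the limit by
    1 / (12 k^2) - 1 / (120 k^4) + ...; correcting it by 1 / (12 k^2) overshoots
    and gives a decreasing sequence, and the slightly smaller correction gives
    an increasing one. Bounds for ln k follow from the values at k = 4 of both. *)
Definition euler_up (k : nat) : R := harm k.-1 + (2 * k%:R)^-1 - ln k%:R + (12 * k%:R ^+ 2)^-1.
Definition euler_dn (k : nat) : R := harm k.-1 + (2 * k%:R)^-1 - ln k%:R + (12 * k%:R ^+ 2 + 3 / 2)^-1.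

Let hS k : (0 < k)%N -> h k.+1 = h k + (k%:R^-1 + k.+1%:R^-1) / 2.
Proof.
case: k => [//|k] _; rewrite /h/= harmS.
have k0 : (0 : R) <= k%:R by [].
by rewrite -!natr1; field; rewrite !gt_eqF//; lra.
Qed.

Let lnS k : (0 < k)%N -> ln k.+1%:R = ln k%:R + ln (1 + k%:R^-1) :> R.
Proof.
move=> k0; have k0' : (0 : R) < k%:R by rewrite ltr0n.
have k1 : 0 < 1 + k%:R^-1 :> R by rewrite addr_gt0// invr_gt0.
rewrite -lnM ?posrE//.
by rewrite mulrDr mulr1 divff ?gt_eqF// natr1.
Qed.

Lemma euler_up_decr k : (0 < k)%N -> euler_up k.+1 <= euler_up k.
Proof.
move=> k0; rewrite /euler_up -/(h k.+1) -/(h k) hS// lnS//.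
have k0' : (0 : R) < k%:R by rewrite ltr0n.
have ki : (0 : R) <= k%:R^-1 by rewrite invr_ge0 ltW.
have := ln1D_ge_cubic ki; rewrite -(natr1 k); move: (k%:R) k0' ki => x x0 xi.
move: (h k) (ln x) (ln (1 + x^-1)) => H l L HL.
rewrite -subr_ge0.
have E : 0 <= (12 * x ^+ 2)^-1 - (12 * (x + 1) ^+ 2)^-1 + (2 * x^-1 / (2 + x^-1) + 2 / 3 * x^-1 ^+ 3 / (2 + x^-1) ^+ 3)
    - (x^-1 + (x + 1)^-1) / 2.
  have -> : (12 * x ^+ 2)^-1 - (12 * (x + 1) ^+ 2)^-1 + (2 * x^-1 / (2 + x^-1) + 2 / 3 * x^-1 ^+ 3 / (2 + x^-1) ^+ 3)
    - (x^-1 + (x + 1)^-1) / 2 = ((2 * x + 1) ^+ 2 + 1) / (24 * x ^+ 2 * (x + 1) ^+ 2 * (2 * x + 1) ^+ 3).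
    by field; rewrite !gt_eqF//; lra.
  by rewrite divr_ge0// ?mulr_ge0 ?exprn_ge0//; nra.
lra.
Qed.

Lemma euler_dn_incr k : (0 < k)%N -> euler_dn k <= euler_dn k.+1.
Proof.
move=> k0; rewrite /euler_dn -/(h k.+1) -/(h k) hS// lnS//.
have k0' : (0 : R) < k%:R by rewrite ltr0n.
have ki : (0 : R) <= k%:R^-1 by rewrite invr_ge0 ltW.
have := ln1D_le_cubic ki; rewrite -(natr1 k); move: (k%:R) k0' ki => x x0 xi.
move: (h k) (ln x) (ln (1 + x^-1)) => H l L HL.
rewrite -subr_ge0.
pose q : R := x ^+ 2 + x.
have x2 : 0 < x ^+ 2 by rewrite exprn_gt0.
have E : 0 <= (12 * (x + 1) ^+ 2 + 3 / 2)^-1 - (12 * x ^+ 2 + 3 / 2)^-1 + (x^-1 + (x + 1)^-1) / 2 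
   - (2 * x^-1 / (2 + x^-1) + x^-1 ^+ 3 / (6 * (2 + x^-1) * (1 + x^-1))).
  have -> : (12 * (x + 1) ^+ 2 + 3 / 2)^-1 - (12 * x ^+ 2 + 3 / 2)^-1 + (x^-1 + (x + 1)^-1) / 2 
   - (2 * x^-1 / (2 + x^-1) + x^-1 ^+ 3 / (6 * (2 + x^-1) * (1 + x^-1))) = 
   (27 / 4) / ((2 * x + 1) * x * (x + 1) * (12 * x ^+ 2 + 3 / 2) * (12 * (x + 1) ^+ 2 + 3 / 2)).
    by field; rewrite !gt_eqF//; nra.
  by rewrite divr_ge0// ?mulr_ge0 ?addr_ge0 ?mulr_ge0 ?exprn_ge0//; nra.
lra.
Qed.

Lemma euler_up_anti i j : (0 < i)%N -> (i <= j)%N -> euler_up j <= euler_up i.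
Proof.
move=> i0 /subnKC <-; elim: (j - i)%N => [|k IH]; first by rewrite addn0.
by rewrite addnS (le_trans _ IH)// euler_up_decr// addn_gt0 i0.
Qed.

Lemma euler_dn_mono i j : (0 < i)%N -> (i <= j)%N -> euler_dn i <= euler_dn j.
Proof.
move=> i0 /subnKC <-; elim: (j - i)%N => [|k IH]; first by rewrite addn0.
by rewrite addnS (le_trans IH)// euler_dn_incr// addn_gt0 i0.
Qed.

Lemma euler_dn_le_up i j : (0 < i)%N -> (0 < j)%N -> euler_dn i <= euler_up j.
Proof.
move=> i0 j0; have dnup k : (0 < k)%N -> euler_dn k <= euler_up k.
  move=> k0; rewrite /euler_dn /euler_up lerD2l lef_pV2 ?posrE; first by rewrite lerDl.
  - by rewrite addr_gt0// mulr_gt0// exprn_gt0// ltr0n.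
  - by rewrite mulr_gt0// exprn_gt0// ltr0n.
apply: le_trans (euler_dn_mono i0 (leq_maxl i j)) _.
apply: le_trans (euler_up_anti j0 (leq_maxr i j)).
by apply: dnup; rewrite leq_max i0.
Qed.

Lemma ln_nat_le k : (0 < k)%N ->
  ln k%:R <= harm k.-1 + (2 * k%:R)^-1 + (12 * k%:R ^+ 2)^-1 - euler_dn 4.
Proof. by move=> k0; have := @euler_dn_le_up 4 k isT k0; rewrite /euler_up; lra. Qed.

Lemma ln_nat_ge k : (4 <= k)%N -> harm k.-1 + (2 * k%:R)^-1 - euler_up 4 <= ln k%:R.
Proof.
move=> k4; have := @euler_up_anti 4 k isT k4; rewrite /euler_up.
have : 0 <= (12 * k%:R ^+ 2)^-1 :> R by rewrite invr_ge0 mulr_ge0// exprn_ge0.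
lra.
Qed.

Lemma harm_le_ln k : (0 < k)%N -> harm k.-1 <= ln k%:R + 7 / 12.
Proof.
move=> k0; have := @euler_up_anti 1 k isT k0; rewrite /euler_up harm0 ln1 expr1n !mulr1.
have : 0 <= (12 * k%:R ^+ 2)^-1 :> R by rewrite invr_ge0 mulr_ge0// exprn_ge0.
have : 0 <= (2 * k%:R)^-1 :> R by rewrite invr_ge0 mulr_ge0.
lra.
Qed.

End Harmonic.

(** * Harmonic sums along a binomial row *)

Section Binomial.
Context {R : realType}.
Implicit Types (n j k : nat) (w : nat -> R).

(** The upper half of an odd binomial row, whose two equal middle
    entries are at j = 0 and j = 1. *)
Let e n j : R := 'C(n.*2.+1, n + j)%:R.

Let e_out n j : (n.+1 < j)%N -> e n j = 0.
Proof. by move=> nj; rewrite /e bin_small// -addnn -addSn addSnnS ltn_add2l. Qed.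

Let e_sym n : e n 0 = e n 1.
Proof.
rewrite /e addn0 addn1 -bin_sub; last by rewrite -addnn ltnW// ltnS leq_addr.
by rewrite -addnn subSn ?leq_addr// addnK.
Qed.

Let e_pascal n j : e n.+1 j.+1 = e n j.+2 + 2 * e n j.+1 + e n j.
Proof.
by rewrite /e doubleS !addnS addSn [in LHS]binS !(binS n.*2.+1 (n + j)) !(binS n.*2.+1 (n + j).+1) !natrD; ring.
Qed.

(** Two steps of Pascal's rule, followed by a summation by parts. *)
Lemma half_row_rec n w :
  \sum_(j < n.+2) e n.+1 j.+1 * w j = 4 * (\sum_(j < n.+1) e n j.+1 * w j)
    + \sum_(j < n.+1) (e n j.+1 - e n j.+2) * (w j.+1 - w j).
Proof.
under eq_bigr do rewrite e_pascal !mulrDl -mulrA.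
rewrite !big_split/= -mulr_sumr.
have S1 : \sum_(j < n.+2) e n j.+1 * w j = \sum_(j < n.+1) e n j.+1 * w j.
  by rewrite big_ord_recr/= e_out// mul0r addr0.
have S2 : \sum_(j < n.+2) e n j.+2 * w j = \sum_(j < n.+1) e n j.+2 * w j.
  by rewrite big_ord_recr/= e_out// mul0r addr0.
have S0 : \sum_(j < n.+2) e n j * w j = e n 1 * w 0 + \sum_(j < n.+1) e n j.+1 * w j.+1.
  by rewrite big_ord_recl e_sym.
have S3 : \sum_(j < n.+1) e n j.+1 * w j = e n 1 * w 0 + \sum_(j < n.+1) e n j.+2 * w j.+1.
  rewrite big_ord_recl; congr (_ + _).
  by rewrite [RHS]big_ord_recr/= e_out// mul0r addr0.
rewrite S1 S2 S0.
have -> : \sum_(j < n.+1) (e n j.+1 - e n j.+2) * (w j.+1 - w j) =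
  \sum_(j < n.+1) e n j.+1 * w j.+1 - \sum_(j < n.+1) e n j.+1 * w j
  - \sum_(j < n.+1) e n j.+2 * w j.+1 + \sum_(j < n.+1) e n j.+2 * w j.
  by rewrite -!sumrB -big_split; apply: eq_bigr => j _ /=; ring.
rewrite S3; ring.
Qed.

Lemma half_row_sum n : \sum_(j < n.+1) e n j.+1 = 4 ^+ n.
Proof.
elim: n => [|n IH]; first by rewrite big_ord1 /e.
have := half_row_rec n (fun=> 1).
under eq_bigr do rewrite mulr1.
under [in X in _ = _ * X + _]eq_bigr do rewrite mulr1.
rewrite IH exprS => ->.
by rewrite big1 ?addr0// => j _; rewrite subrr mulr0.
Qed.

(** The probability that a simple random walk is back at 0 at time 2 n. *)
Definition cbin n : R := 'C(n.*2, n)%:R / 4 ^+ n.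

Let cbin_e n : e n 1 = 2 * 4 ^+ n * cbin n.+1.
Proof.
rewrite /cbin /e doubleS addn1 (binS n.*2.+1 n).
have -> : 'C(n.*2.+1, n) = 'C(n.*2.+1, n.+1).
  rewrite -bin_sub; last by rewrite -addnn ltnW// ltnS leq_addr.
  by rewrite -addnn subSn ?leq_addr// addnK.
rewrite natrD exprS.
have : (4 : R) ^+ n != 0 by rewrite expf_neq0// pnatr_eq0.
move: (4 ^+ n) => z z0.
by field.
Qed.

Let c_e n j : j.+1%:R * 'C(n.+1.*2, n.+1 + j.+1)%:R = n.+1%:R * (e n j.+1 - e n j.+2).
Proof.
have H1 : ((n.+1 + j.+1) * 'C(n.+1.*2, n.+1 + j.+1) = 2 * n.+1 * 'C(n.*2.+1, n + j.+1))%N.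
  by rewrite mul2n addSn doubleS mul_bin_diag.
have H2 : n.+1%:R * 'C(n.+1.*2, n.+1 + j.+1)%:R = n.+1%:R * (e n j.+1 + e n j.+2) :> R.
  by congr (_ * _); rewrite doubleS addSn binS natrD /e addrC !addnS.
move/(congr1 (fun z : nat => z%:R : R)): H1.
rewrite !natrM natrD mulrDl H2 -/(e n j.+1).
by move=> H1; apply: (addrI (n.+1%:R * (e n j.+1 + e n j.+2))); rewrite H1; ring.
Qed.

Lemma half_row_even_sum n : \sum_(j < n.+1) 'C(n.+1.*2, n.+1 + j.+1)%:R = 2 * 4 ^+ n * (1 - cbin n.+1) :> R.
Proof.
have -> : \sum_(j < n.+1) 'C(n.+1.*2, n.+1 + j.+1)%:R = \sum_(j < n.+1) (e n j.+1 + e n j.+2).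
  by apply: eq_bigr => j _; rewrite doubleS addSn binS natrD /e addrC !addnS.
rewrite big_split/= half_row_sum.
have := half_row_sum n; rewrite big_ord_recl/= cbin_e => H.
have -> : \sum_(j < n.+1) e n j.+2 = \sum_(j < n) e n (bump 0 j).+1.
  by rewrite big_ord_recr/= e_out// addr0.
by rewrite mulrBr mulr1; lra.
Qed.

Lemma half_row_harm n : \sum_(j < n.+1) e n j.+1 * harm j =
  4 ^+ n * \sum_(i < n) (1 - cbin i.+1) / (2 * i.+1%:R).
Proof.
elim: n => [|n IH]; first by rewrite big_ord1 big_ord0 harm0 !mulr0.
rewrite half_row_rec IH [in RHS]big_ord_recr/= exprS mulrDr; congr (_ + _); first by rewrite mulrA.
transitivity (\sum_(j < n.+1) 'C(n.+1.*2, n.+1 + j.+1)%:R / n.+1%:R : R).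
    apply: eq_bigr => j _; have -> : harm j.+1 - harm j = j.+1%:R^-1 :> R by rewrite harmS; ring.
  apply: (mulfI (_ : n.+1%:R * j.+1%:R != 0 :> R)); first by rewrite mulf_neq0 ?pnatr_eq0.
  have := c_e n j; move: ('C(_, _)%:R) (e n _) (e n _) => c a b H.
  transitivity (n.+1%:R * (b - a)); first by field; rewrite ?gt_eqF//; have := ler0n R j; lra.
  by rewrite -H; field; rewrite ?gt_eqF//; have := ler0n R n; lra.
rewrite -mulr_suml half_row_even_sum; field.
by rewrite ?gt_eqF//; have := ler0n R n; lra.
Qed.

(** The moment of x^2 ln |x| for the random walk, with ln k replaced by its
    approximation harm (k - 1) + 1 / (2 k), has a closed form: k times a
    binomial coefficient telescopes, and a summation by parts then turns the
    harmonic numbers into the sums of half_row_harm. *)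
Lemma binomial_harm n :
  \sum_(j < n.+1) 'C(n.+1.*2, n.+1 + j.+1)%:R * (j.+1%:R ^+ 2 * (harm j + (2 * j.+1%:R)^-1))
   = n.+1%:R * 4 ^+ n * (\sum_(i < n) (1 - cbin i.+1) / (2 * i.+1%:R) + 1 - cbin n.+1) :> R.
Proof.
pose g j : R := j%:R * harm j.-1 + 2^-1.
transitivity (n.+1%:R * \sum_(j < n.+1) (e n j.+1 - e n j.+2) * g j.+1).
  rewrite mulr_sumr; apply: eq_bigr => j _; rewrite [in RHS]mulrA -c_e /g/=.
  by field; rewrite ?gt_eqF//; have := ler0n R j; lra.
have abel N : \sum_(j < N.+1) (e n j.+1 - e n j.+2) * g j.+1 =
  \sum_(j < N.+1) e n j.+1 * (harm j + 1) - e n 1 / 2 - e n N.+2 * g N.+1.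
  elim: N => [|N IH]; first by rewrite !big_ord1 /g/= harm0; field.
  rewrite big_ord_recr IH [X in _ = X - _ - _]big_ord_recr/= /g/= harmS -!natr1.
  by field; rewrite gt_eqF//; have : (0 : R) <= N%:R by []; lra.
rewrite abel (@e_out n n.+2)// mul0r subr0 cbin_e.
have -> : \sum_(j < n.+1) e n j.+1 * (harm j + 1) = \sum_(j < n.+1) e n j.+1 * harm j + \sum_(j < n.+1) e n j.+1.
  by rewrite -big_split; apply: eq_bigr => j _; rewrite mulrDr mulr1.
by rewrite half_row_harm half_row_sum; field.
Qed.

End Binomial.

(** * The simple random walk *)

Section WalkEntropy.
Context {R : realType}.
Implicit Types (n j k nu : nat) (F : R -> R).

Lemma rad_nseq N F (x : R) : rad (nseq N 2^-1) F x =
  (\sum_(i < N.+1) 'C(N, i)%:R * F (x + N%:R / 2 - i%:R)) / 2 ^+ N.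
Proof.
elim: N x => [|N IH] x; first by rewrite big_ord1 bin0 mul1r !mul0r addr0 subr0 divr1.
rewrite /= rad_cons !IH.
have -> : \sum_(i < N.+2) 'C(N.+1, i)%:R * F (x + N.+1%:R / 2 - i%:R) =
  \sum_(i < N.+1) 'C(N, i)%:R * F (x + 2^-1 + N%:R / 2 - i%:R) +
  \sum_(i < N.+1) 'C(N, i)%:R * F (x - 2^-1 + N%:R / 2 - i%:R).
  rewrite big_ord_recl/= bin0 mul1r subr0.
  under eq_bigr do rewrite binS natrD mulrDl.
  rewrite big_split/= addrA; congr (_ + _).
    rewrite [RHS]big_ord_recl/= bin0 mul1r subr0 big_ord_recr/= bin_small// mul0r addr0.
    congr (F _ + _); first by rewrite -natr1; field.
    by apply: eq_bigr => i _; congr (_ * F _); rewrite -natr1; field.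
  by apply: eq_bigr => i _; congr (_ * F _); rewrite /bump/= add1n -!natr1; field.
by rewrite exprS; field; rewrite expf_neq0// pnatr_eq0.
Qed.

Lemma rad_nseq_even nu F : (forall x, F (- x) = F x) -> F 0 = 0 ->
  rad (nseq nu.*2 2^-1) F 0 =
  2 / 4 ^+ nu * \sum_(j < nu) 'C(nu.*2, nu + j.+1)%:R * F j.+1%:R.
Proof.
move=> FN F0; rewrite rad_nseq.
have -> : (2 : R) ^+ nu.*2 = 4 ^+ nu by rewrite -mul2n exprM; congr (_ ^+ _); rewrite expr2 -natrM.
have -> : \sum_(i < nu.*2.+1) 'C(nu.*2, i)%:R * F (0 + nu.*2%:R / 2 - i%:R) =
  \sum_(i < nu.*2.+1) 'C(nu.*2, i)%:R * F (nu%:R - i%:R).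
  have -> : nu.*2%:R / 2 = nu%:R :> R by rewrite -muln2 natrM mulfK.
  by under eq_bigr do rewrite add0r.
rewrite -(big_mkord xpredT (fun i => 'C(nu.*2, i)%:R * F (nu%:R - i%:R))).
have nu2 : (nu <= nu.*2.+1)%N by rewrite -addnn -addnS leq_addr.
have nu3 : (nu < nu.*2.+1)%N by rewrite -addnn ltnS leq_addr.
rewrite (big_cat_nat (n := nu))//= (big_ltn nu3)/=.
rewrite subrr F0 mulr0 add0r big_nat_rev/= add0n big_mkord.
have -> : \sum_(i < nu) 'C(nu.*2, nu - i.+1)%:R * F (nu%:R - (nu - i.+1)%:R) =
  \sum_(i < nu) 'C(nu.*2, nu + i.+1)%:R * F i.+1%:R.
  apply: eq_bigr => i _; have iN := ltn_ord i.
  congr (_%:R * F _).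
    by rewrite -[RHS]bin_sub -addnn ?leq_add2l// subnDl.
  by rewrite natrB// opprB addrC subrK.
have -> : \sum_(nu.+1 <= i < nu.*2.+1) 'C(nu.*2, i)%:R * F (nu%:R - i%:R) =
  \sum_(i < nu) 'C(nu.*2, nu + i.+1)%:R * F i.+1%:R.
  rewrite -{1}[nu.+1]add0n big_addn subSS -[in (nu.*2 - nu)%N]addnn addnK big_mkord.
  apply: eq_bigr => i _; rewrite addnS (addnC i) -addnS; congr (_ * _).
  by rewrite -[RHS]FN natrD opprD addrA subrr sub0r.
by rewrite mulrC mulrAC mulrDl; ring.
Qed.

(** Steps of size 1/2 make the positions after an even number of steps
    integers, so that only logarithms of integers occur; the factor 4 undoes
    the scaling in x^2. *)
Definition walk_xlnx2 nu : R := rad (nseq nu.*2 2^-1) (fun x : R => 4 * xlnx2 x) 0.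

Lemma walk_xlnx2E nu : walk_xlnx2 nu =
  8 / 4 ^+ nu * \sum_(j < nu) 'C(nu.*2, nu + j.+1)%:R * (j.+1%:R ^+ 2 * ln j.+1%:R).
Proof.
rewrite /walk_xlnx2 rad_nseq_even; first last.
- by rewrite /xlnx2 expr0n mul0r mulr0.
- by move=> x; rewrite /xlnx2 sqrrN normrN.
rewrite [X in _ * X = _](_ : _ =
  4 * \sum_(j < nu) 'C(nu.*2, nu + j.+1)%:R * (j.+1%:R ^+ 2 * ln j.+1%:R)).
  by ring.
by rewrite mulr_sumr; apply: eq_bigr => j _; rewrite /xlnx2 normr_nat; ring.
Qed.

Lemma sum_sqr_nseq N (a : R) : \sum_(b <- nseq N a) b ^+ 2 = N%:R * a ^+ 2.
Proof.
by elim: N => [|N IH]; rewrite ?big_nil ?mul0r//= big_cons IH -natr1; ring.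
Qed.
Lemma walk_sqr nu : 2 / 4 ^+ nu * \sum_(j < nu) 'C(nu.*2, nu + j.+1)%:R * j.+1%:R ^+ 2 = nu%:R / 2 :> R.
Proof.
rewrite -(@rad_nseq_even nu (fun x => x ^+ 2)); first last.
- by rewrite expr0n.
- by move=> x; rewrite sqrrN.
by rewrite rad_sqr expr0n add0r -mul2n sum_sqr_nseq natrM; field.
Qed.

End WalkEntropy.

Section WalkBounds.
Context {R : realType}.
Implicit Types (n j k nu : nat).
Local Notation harmR := (@harm R).
Local Notation cbinR := (@cbin R).
Local Notation walk := (@walk_xlnx2 R).

Lemma cbin0 : cbinR 0 = 1.
Proof. by rewrite /cbin bin0 expr0 divr1. Qed.

Lemma cbinS n : cbinR n.+1 = cbinR n * (2 * n%:R + 1) / (2 * n%:R + 2).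
Proof.
have H1 : (n.+1 * 'C(n.+1.*2, n.+1) = 2 * n.+1 * 'C(n.*2.+1, n))%N.
  by rewrite mul2n doubleS mul_bin_diag.
have H2 : (n.+1 * 'C(n.*2.+1, n) = n.*2.+1 * 'C(n.*2, n))%N.
  have := mul_bin_left n.*2.+1 n; have := mul_bin_diag n.*2.+1 n.
  rewrite -(@bin_sub n.*2.+1 n); last by rewrite -addnn ltnW// ltnS leq_addr.
  rewrite (_ : n.*2.+1 - n = n.+1)%N; last by rewrite -addnn subSn ?leq_addr// addnK.
  by rewrite mul_bin_diag.
move/(congr1 (fun z : nat => z%:R : R)): H1.
move/(congr1 (fun z : nat => z%:R : R)): H2.
rewrite /cbin !natrM -(natr1 n) -(natr1 n.*2) -mul2n natrM exprS.
have n0 := ler0n R n.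
move: ('C(n.+1.*2, n.+1)%:R : R) ('C((2 * n).+1, n)%:R : R) ('C(2 * n, n)%:R : R) => a b c.
have : (4 : R) ^+ n != 0 by rewrite expf_neq0// pnatr_eq0.
move: (4 ^+ n) (n%:R) n0 => z x x0 z0 E1 E2.
have x1 : x + 1 != 0 by rewrite gt_eqF//; lra.
have bE : b = (2 * x + 1) * c / (x + 1) by rewrite -E1; field.
have aE : a = 2 * b by apply: (mulfI x1); rewrite E2; ring.
rewrite aE bE; field; rewrite z0/=; apply/andP; split; rewrite gt_eqF//; lra.
Qed.

Lemma cbin_gt0 n : 0 < cbinR n.
Proof. by rewrite divr_gt0// ?exprn_gt0// ltr0n bin_gt0 -addnn leq_addr. Qed.

Lemma cbin_anti n : cbinR n.+1 <= cbinR n.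
Proof.
have n0 := ler0n R n; rewrite cbinS ler_pdivrMr; last lra.
by rewrite ler_pM2l ?cbin_gt0//; lra.
Qed.

Lemma cbin4 : cbinR 4 = 35 / 128.
Proof. by rewrite !cbinS cbin0; by field. Qed.

Lemma cbin_le4 nu : (4 <= nu)%N -> cbinR nu <= 35 / 128.
Proof.
move/subnKC => <-; elim: (nu - 4)%N => [|k IH]; first by rewrite addn0 cbin4.
by rewrite addnS (le_trans (cbin_anti _)).
Qed.

(** The partial sums of a series with sum 2 ln 2. *)
Definition cbin_sum n : R := \sum_(i < n) cbinR i.+1 / i.+1%:R.
(** A lower bound for the part of that series from nu on, chosen so that
    adding it to the partial sums gives an increasing sequence. *)
Let tail nu : R := 2 * cbinR nu + 4 * cbinR nu / (6 * nu%:R - 1).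

Let tail_step n : (3 <= n)%N ->
  cbin_sum n + tail n.+1 <= cbin_sum n.+1 + tail n.+2.
Proof.
move=> n3; rewrite /cbin_sum big_ord_recr/= /tail (cbinS n.+1).
have c0 := cbin_gt0 n.+1.
have x3 : (3 : R) <= n%:R by rewrite ler_nat.
rewrite -(natr1 n.+1) -(natr1 n); move: (n%:R) x3 (cbinR n.+1) c0 => x x3 c c0.
rewrite -addrA lerD2l -subr_ge0.
have -> : c / (x + 1) + (2 * (c * (2 * (x + 1) + 1) / (2 * (x + 1) + 2)) +
   4 * (c * (2 * (x + 1) + 1) / (2 * (x + 1) + 2)) / (6 * (x + 1 + 1) - 1)) -
  (2 * c + 4 * c / (6 * (x + 1) - 1)) =
  c * (2 * x - 3) / ((x + 1) * (x + 2) * (6 * x + 5) * (6 * x + 11)).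
  by field; rewrite !gt_eqF//; lra.
by rewrite divr_ge0// ?mulr_ge0//; lra.
Qed.

(** The numerical constant bounds the partial sum plus its tail at n = 3 from
    below; it is slightly less than 2 ln 2. *)
Lemma cbin_sum_ge n : (3 <= n)%N ->
  (1386 + 9 / 100) / 1000 - 2 * cbinR n.+1 - 4 * cbinR n.+1 / (6 * n.+1%:R - 1) <= cbin_sum n.
Proof.
move=> n3; suff : (1386 + 9 / 100) / 1000 <= cbin_sum n + tail n.+1 by rewrite /tail; lra.
move/subnKC: n3 => <-; elim: (n - 3)%N => [|k IH]; last first.
  by rewrite addnS (le_trans IH)// tail_step.
have c1 : cbinR 1 = 1 / 2 by rewrite cbinS cbin0; field.
have c2 : cbinR 2 = 3 / 8 by rewrite cbinS c1; field.
have c3 : cbinR 3 = 5 / 16 by rewrite cbinS c2; field.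
rewrite addn0 /cbin_sum !big_ord_recr big_ord0 /tail /= add0r cbin4 c3 c2 c1 (_ : 6 * 4 - 1 = 23); [lra|ring].
Qed.

Lemma ln2_le : ln 2 <= 61 / 88 :> R.
Proof.
have -> : (2 : R) = (1 + 1 / 3) * (1 + 1 / 3) * (1 + 1 / 8) by field.
rewrite !lnM ?posrE ?mulr_gt0//; try lra.
have H3 : ln (1 + 1 / 3) <= 145 / 504 :> R.
  apply: le_trans (ln1D_le_cubic _) _; first lra.
  by rewrite le_eqVlt; apply/orP; left; apply/eqP; field.
have H8 : ln (1 + 1 / 8) <= 865 / 7344 :> R.
  apply: le_trans (ln1D_le_cubic _) _; first lra.
  by rewrite le_eqVlt; apply/orP; left; apply/eqP; field.
lra.
Qed.

Lemma ln2_ge : 69 / 100 <= ln 2 :> R.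
Proof.
have := @ln1D_ge_cubic R 1 ler01; rewrite (_ : 1 + 1 = 2); last by [].
by apply: le_trans; rewrite (_ : _ + _ = 56 / 81); [lra|field].
Qed.

Lemma ln3_ge : 109 / 100 <= ln 3 :> R.
Proof.
have -> : (3 : R) = 2 * (1 + 1 / 2) by field.
have p : 0 < 1 + 1 / 2 :> R by lra.
rewrite lnM ?posrE//.
have H : 2 / 5 <= ln (1 + 1 / 2) :> R.
  have h0 : 0 <= 1 / 2 :> R by lra.
  apply: le_trans (ln1D_ge h0).
  by rewrite le_eqVlt; apply/orP; left; apply/eqP; field.
have := ln2_ge; lra.
Qed.

(** The margin that makes the random walk estimate close: the left-hand side
    is about 2 - 2 ln 2 - gamma. *)
Lemma euler_const : euler_up 4 - 2 * euler_dn 4 + (2 - (1386 + 9 / 100) / 1000) <= 73 / 100 - ln 2 :> R.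
Proof.
have h3 : harmR 3 = 11 / 6 by rewrite !harmS harm0; field.
have e1 : (12 * 4 ^+ 2)^-1 = 1 / 192 :> R by field.
have e2 : (12 * 4 ^+ 2 + 3 / 2)^-1 = 2 / 387 :> R by field.
have e3 : (2 * 4)^-1 = 1 / 8 :> R by field.
rewrite /euler_up /euler_dn h3 e1 e2 e3.
have -> : ln 4 = 2 * ln 2 :> R.
  rewrite (_ : 4 = 2 * 2 :> R); last by rewrite -natrM.
  by rewrite lnM ?posrE//; ring.
have := ln2_le; lra.
Qed.

Lemma walk_le n : walk n.+1 <= n.+1%:R * (harmR n - cbin_sum n + 2 * (1 - cbinR n.+1) - 2 * euler_dn 4)
   + (1 - cbinR n.+1) / 3.
Proof.
have -> : harmR n - cbin_sum n = 2 * \sum_(i < n) (1 - cbinR i.+1) / (2 * i.+1%:R).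
  rewrite /harm /cbin_sum -sumrB mulr_sumr; apply: eq_bigr => i _.
  by field; rewrite ?gt_eqF//; have := ler0n R i; lra.
have H1 := @binomial_harm R n.
have H2 := @walk_sqr R n.+1.
have H3 := @half_row_even_sum R n.
have z0 : (0 : R) < 4 ^+ n by rewrite exprn_gt0.
pose c j : R := 'C(n.+1.*2, n.+1 + j.+1)%:R.
have H4 : walk n.+1 <= 8 / 4 ^+ n.+1 * (\sum_(j < n.+1) c j * (j.+1%:R ^+ 2 * (harmR j + (2 * j.+1%:R)^-1))
     + (\sum_(j < n.+1) c j) / 12 - euler_dn 4 * \sum_(j < n.+1) c j * j.+1%:R ^+ 2).
  rewrite walk_xlnx2E ler_pM2l; last by rewrite divr_gt0// exprn_gt0.
  rewrite mulr_suml mulr_sumr -big_split -sumrB/=; apply: ler_sum => j _.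
  have c0 : 0 <= c j by [].
  have -> : c j * (j.+1%:R ^+ 2 * (harmR j + (2 * j.+1%:R)^-1)) + c j / 12 - euler_dn 4 * (c j * j.+1%:R ^+ 2)
    = c j * (j.+1%:R ^+ 2 * (harmR j + (2 * j.+1%:R)^-1 + (12 * j.+1%:R ^+ 2)^-1 - euler_dn 4)).
    by field; rewrite gt_eqF//; have := ler0n R j; lra.
  by rewrite ler_wpM2l// ler_wpM2l ?exprn_ge0//; exact: (@ln_nat_le R j.+1).
apply: (le_trans H4).
have H2' : \sum_(j < n.+1) c j * j.+1%:R ^+ 2 = n.+1%:R * 4 ^+ n.
  apply: (mulfI (_ : 2 / 4 ^+ n.+1 != 0 :> R)); first by rewrite mulf_neq0 ?pnatr_eq0// invr_eq0 expf_neq0// pnatr_eq0.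
  by rewrite H2 exprS; field; rewrite gt_eqF.
rewrite H1 H2' H3 exprS -subr_ge0.
set S := \sum_(i < n) _.
rewrite (_ : _ - _ = 0)//; by field; rewrite gt_eqF.
Qed.

(** Asymptotically the two sides differ by the gap between 73/100 and the
    Gaussian value 2 - ln 2 - gamma, which is less than 1/1000; the last
    term pays for the interpolation between consecutive walks. *)
Lemma walk_bound nu : (4 <= nu)%N ->
  walk nu <= nu%:R * (73 / 100 - ln 2 + ln nu%:R) - (8 * (nu%:R - 1))^-1.
Proof.
case: nu => [//|n]; rewrite ltnS => n3.
apply: le_trans (walk_le n) _.
have x3 : (3 : R) <= n%:R by rewrite ler_nat.
have := @ln_nat_ge R n.+1 n3; have := cbin_sum_ge n3.
have := @cbin_le4 n.+1 n3; have := euler_const; have := cbin_gt0 n.+1.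
rewrite /= -(natr1 n); move: (ln (n%:R + 1)) => L; move: (n%:R) x3 (harmR n) (cbin_sum n) (cbinR n.+1) (euler_up 4) (euler_dn 4) => x x3 H B c u d.
move=> c0 ud c4 HB HL.
rewrite addrK.
have X1 : 0 < x + 1 by lra.
have E1 : H - B + 2 * (1 - c) - 2 * d <= L + (73 / 100 - ln 2) - (2 * (x + 1))^-1 + 4 * c / (6 * (x + 1) - 1).
  lra.
have := ler_wpM2l (ltW X1) E1.
have E2 : (x + 1) * (4 * c / (6 * (x + 1) - 1)) <= 16 / 23 * c.
  rewrite mulrA ler_pdivrMr; last lra.
  nra.
have E3 : (x + 1) * (2 * (x + 1))^-1 = 1 / 2 by field; rewrite gt_eqF.
have E4 : (8 * x)^-1 <= 24^-1 by rewrite lef_pV2 ?posrE//; lra.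
move: ((6 * (x + 1) - 1)^-1) ((2 * (x + 1))^-1) ((8 * x)^-1) E2 E3 E4 => p q r E2 E3 E4.
move=> E5; nra.
Qed.

End WalkBounds.

(** * Real powers of the cosine and mixtures of random walks *)

Section Interpolation.
Context {R : realType}.
Implicit Types (nu : nat) (x y t sigma : R).
Local Notation walk := (@walk_xlnx2 R).

Lemma walk1 : walk 1 = 0.
Proof. by rewrite walk_xlnx2E big_ord1 ln1 !mulr0. Qed.

Lemma walk2 : walk 2 = 2 * ln 2.
Proof.
rewrite walk_xlnx2E !big_ord_recr big_ord0/= ln1 (_ : 'C(4, 4) = 1)%N//.
by field.
Qed.

Lemma walk3 : walk 3 = 3 * ln 2 + 9 / 8 * ln 3.
Proof.
rewrite walk_xlnx2E !big_ord_recr big_ord0/= ln1 (_ : 'C(6, 5) = 6)%N// (_ : 'C(6, 6) = 1)%N//.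
by field.
Qed.

(** The slack of the walk of 2 nu steps in the estimate that is to hold for all
    real sigma; it has to cover the defect of convexity of x ln x on an
    interval of length one, which is at most 1 / (8 nu). *)
Definition walk_gap nu : R := nu%:R * (73 / 100 - ln 2 + ln nu%:R) - walk nu.

Lemma walk_gap_ge nu : (2 <= nu)%N -> (8 * nu%:R)^-1 <= walk_gap nu.
Proof.
case: nu => [//|[//|[|[|n]]]] _.
- rewrite /walk_gap walk2 (_ : (8 * 2)^-1 = 1 / 16); last by field.
  by have := @ln2_le R; lra.
- rewrite /walk_gap walk3 (_ : (8 * 3)^-1 = 1 / 24); last by field.
  by have := @ln2_le R; have := @ln3_ge R; lra.
- rewrite /walk_gap lerBrDl -lerBrDr; apply: le_trans (@walk_bound R n.+4 isT) _.
  rewrite lerD2l lerN2.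
  have N4 : 4 <= n.+4%:R :> R by rewrite ler_nat.
  by rewrite lef_pV2 ?posrE; lra.
Qed.

Lemma walk_gap_succ nu : (2 <= nu)%N -> (8 * nu%:R)^-1 <= walk_gap nu.+1.
Proof.
case: nu => [//|[//|[|n]]] _.
- rewrite /walk_gap walk3 (_ : (8 * 2)^-1 = 1 / 16); last by field.
  by have := @ln2_le R; have := @ln3_ge R; lra.
- rewrite /walk_gap lerBrDl -lerBrDr; apply: le_trans (@walk_bound R n.+4 isT) _.
  by rewrite lerD2l lerN2 -[in leRHS](natr1 n.+3) addrK.
Qed.

Lemma powR_le_tangent y t : 0 < y -> 0 <= t <= 1 -> y `^ t <= 1 - t * (1 - y).
Proof.
move=> y0 /andP[t0 t1]; rewrite /powR gt_eqF//.
set L := ln y; have -> : y = expR L by rewrite lnK.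
have H1 := expR_ge1Dx ((1 - t) * L); have H2 := expR_ge1Dx (- (t * L)).
have -> : 1 - t * (1 - expR L) = expR (t * L) * (t * expR ((1 - t) * L) + (1 - t) * expR (- (t * L))).
  have E1 : expR (t * L) * expR ((1 - t) * L) = expR L by rewrite -expRD; congr expR; ring.
  have E2 : expR (t * L) * expR (- (t * L)) = 1 by rewrite -expRD subrr expR0.
  transitivity (t * (expR (t * L) * expR ((1 - t) * L)) + (1 - t) * (expR (t * L) * expR (- (t * L)))).
    by rewrite E1 E2; ring.
  ring.
rewrite ler_peMr ?expR_ge0//; nra.
Qed.

Lemma powR_le_taylor2 y t : 0 < y <= 1 -> 0 <= t <= 1 ->
  y `^ t <= 1 - t * (1 - y) - t * (1 - t) * (1 - y) ^+ 2 / 2.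
Proof.
move=> /andP[y0 y1] /andP[t0 t1].
pose f x : R := x `^ t - (1 - t * (1 - x) - t * (1 - t) * (1 - x) ^+ 2 / 2).
have := @has_deriv_ndecr R f (fun x => t * x `^ (t - 1) - (t + t * (1 - t) * (1 - x))) y 1 y1.
have -> : f 1 = 0 by rewrite /f powR1; ring.
rewrite /f subr_le0; apply.
- move=> x /andP[yx x1]; have x0 : 0 < x := lt_le_trans y0 yx.
  apply: has_deriv_eq.
    apply: has_derivD; [exact: (is_derive1_powR t x0)|has_deriv].
  by rewrite /=; field.
- move=> x /andP[yx x1]; have x0 : 0 < x := lt_le_trans y0 yx.
  rewrite subr_ge0 /powR gt_eqF//.
  have H := expR_ge1Dx ((t - 1) * ln x).
  have x1' : -1 < x - 1 by lra.
  have Hl := le_ln1Dx x1'; rewrite addrCA subrr addr0 in Hl.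
  rewrite (_ : t + t * (1 - t) * (1 - x) = t * (1 + (1 - t) * (1 - x))); last ring.
  rewrite ler_wpM2l//; apply: le_trans H; nra.
Qed.

(** The polynomial in y with coefficients q lies above the power y^sigma on the
    unit interval and touches it to first order at 1. With y = cos^2 it becomes
    the characteristic function of a mixture of random walks of mass one and
    the right variance; negative weights are harmless, since the comparison
    principle allows signed measures. *)
Definition dominates (q : seq (R * nat)) sigma :=
  [/\ \sum_(p <- q) p.1 = 1, \sum_(p <- q) p.1 * p.2%:R = sigma &
      forall y, 0 <= y <= 1 -> y `^ sigma <= \sum_(p <- q) p.1 * y ^+ p.2].

Lemma dominates1 : dominates [:: (1, 1%N)] 1.
Proof.
split; rewrite ?big_seq1/= ?mulr1// => y /andP[y0 _].
by rewrite big_seq1 mul1r/= powRr1.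
Qed.

Let powR_split nu y t : (0 < nu)%N -> 0 <= y -> 0 <= t -> y != 0 -> y `^ (nu%:R + t) = y ^+ nu * y `^ t.
Proof. by move=> n0 y0 t0 yn; rewrite powRD ?powR_mulrn// (negPf yn) implybT. Qed.

(** Between 1 and 2 the chord is too lossy, because the walk of two steps has
    little slack; the second order Taylor polynomial is used. *)
Let dominates_le2 t : 0 <= t <= 1 -> exists2 q, dominates q (1 + t) &
    \sum_(p <- q) p.1 * walk p.2 <= (1 + t) * (73 / 100 - ln 2 + ln (1 + t)).
Proof.
move=> /andP[t0 t1].
exists [:: (1 - t - t * (1 - t) / 2, 1%N); (t + t * (1 - t), 2%N); (- (t * (1 - t) / 2), 3%N)].
  split; rewrite ?big_cons ?big_nil/=; [by field|by field|move=> y /andP[y0 y1]].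
  have [->|yn] := eqVneq y 0.
    rewrite powR0; last by rewrite gt_eqF//; lra.
    by rewrite !big_cons big_nil/= !expr0n/= !mulr0 !addr0.
  have yp : 0 < y by rewrite lt_neqAle eq_sym yn.
  rewrite !big_cons big_nil/= (@powR_split 1)// expr1.
  have := @powR_le_taylor2 y t; rewrite yp y1 t0 t1 => /(_ isT isT) H.
  apply: le_trans (ler_wpM2l y0 H) _.
  by rewrite le_eqVlt; apply/orP; left; apply/eqP; field.
rewrite !big_cons big_nil/= walk1 walk2 walk3.
have L := ln1D_ge t0.
have Q : t + t ^+ 2 / 3 <= (1 + t) * (2 * t / (2 + t)).
  by rewrite mulrA ler_pdivlMr; nra.
have l2 := @ln2_le R; have l3 := @ln3_ge R; have l2' := @ln2_ge R.
have := ler_wpM2l (_ : 0 <= 1 + t) L; rewrite addr_ge0// => /(_ isT).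
move: (ln 2) (ln 3) (ln (1 + t)) l2 l3 l2' {L} => a b c l2 l3 l2' L.
have h : 0 <= t * (1 - t) by nra.
have : 0 <= t * (1 - t) * (9 / 8 * b - a - 1 / 2) by nra.
nra.
Qed.

(** From 2 on it suffices to mix two consecutive walks. *)
Let dominates_ge2 nu t : (2 <= nu)%N -> 0 <= t <= 1 ->
  exists2 q, dominates q (nu%:R + t) &
    \sum_(p <- q) p.1 * walk p.2 <= (nu%:R + t) * (73 / 100 - ln 2 + ln (nu%:R + t)).
Proof.
move=> nu2 /andP[t0 t1].
exists [:: (1 - t, nu); (t, nu.+1)].
  split; rewrite ?big_cons ?big_nil/=; [by field|by rewrite -natr1; field|move=> y /andP[y0 y1]].
  rewrite !big_cons big_nil/=.
  have N2 : 2 <= nu%:R :> R by rewrite ler_nat.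
  have [->|yn] := eqVneq y 0.
    rewrite powR0; last by rewrite gt_eqF//; lra.
    by rewrite !expr0n/= (gtn_eqF (ltnW nu2)) !mulr0 !addr0.
  have yp : 0 < y by rewrite lt_neqAle eq_sym yn.
  rewrite powR_split// ?(ltnW nu2)//.
  have := @powR_le_tangent y t yp; rewrite t0 t1 => /(_ isT) H.
  apply: le_trans (ler_wpM2l (exprn_ge0 nu y0) H) _.
  by rewrite exprS le_eqVlt; apply/orP; left; apply/eqP; ring.
rewrite !big_cons big_nil addr0/=.
have G1 := walk_gap_ge nu2; have G2 := walk_gap_succ nu2.
rewrite /walk_gap in G1 G2.
have N2 : 2 <= nu%:R :> R by rewrite ler_nat.
rewrite -(natr1 nu) in G2.
move: (walk nu) (walk nu.+1) (nu%:R) G1 G2 N2 => W W' N G1 G2 N2.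
have N0 : 0 < N by lra.
have S0 : 0 < N + t by lra.
(* the convexity defect of x ln x over an interval of length one *)
have A1 : N * ln N <= N * ln (N + t) - 2 * N * t / (2 * N + t).
  have q0 : 0 <= t / N by rewrite divr_ge0// ltW.
  have q1 : 0 < 1 + t / N by rewrite ltr_pwDl.
  have E : ln (N + t) = ln N + ln (1 + t / N).
    by rewrite -lnM ?posrE//; congr ln; field; rewrite gt_eqF.
  have := ler_wpM2l (ltW N0) (ln1D_ge q0).
  rewrite (_ : N * (2 * (t / N) / (2 + t / N)) = 2 * N * t / (2 * N + t)); last first.
    by field; rewrite !gt_eqF//; lra.
  rewrite E; lra.
have A2 : (N + 1) * ln (N + 1) <= (N + 1) * ln (N + t) + (1 - t) + (1 - t) ^+ 2 / (2 * (N + t)).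
  have q0 : 0 <= (1 - t) / (N + t) by rewrite divr_ge0 ?subr_ge0// ltW.
  have q1 : 0 < 1 + (1 - t) / (N + t) by rewrite ltr_pwDl.
  have E : ln (N + 1) = ln (N + t) + ln (1 + (1 - t) / (N + t)).
    by rewrite -lnM ?posrE//; congr ln; field; rewrite gt_eqF.
  have N1 : 0 <= N + 1 by lra.
  have := ler_wpM2l N1 (ln1D_le q0).
  rewrite (_ : (N + 1) * ((1 - t) / (N + t) * ((1 - t) / (N + t) + 2) / (2 * (1 + (1 - t) / (N + t))))
     = (1 - t) + (1 - t) ^+ 2 / (2 * (N + t))); last by field; rewrite !gt_eqF//; lra.
  rewrite E; lra.
have A3 : (1 - t) * (- (2 * N * t / (2 * N + t))) + t * ((1 - t) + (1 - t) ^+ 2 / (2 * (N + t))) <= (8 * N)^-1.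
  have -> : (1 - t) * (- (2 * N * t / (2 * N + t))) + t * ((1 - t) + (1 - t) ^+ 2 / (2 * (N + t)))
    = t * (1 - t) * (t / (2 * N + t) + (1 - t) / (2 * (N + t))).
    by field; rewrite !gt_eqF//; lra.
  have B1 : t / (2 * N + t) <= t * (2 * N)^-1.
    by rewrite ler_wpM2l// lef_pV2 ?posrE; lra.
  have B2 : (1 - t) / (2 * (N + t)) <= (1 - t) * (2 * N)^-1.
    by rewrite ler_wpM2l ?subr_ge0// lef_pV2 ?posrE; lra.
  have B3 : t * (1 - t) <= 1 / 4 by have := sqr_ge0 (t - 1 / 2); nra.
  have B4 : (8 * N)^-1 = 1 / 4 * (2 * N)^-1 by field; rewrite gt_eqF.
  have B5 : 0 <= (2 * N)^-1 by rewrite invr_ge0; lra.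
  have B0 : 0 <= t * (1 - t) by rewrite mulr_ge0// subr_ge0.
  rewrite B4; apply: (@le_trans _ _ (t * (1 - t) * (2 * N)^-1)); last by rewrite ler_wpM2r.
  by rewrite ler_wpM2l//; lra.
move: (ln N) (ln (N + 1)) (ln (N + t)) (ln 2) (2 * N * t / (2 * N + t)) ((1 - t) ^+ 2 / (2 * (N + t))) ((8 * N)^-1) A1 A2 A3 G1 G2.
move=> a b c d p q r A1 A2 A3 G1 G2.
have t1' : 0 <= 1 - t by lra.
have := ler_wpM2l t0 A2; have := ler_wpM2l t1' A1.
have := ler_wpM2l t0 G2; have := ler_wpM2l t1' G1.
lra.
Qed.

Lemma dominates_exists sigma : 1 <= sigma ->
  exists2 q, dominates q sigma &
    \sum_(p <- q) p.1 * walk p.2 <= sigma * (73 / 100 - ln 2 + ln sigma).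
Proof.
move=> s1; have [s2|s2] := leP sigma 2.
  have := @dominates_le2 (sigma - 1); rewrite addrCA subrr addr0; apply.
  by apply/andP; split; lra.
have s0 : 0 <= sigma by lra.
have /andP[fl fu] := truncn_itv s0.
have := @dominates_ge2 (Num.truncn sigma) (sigma - (Num.truncn sigma)%:R).
rewrite addrCA subrr addr0; apply.
  by rewrite -ltnS -(ltr_nat R); lra.
by move: fu; rewrite -natr1 => fu; apply/andP; split; lra.
Qed.

End Interpolation.

(** * The entropy of Rademacher sums *)

Section Entropy.
Context {R : realType}.
Implicit Types (s : seq R) (a x y z : R).
Local Notation walk := (@walk_xlnx2 R).

Lemma rad_scale (c : R) s (F : R -> R) x :
  rad [seq c * a | a <- s] F (c * x) = rad s (fun z => F (c * z)) x.
Proof.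
elim: s x => [//|a s IH] x.
by rewrite /= !rad_cons -mulrDr -mulrBr !IH.
Qed.

Lemma xlnx2M (c z : R) : xlnx2 (c * z) = c ^+ 2 * xlnx2 z + xlnx2 c * z ^+ 2.
Proof.
rewrite /xlnx2 normrM exprMn.
have [->|c0] := eqVneq c 0; first by rewrite expr0n/= !mul0r addr0.
have [->|z0] := eqVneq z 0; first by rewrite expr0n/= !(mulr0, mul0r) addr0.
by rewrite lnM ?posrE ?normr_gt0//; ring.
Qed.

Lemma rad_nseq_xlnx2 nu a :
  rad (nseq nu.*2 a) xlnx2 0 = a ^+ 2 * (walk nu + 2 * nu%:R * ln (2 * `|a|)).
Proof.
have -> : nseq nu.*2 a = [seq (2 * a) * b | b <- nseq nu.*2 2^-1].
  by rewrite map_nseq; congr nseq; field.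
rewrite -(mulr0 (2 * a)) rad_scale.
under eq_rad do rewrite xlnx2M.
have -> : (fun z => (2 * a) ^+ 2 * xlnx2 z + xlnx2 (2 * a) * z ^+ 2) =
    (fun z => a ^+ 2 * (4 * xlnx2 z) + xlnx2 (2 * a) * z ^+ 2).
  by apply/funext => z; ring.
rewrite radD !(radZ _ (a ^+ 2)) (radZ _ (xlnx2 _)) rad_sqr expr0n add0r -/(walk nu).
rewrite sum_sqr_nseq /xlnx2 normrM [`|2|]ger0_norm// -mul2n natrM.
by field.
Qed.

(** The characteristic function \prod cos (a_i t) of a Rademacher sum is at
    most the weighted mean of the |cos (a_i t)|^(2 sigma_i), hence of the
    dominating polynomials in cos^2 (a_i t), which are characteristic functions
    of mixtures of random walks with steps a_i. Masses and variances agree, so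
    the comparison principle bounds the entropy by that of the mixture. *)
Lemma rad_xlnx2_amgm (T : Type) (r : seq T) (a sigma : T -> R) (q : T -> seq (R * nat)) :
  (forall i, 1 <= sigma i) -> (forall i, dominates (q i) (sigma i)) ->
  \sum_(i <- r) (2 * sigma i)^-1 = 1 ->
  rad [seq a i | i <- r] xlnx2 0 <=
  \sum_(i <- r) a i ^+ 2 * ((\sum_(p <- q i) p.1 * walk p.2) / (2 * sigma i) + ln (2 * `|a i|)).
Proof.
move=> s1 dom sum1.
have s0 i : 0 < sigma i by apply: lt_le_trans (s1 i).
pose mix i (F : R -> R) : R := \sum_(p <- q i) p.1 * rad (nseq p.2.*2 (a i)) F 0.
pose L (F : R -> R) : R := \sum_(i <- r) (2 * sigma i)^-1 * mix i F + -1 * rad [seq a i | i <- r] F 0.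
have finL : finitary L.
  apply: finitaryD; last by apply: finitaryZ; exact: finitary_rad.
  apply: finitary_sum => i; apply: finitaryZ; apply: finitary_sum => p.
  by apply: finitaryZ; exact: finitary_rad.
have := finitary_comparison finL.
have -> : L xlnx2 = \sum_(i <- r) a i ^+ 2 * ((\sum_(p <- q i) p.1 * walk p.2) / (2 * sigma i) + ln (2 * `|a i|))
    - rad [seq a i | i <- r] xlnx2 0.
  rewrite /L mulN1r; congr (_ - _); apply: eq_bigr => i _.
  have [_ q2 _] := dom i.
  have -> : mix i xlnx2 = a i ^+ 2 * (\sum_(p <- q i) p.1 * walk p.2 + 2 * sigma i * ln (2 * `|a i|)).
    rewrite -q2 mulr_sumr mulr_suml -big_split mulr_sumr; apply: eq_bigr => p _ /=.
    by rewrite rad_nseq_xlnx2; ring.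
  by field; rewrite gt_eqF.
rewrite subr_ge0; apply.
- rewrite /L rad_cst mulr1 (eq_bigr (fun i => (2 * sigma i)^-1)); first by rewrite sum1 subrr.
  move=> i _; rewrite /= /mix.
  have -> : \sum_(p <- q i) p.1 * rad (nseq p.2.*2 (a i)) (fun=> 1) 0 = 1.
    have [q1 _ _] := dom i; rewrite -[RHS]q1; apply: eq_bigr => p _.
    by rewrite rad_cst mulr1.
  by rewrite mulr1.
- rewrite /L rad_sqr expr0n add0r big_map mulr_sumr -big_split big1// => i _.
  rewrite /= /mix.
  have -> : \sum_(p <- q i) p.1 * rad (nseq p.2.*2 (a i)) (fun x => x ^+ 2) 0 = 2 * sigma i * a i ^+ 2.
    have [_ q2 _] := dom i; rewrite -[in RHS]q2 mulr_sumr mulr_suml; apply: eq_bigr => p _.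
    by rewrite rad_sqr expr0n add0r sum_sqr_nseq -mul2n natrM; ring.
  by field; rewrite gt_eqF.
- move=> t t0; rewrite /L rad_cos mulr0 cos0 mul1r big_map mulN1r subr_ge0.
  have := @amgm_powR R T r (fun i => cos (t * a i)) sigma s0 sum1.
  rewrite -normr_prod => /(le_trans (ler_norm _))/le_trans; apply.
  apply: ler_sum => i _; rewrite ler_wpM2l//; first by rewrite invr_ge0 mulr_ge0// ltW.
  have [_ _ q3] := dom i.
  apply: le_trans (q3 _ _) _.
    by rewrite sqr_ge0/= cos2sin2 gerBl sqr_ge0.
  rewrite le_eqVlt; apply/orP; left; apply/eqP; apply: eq_bigr => p _.
  rewrite rad_cos mulr0 cos0 mul1r -exprM mul2n; congr (_ * _).
  by elim: (p.2.*2) => [|k IH]; rewrite ?big_nil ?expr0//= big_cons exprS IH.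
Qed.

End Entropy.

Section EntropyBound.
Context {R : realType}.
Implicit Types (s : seq R) (a x y z : R).
Local Notation walk := (@walk_xlnx2 R).

(** The price per unit of variance of a coefficient that receives the weight l.
    For l = 1/2 the power of the cosine is the square, and the exact value for
    a walk of two steps is used. *)
Let cost (l : R) : R := if l == 1 / 2 then ln 2 else 73 / 200 - ln l / 2.

Let cost_le l : 0 < l -> l <= 1 / 2 -> cost l <= 73 / 200 - ln l / 2.
Proof.
move=> l0 l2; rewrite /cost; case: eqP => // ->.
by rewrite mul1r lnV ?posrE//; have := @ln2_le R; lra.
Qed.

Let rad_xlnx2_cost s (lam : R -> R) : (forall x, 0 < lam x <= 1 / 2) ->
  \sum_(a <- s) lam a = 1 ->
  rad s xlnx2 0 <= \sum_(a <- s) a ^+ 2 * (cost (lam a) + ln `|a|).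
Proof.
move=> lamP sum1.
have sig1 x : 1 <= (2 * lam x)^-1.
  have /andP[l0 l1] := lamP x.
  by rewrite -[leLHS]invr1 lef_pV2 ?posrE//; lra.
have /choice[q qP] : forall x, exists q, dominates q (2 * lam x)^-1 /\
   (\sum_(p <- q) p.1 * walk p.2) / (2 * (2 * lam x)^-1) + ln 2 <= cost (lam x).
  move=> x; have /andP[l0 l1] := lamP x.
  rewrite /cost; case: eqP => [->|_].
    exists [:: (1, 1%N)]; rewrite mul1r divff//= invr1; split; first exact: dominates1.
    by rewrite big_seq1/= walk1 mulr0 mul0r add0r.
  have [q dq wq] := dominates_exists (sig1 x).
  exists q; split => //.
  rewrite -lerBrDr ler_pdivrMr; last by have := sig1 x; lra.
  apply: le_trans wq _.
  rewrite lnV ?posrE ?mulr_gt0// lnM ?posrE//.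
  by rewrite le_eqVlt; apply/orP; left; apply/eqP; field; rewrite gt_eqF.
have := @rad_xlnx2_amgm R R s id (fun x => (2 * lam x)^-1) q sig1 (fun x => (qP x).1).
rewrite map_id => /(_ _)/le_trans; apply.
  rewrite -[RHS]sum1; apply: eq_bigr => a _.
  by have /andP[l0 _] := lamP a; field; rewrite gt_eqF.
apply: ler_sum => a _.
have [->|a0] := eqVneq a 0; first by rewrite /= expr0n !mul0r.
rewrite ler_wpM2l ?sqr_ge0// lnM ?posrE ?normr_gt0// addrA lerD2r.
exact: (qP a).2.
Qed.

Let lnsqr a : a != 0 -> ln (a ^+ 2) = 2 * ln `|a|.
Proof.
by move=> a0; rewrite -(real_normK (num_real a)) lnXn ?normr_gt0// mulr2n; ring.
Qed.

(** The weight x^2 / c, cut off at 1/2 so that the power of the cosine that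
    belongs to it is at least the square. *)
Let lamc c x : R := if 0 < x ^+ 2 / c <= 1 / 2 then x ^+ 2 / c else 1 / 2.

Let lamcP c x : 0 < lamc c x <= 1 / 2.
Proof. by rewrite /lamc; case: ifP => // _; apply/andP; split; lra. Qed.

(** No coefficient carries more than half of the variance: weights equal to the
    variances make the logarithms cancel. *)
Let rad_xlnx2_spread s : all (fun a => a != 0) s -> \sum_(a <- s) a ^+ 2 = 1 ->
  all (fun a => a ^+ 2 <= 1 / 2) s -> rad s xlnx2 0 <= 73 / 200.
Proof.
move=> s0 s2 sl.
have lE a : a \in s -> lamc 1 a = a ^+ 2.
  move=> ain; rewrite /lamc divr1 (allP sl _ ain) andbT exprn_even_gt0//=.
  by rewrite (allP s0 _ ain).
apply: le_trans (@rad_xlnx2_cost s (lamc 1) (lamcP 1) _) _.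
  by rewrite -[RHS]s2; apply: eq_big_seq => a /lE.
rewrite [leRHS](_ : _ = \sum_(a <- s) a ^+ 2 * (73 / 200)); last by rewrite -mulr_suml s2 mul1r.
rewrite big_seq [leRHS]big_seq; apply: ler_sum => a ain.
have a0 := allP s0 _ ain.
rewrite ler_wpM2l ?sqr_ge0//.
have /andP[l0 l1] := lamcP 1 a.
have := cost_le l0 l1; rewrite lE// lnsqr//; lra.
Qed.

(** One coefficient carries slightly more than half: it gets the weight 1/2 and
    the others share the remaining half in proportion to their variances. *)
Let rad_xlnx2_head a s : all (fun a => a != 0) (a :: s) ->
  a ^+ 2 + \sum_(b <- s) b ^+ 2 = 1 ->
  1 / 2 < a ^+ 2 -> a ^+ 2 <= 3 / 5 -> rad (a :: s) xlnx2 0 <= 73 / 200.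
Proof.
move=> /= /andP[a0 s0] s2 a1 a2.
pose v := \sum_(b <- s) b ^+ 2.
have vE : v = 1 - a ^+ 2 by rewrite -s2 addrC addKr.
have v0 : 0 < v by rewrite vE; lra.
have bv b : b \in s -> b ^+ 2 <= v.
  move=> bs; rewrite /v (big_rem b)//= lerDl; apply: sumr_ge0 => c _; exact: sqr_ge0.
have lE b : b \in s -> lamc (2 * v) b = b ^+ 2 / (2 * v).
  move=> bs; rewrite /lamc ifT//; apply/andP; split.
    apply: divr_gt0; last by rewrite mulr_gt0.
    by rewrite exprn_even_gt0//= (allP s0 _ bs).
  by rewrite ler_pdivrMr ?mulr_gt0//; have := bv b bs; lra.
have lA : lamc (2 * v) a = 1 / 2.
  rewrite /lamc; case: ifP => // /andP[_]; rewrite ler_pdivrMr ?mulr_gt0//.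
  rewrite vE; lra.
apply: le_trans (@rad_xlnx2_cost _ (lamc (2 * v)) (lamcP _) _) _.
  rewrite big_cons lA (eq_big_seq (fun b => b ^+ 2 / (2 * v))) => [|b /lE//].
  by rewrite -mulr_suml -/v; field; rewrite gt_eqF.
rewrite big_cons lA.
have H : \sum_(b <- s) b ^+ 2 * (cost (lamc (2 * v) b) + ln `|b|) <= v * (73 / 200 + (ln 2 + ln v) / 2).
  rewrite /v mulr_suml -/v big_seq [leRHS]big_seq; apply: ler_sum => b bs.
  have b0 := allP s0 _ bs.
  rewrite ler_wpM2l ?sqr_ge0//.
  have /andP[l0 l1] := lamcP (2 * v) b.
  have := cost_le l0 l1; rewrite lE// lnM ?posrE ?exprn_even_gt0//; last by rewrite invr_gt0 mulr_gt0.
  rewrite lnsqr// lnV ?posrE ?mulr_gt0// lnM ?posrE//; lra.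
apply: (le_trans (lerD (lexx _) H)).
rewrite /cost eqxx.
have -> : ln `|a| = ln (a ^+ 2) / 2 by rewrite lnsqr//; field.
move: (a ^+ 2) a1 a2 vE v0 => A A1 A2 vE v0.
pose x := 2 * A - 1.
have AE : A = (1 + x) / 2 by rewrite /x; field.
have vE' : v = (1 - x) / 2 by rewrite vE /x; field.
have x0 : 0 < x by rewrite /x; lra.
have x1 : x <= 1 / 5 by rewrite /x; lra.
have lnA : A * (ln 2 + ln A) <= (x + x ^+ 2 / 2) / 2.
  rewrite -lnM ?posrE//; last lra.
  have := ln1D_le (ltW x0); rewrite ler_pdivlMr; last lra.
  rewrite (_ : 2 * A = 1 + x); last by rewrite AE; field.
  rewrite AE; lra.
have lnv : v * (ln 2 + ln v) <= (- x + x ^+ 2 / 2 + x ^+ 3 / 2) / 2.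
  rewrite -lnM ?posrE// (_ : 2 * v = 1 - x); last by rewrite vE'; field.
  have y0 : 0 <= x / (1 - x) by rewrite divr_ge0; lra.
  have E : 1 - x = (1 + x / (1 - x))^-1 by field; rewrite ?gt_eqF//; lra.
  have := ln1D_ge y0; rewrite E lnV ?posrE -?E; last by rewrite ltr_pwDl.
  rewrite (_ : 2 * (x / (1 - x)) / (2 + x / (1 - x)) = 2 * x / (2 - x)); last first.
    by field; rewrite !gt_eqF//; lra.
  move=> L.
  have L2 : x + x ^+ 2 / 2 <= 2 * x / (2 - x) by rewrite ler_pdivlMr; nra.
  rewrite vE'; nra.
have c0 : x ^+ 2 / 2 + x ^+ 3 / 4 <= 11 / 100 * x by nra.
have A0 : 0 <= A by lra.
have hA := ler_wpM2l A0 (@ln2_le R).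
lra.
Qed.

(** Tangent line of the logarithm at c, applied to x^2. *)
Lemma xlnx2_le_tangent (c x : R) : 0 < c -> xlnx2 x <= x ^+ 2 * (ln c + x ^+ 2 / c - 1) / 2.
Proof.
move=> c0; have [->|x0] := eqVneq x 0; first by rewrite /xlnx2 expr0n/= !mul0r.
have x2 : 0 < x ^+ 2 by rewrite exprn_even_gt0.
have -> : xlnx2 x = x ^+ 2 * ln (x ^+ 2) / 2 by rewrite lnsqr// /xlnx2; field.
rewrite ler_wpM2r// ler_wpM2l ?sqr_ge0//.
have u0 : 0 < x ^+ 2 / c by rewrite divr_gt0.
have -> : ln (x ^+ 2) = ln c + ln (x ^+ 2 / c) by rewrite -lnM ?posrE// mulrCA divff ?mulr1// gt_eqF.
have u1 : -1 < x ^+ 2 / c - 1 by lra.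
by have := le_ln1Dx u1; rewrite addrCA subrr addr0; lra.
Qed.

(** A quadratic polynomial in w^2 above the mean of x^2 ln |x| at 1 + w and
    1 - w, found numerically. *)
Let pair_le (w : R) : (xlnx2 (1 + w) + xlnx2 (1 - w)) / 2 <=
  (367 / 1000 + 19 / 8 * w ^+ 2 + w ^+ 4 / 12) / 2.
Proof.
pose z := w ^+ 2; have z0 : 0 <= z := sqr_ge0 w.
have H c : 0 < c -> (xlnx2 (1 + w) + xlnx2 (1 - w)) / 2 <= ((1 + z) * (ln c - 1) + (1 + 6 * z + z ^+ 2) / c) / 2.
  move=> c0; have h1 := xlnx2_le_tangent (1 + w) c0; have h2 := xlnx2_le_tangent (1 - w) c0.
  apply: le_trans (_ : _ <= ((1 + w) ^+ 2 * (ln c + (1 + w) ^+ 2 / c - 1) / 2 + (1 - w) ^+ 2 * (ln c + (1 - w) ^+ 2 / c - 1) / 2) / 2) _.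
    by rewrite ler_wpM2r// lerD.
  by rewrite le_eqVlt; apply/orP; left; apply/eqP; rewrite /z; field; rewrite gt_eqF.
have -> : w ^+ 4 = z ^+ 2 by rewrite /z -exprM.
rewrite -/z; clearbody z.
have l2 := @ln2_le R.
have ln15 : ln (1 + 1 / 2) <= 73 / 180 :> R.
  have h0 : 0 <= 1 / 2 :> R by lra.
  apply: le_trans (ln1D_le_cubic h0) _.
  by rewrite le_eqVlt; apply/orP; left; apply/eqP; field.
have l3 : ln 3 <= 61 / 88 + 73 / 180 :> R.
  have p : 0 < 1 + 1 / 2 :> R by lra.
  have -> : (3 : R) = 2 * (1 + 1 / 2) by field.
  by rewrite lnM ?posrE//; lra.
have l4 : ln 4 = 2 * ln 2 :> R.
  rewrite (_ : 4 = 2 * 2 :> R); last by rewrite -natrM.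
  by rewrite lnM ?posrE//; ring.
have l6 : ln 6 = ln 2 + ln 3 :> R.
  rewrite (_ : 6 = 2 * 3 :> R); last by rewrite -natrM.
  by rewrite lnM ?posrE.
have l12 : ln 12 = ln 4 + ln 3 :> R.
  rewrite (_ : 12 = 4 * 3 :> R); last by rewrite -natrM.
  by rewrite lnM ?posrE.
have z1 : 0 <= 1 + z by lra.
(* the best constant c is close to (1 + 6 z + z^2) / (1 + z) *)
have [zl|zl] := leP z (71 / 200).
  apply: le_trans (H 2 _) _ => //.
  have hz : 0 <= z * (71 / 200 - z) by apply: mulr_ge0; lra.
  have := ler_wpM2l z1 l2; lra.
have [zm|zm] := leP z (3 / 4).
  apply: le_trans (H 3 _) _ => //.
  have hz : 0 <= (z - 71 / 200) * (3 / 4 - z) by apply: mulr_ge0; lra.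
  have := ler_wpM2l z1 l3; lra.
have [zn|zn] := leP z 2.
  apply: le_trans (H 4 _) _ => //.
  have := ler_wpM2l z1 l2; rewrite l4.
  have hz : 0 <= (z - 3 / 4) * (2 - z) by apply: mulr_ge0; lra.
  lra.
have [zo|zo] := leP z 4.
  apply: le_trans (H 6 _) _ => //.
  have := ler_wpM2l z1 l2; have := ler_wpM2l z1 l3; rewrite l6.
  have hz : 0 <= (z - 2) * (4 - z) by apply: mulr_ge0; lra.
  lra.
apply: le_trans (H 12 _) _ => //.
have := ler_wpM2l z1 l2; have := ler_wpM2l z1 l3; rewrite l12 l4; lra.
Qed.

(** One coefficient a carries at least 3/5: averaging over its sign first, the
    rest g enters only through its second and fourth moments, by the estimate
    for a pair with w = g / a. *)
Let rad_xlnx2_peak a s : a ^+ 2 + \sum_(b <- s) b ^+ 2 = 1 ->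
  3 / 5 <= a ^+ 2 -> rad (a :: s) xlnx2 0 <= 73 / 200.
Proof.
move=> s2 a2.
have a0 : a != 0 by apply/eqP => a0; move: a2; rewrite a0 expr0n/=; lra.
have A0 : 0 < a ^+ 2 by rewrite exprn_even_gt0.
pose v := \sum_(b <- s) b ^+ 2.
have vE : v = 1 - a ^+ 2 by rewrite -s2 addrC addKr.
have v0 : 0 <= v by apply: sumr_ge0 => b _; exact: sqr_ge0.
have shiftr t (F : R -> R) x y : rad t F (x + y) = rad t (fun z => F (z + y)) x.
  elim: t x => [//|b t IH] x; rewrite !rad_cons -!IH; congr ((rad _ _ _ + rad _ _ _) / 2); ring.
rewrite rad_cons !shiftr -radD mulrC -radZ.
apply: (@le_trans _ _ (rad s (fun g => (367 / 2000 * a ^+ 2 + ln `|a| * a ^+ 2) * 1 +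
   ((19 / 16 + ln `|a|) * g ^+ 2 + (24 * a ^+ 2)^-1 * g ^+ 4)) 0)).
  apply: le_rad => g.
  pose w := g / a.
  have gE : g = a * w by rewrite /w mulrCA divff ?mulr1.
  have -> : xlnx2 (g + a) = xlnx2 (a * (1 + w)) by congr xlnx2; rewrite gE; ring.
  have -> : xlnx2 (g - a) = xlnx2 (a * (1 - w)).
    by rewrite gE /xlnx2 (_ : a * w - a = - (a * (1 - w))) ?sqrrN ?normrN//; ring.
  rewrite !xlnx2M.
  have := ler_wpM2l (ltW A0) (pair_le w).
  rewrite (_ : _ * _ + (_ + _) = a ^+ 2 * ((367 / 1000 + 19 / 8 * w ^+ 2 + w ^+ 4 / 12) / 2) + xlnx2 a * (1 + w ^+ 2)); last first.
    by rewrite gE /xlnx2; field.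
  rewrite (_ : 2^-1 * _ = a ^+ 2 * ((xlnx2 (1 + w) + xlnx2 (1 - w)) / 2) + xlnx2 a * (1 + w ^+ 2)); last by field.
  by rewrite lerD2r.
rewrite radD radZ rad_cst mulr1 radD !radZ rad_sqr expr0n add0r -/v.
have := @rad_pow4 R s 0; rewrite !expr0n/= mulr0 mul0r !add0r -/v => H4.
have iA : 0 <= (24 * a ^+ 2)^-1 by rewrite invr_ge0 mulr_ge0// ltW.
have := ler_wpM2l iA H4.
have lnA : ln `|a| = ln (a ^+ 2) / 2 by rewrite lnsqr//; field.
rewrite lnA; move: (rad _ _ _) => M4 HM.
move: (a ^+ 2) a2 A0 vE iA HM => A a2 A0 vE iA HM.
(* tangent line of ln at 3/5 *)
have L1 : ln A <= - (1 / 2 + 1 / 96) + (5 / 3 * A - 1).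
  have -> : A = (3 / 5) * (5 / 3 * A) by field.
  have B0 : 0 < 5 / 3 * A by rewrite mulr_gt0.
  have B1 : -1 < 5 / 3 * A - 1 by lra.
  have C1 : 0 <= 2 / 3 :> R by lra.
  have := le_ln1Dx B1; rewrite addrCA subrr addr0 => B2.
  have := ln1D_ge_cubic C1.
  rewrite (_ : 2 * (2 / 3) / (2 + 2 / 3) + 2 / 3 * (2 / 3) ^+ 3 / (2 + 2 / 3) ^+ 3 = 1 / 2 + 1 / 96); last by field.
  have D0 : 0 < 1 + 2 / 3 :> R by lra.
  rewrite lnM ?posrE//.
  rewrite (_ : 3 / 5 = (1 + 2 / 3)^-1 :> R); last by field.
  rewrite lnV ?posrE// (_ : 5 / 3 * ((1 + 2 / 3)^-1 * (5 / 3 * A)) = 5 / 3 * A); last by field.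
  lra.
have HM2 : (24 * A)^-1 * (3 * v ^+ 2) <= 5 / 24 * v ^+ 2.
  rewrite (_ : (24 * A)^-1 * (3 * v ^+ 2) = (v ^+ 2 / 8) / A); last by field; rewrite gt_eqF.
  by rewrite ler_pdivrMr//; have := sqr_ge0 v; nra.
have A1 : A <= 1 by lra.
rewrite vE in HM HM2 *.
nra.
Qed.

(** The derivative at q = 2 of the sharp Khinchine inequality. By the central
    limit theorem the bound cannot be smaller than the Gaussian value
    (2 - ln 2 - gamma) / 2 = 0.3648..., so that little room is left; the three
    cases differ in how much of the variance the largest coefficient carries. *)
Theorem rad_xlnx2_le s : \sum_(a <- s) a ^+ 2 = 1 -> rad s xlnx2 0 <= 365 / 1000.
Proof.
have -> : (365 / 1000 : R) = 73 / 200 by field.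
move=> s2; rewrite -rad_filter0.
have {}s2 : \sum_(a <- s | a != 0) a ^+ 2 = 1.
  by rewrite -s2 [RHS](bigID (fun a => a != 0))/= [X in _ + X]big1 ?addr0// => a; rewrite negbK => /eqP ->; rewrite expr0n.
rewrite -big_filter in s2.
have : all (fun a => a != 0) [seq a <- s | a != 0] by exact: filter_all.
move: [seq a <- s | a != 0] s2 => {}s s2 s0.
have [sl|] := boolP (all (fun a => a ^+ 2 <= 1 / 2) s); first exact: rad_xlnx2_spread.
move=> /allPn[a ain]; rewrite -ltNge => a2.
have [s1 [s3 sE]] : exists s1 s3, s = s1 ++ a :: s3.
  by case/splitPr: ain => s1 s3; exists s1, s3.
move: s2 s0; rewrite sE rad_move big_cat big_cons/= addrCA -big_cat all_cat/= andbCA -all_cat.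
move=> s2 s0; have [a3|/ltW a3] := leP (a ^+ 2) (3 / 5).
  exact: rad_xlnx2_head.
exact: rad_xlnx2_peak.
Qed.

End EntropyBound.

(** * Scalars *)

Section Modulus.
Context {R : realType}.
Variable s : scalars.
Local Notation K := (base_field R s).
Implicit Types (z w : K) (r : R).

Definition emb : R -> K :=
  match s return R -> base_field R s with
  | RealScalars => id
  | ComplexScalars => fun r => real_complex R r
  end.

Lemma embD : {morph emb : x y / x + y}.
Proof. by rewrite /emb; case: s => x y //; exact: rmorphD. Qed.

Lemma embM : {morph emb : x y / x * y}.
Proof. by rewrite /emb; case: s => x y //; exact: rmorphM. Qed.

Lemma emb0 : emb 0 = 0.
Proof. by rewrite /emb; case: s. Qed.

Lemma emb1 : emb 1 = 1.
Proof. by rewrite /emb; case: s. Qed.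

Lemma emb_sum I (r : seq I) (P : pred I) (F : I -> R) :
  emb (\sum_(i <- r | P i) F i) = \sum_(i <- r | P i) emb (F i).
Proof. by apply: big_morph; [exact: embD|exact: emb0]. Qed.

Lemma emb_prod I (r : seq I) (P : pred I) (F : I -> R) :
  emb (\prod_(i <- r | P i) F i) = \prod_(i <- r | P i) emb (F i).
Proof. by apply: big_morph; [exact: embM|exact: emb1]. Qed.

Lemma modulus_ge0 z : 0 <= modulus z.
Proof. by case: s z => //= -[x y]; exact: sqrtr_ge0. Qed.

Lemma modulus0 : modulus (0 : K) = 0.
Proof. by case: s => /=; [exact: normr0|exact: ComplexField.Normc.normc0]. Qed.

Lemma modulus1 : modulus (1 : K) = 1.
Proof. by case: s => /=; [exact: normr1|exact: ComplexField.Normc.normc1]. Qed.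

Lemma modulusM z w : modulus (z * w) = modulus z * modulus w.
Proof. by case: s z w => /= z w; [exact: normrM|exact: ComplexField.Normc.normcM]. Qed.

Lemma modulusD z w : modulus (z + w) <= modulus z + modulus w.
Proof. by case: s z w => /= z w; [exact: ler_normD|exact: le_normcD]. Qed.

Lemma modulus_sum I (r : seq I) (P : pred I) (F : I -> K) :
  modulus (\sum_(i <- r | P i) F i) <= \sum_(i <- r | P i) modulus (F i).
Proof.
elim/big_ind2: _ => // [|x y z w xy zw]; first by rewrite modulus0.
exact: le_trans (modulusD _ _) (lerD _ _).
Qed.

Lemma modulus_prod I (r : seq I) (P : pred I) (F : I -> K) :
  modulus (\prod_(i <- r | P i) F i) = \prod_(i <- r | P i) modulus (F i).
Proof. by apply: big_morph; [exact: modulusM|exact: modulus1]. Qed.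

Lemma modulus_emb r : modulus (emb r) = `|r|.
Proof.
rewrite /emb; case: s => //=.
by rewrite expr0n/= addr0 sqrtr_sqr.
Qed.

Lemma modulus_eq0 z : (modulus z == 0) = (z == 0).
Proof.
apply/eqP/eqP => [|->]; last exact: modulus0.
case: s z => /= z; first by move/eqP; rewrite normr_eq0 => /eqP.
exact: ComplexField.Normc.eq0_normc.
Qed.

Lemma modulus_phase z : exists2 u : K, modulus u = 1 & u * z = emb (modulus z).
Proof.
have [->|z0] := eqVneq z 0.
  by exists 1; rewrite ?modulus1// mulr0 modulus0 emb0.
exists (emb (modulus z) / z); last by rewrite divfK.
have mz : modulus z != 0 by rewrite modulus_eq0.
apply: (mulIf mz); rewrite -modulusM divfK// modulus_emb mul1r ger0_norm//.
exact: modulus_ge0.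
Qed.

End Modulus.

Section Khinchine.
Context {R : realType}.
Variable s : scalars.
Local Notation K := (base_field R s).
Implicit Types (l : seq K) (z a : K).

(** Four phases suffice in the complex case: the second moment is that of a
    sum with uniformly distributed phases, and the fourth moment obeys the
    same bound. *)
Definition phases : seq K :=
  match s return seq (base_field R s) with
  | RealScalars => [:: 1; -1]
  | ComplexScalars => [:: 1; -1; Complex 0 1; Complex 0 (-1)]
  end.

Lemma phases_gt0 : (0 < size phases)%N.
Proof. by rewrite /phases; case: s. Qed.

Lemma modulus_phases z : z \in phases -> modulus z = 1.
Proof.
rewrite /phases; case: s z => z; rewrite !inE.
  by move=> /orP[] /eqP -> /=; rewrite ?normrN normr1.
move=> /or4P[] /eqP -> /=; rewrite ?normcN ?oppr0 ?expr0n ?sqrrN ?expr1n/= ?addr0 ?add0r ?sqrtr1//.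
Qed.
End Khinchine.

Section KhinchineReal.
Context {R : realType}.

Lemma phase_avg_real (l : seq R) F x : phase_avg (phases RealScalars) l F x = rad l F x.
Proof. by []. Qed.

End KhinchineReal.

Section KhinchineComplex.
Context {R : realType}.
Local Notation C := R[i].
Local Notation nrm := (@ComplexField.Normc.normc R).
Local Notation avg := (@phase_avg R C (phases ComplexScalars)).

Lemma normc_sqr (z : C) : nrm z ^+ 2 = complex.Re z ^+ 2 + complex.Im z ^+ 2.
Proof. by case: z => x y /=; rewrite sqr_sqrtr// addr_ge0// sqr_ge0. Qed.

Let avg_cons a l F x : avg (a :: l) F x =
  (avg l F (x + a) + avg l F (x - a) + avg l F (x + Complex 0 1 * a) + avg l F (x + Complex 0 (-1) * a)) / 4.
Proof.
by rewrite /= !big_cons big_nil addr0 mul1r mulN1r !addrA.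
Qed.

Lemma avg_normc2 l (x : C) :
  avg l (fun z => nrm z ^+ 2) x = nrm x ^+ 2 + \sum_(a <- l) nrm a ^+ 2.
Proof.
elim: l x => [|a l IH] x; first by rewrite big_nil addr0.
rewrite avg_cons !IH big_cons !normc_sqr.
by case: x a => [x y] [u v] /=; field.
Qed.

(** The fourth moment of a complex Gaussian is twice the square of its
    variance; the real case has the factor three instead. *)
Lemma avg_normc4 l (x : C) : avg l (fun z => nrm z ^+ 4) x <=
  nrm x ^+ 4 + 4 * nrm x ^+ 2 * (\sum_(a <- l) nrm a ^+ 2) + 2 * (\sum_(a <- l) nrm a ^+ 2) ^+ 2.
Proof.
elim: l x => [|a l IH] x; first by rewrite big_nil !mulr0 expr0n/= mulr0 !addr0.
rewrite avg_cons big_cons; set V := \sum_(_ <- l) _ in IH *.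
have pow4 (z : C) : nrm z ^+ 4 = (nrm z ^+ 2) ^+ 2 by rewrite -exprM.
apply: (@le_trans _ _ ((\sum_(z <- [:: x + a; x - a; x + Complex 0 1 * a; x + Complex 0 (-1) * a])
   (nrm z ^+ 4 + 4 * nrm z ^+ 2 * V + 2 * V ^+ 2)) / 4)).
  rewrite !big_cons big_nil addr0 !addrA ler_wpM2r//.
  have := IH (x + a); have := IH (x - a).
  by have := IH (x + Complex 0 1 * a); have := IH (x + Complex 0 (-1) * a); lra.
rewrite !big_cons big_nil !pow4 !normc_sqr; clearbody V.
case: x a => [x y] [u v] /=.
rewrite -subr_ge0 (_ : _ - _ = (u ^+ 2 + v ^+ 2) ^+ 2) ?sqr_ge0//.
by field.
Qed.

End KhinchineComplex.

(** * The Khinchine inequality *)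

Lemma rad_xlnx2_scaled (R : realType) (l : seq R) (V := \sum_(a <- l) a ^+ 2) : 0 < V ->
  rad l xlnx2 0 <= V * (365 / 1000 + ln V / 2).
Proof.
move=> V0.
pose c := Num.sqrt V; have c0 : 0 < c by rewrite sqrtr_gt0.
have c2 : c ^+ 2 = V by rewrite sqr_sqrtr// ltW.
have lE : l = [seq c * a | a <- [seq c^-1 * a | a <- l]].
  rewrite -map_comp -[LHS]map_id; apply: eq_map => a /=.
  by rewrite mulrA divff ?mul1r// gt_eqF.
rewrite {1}lE -(mulr0 c) rad_scale (eq_rad _ _ (_ : _ =1 (fun z => c ^+ 2 * xlnx2 z + xlnx2 c * z ^+ 2))).
  rewrite radD !radZ rad_sqr expr0n add0r big_map.
  have -> : \sum_(a <- l) (c^-1 * a) ^+ 2 = 1.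
    under eq_bigr do rewrite exprMn.
    by rewrite -mulr_sumr -/V exprVn c2 mulVf// gt_eqF.
  have -> : xlnx2 c = V * (ln V / 2).
    by rewrite /xlnx2 gtr0_norm// -c2 lnXn// mulr2n; field.
  rewrite c2 mulr1 mulrDr lerD2r ler_wpM2l ?(ltW V0)//.
  apply: rad_xlnx2_le; rewrite big_map.
  under eq_bigr do rewrite exprMn.
  by rewrite -mulr_sumr -/V exprVn c2 mulVf// gt_eqF.
by move=> z; rewrite xlnx2M.
Qed.

Section Khinchine.
Context {R : realType}.
Variable s : scalars.
Local Notation K := (base_field R s).
Local Notation avg := (@phase_avg R K (phases s)).
Implicit Types (l : seq K) (z a : K) (q : R).

Lemma avg_modulus2 l : avg l (fun z => modulus z ^+ 2) 0 = \sum_(a <- l) modulus a ^+ 2.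
Proof.
case: s l => l.
  under eq_phase_avg do rewrite /= real_normK ?num_real//.
  rewrite phase_avg_real rad_sqr expr0n add0r.
  by apply: eq_bigr => a _ /=; rewrite real_normK ?num_real.
by rewrite avg_normc2 ComplexField.Normc.normc0 expr0n add0r.
Qed.

(** For complex scalars the crude bound by the fourth moment suffices: it gives
    ln 2 / 2 < 365 / 1000. *)
Lemma avg_xlnx2 l (V := \sum_(a <- l) modulus a ^+ 2) : 0 < V ->
  avg l (fun z => xlnx2 (modulus z)) 0 <= V * (365 / 1000 + ln V / 2).
Proof.
rewrite /V {V}; case: s l => l.
  rewrite (eq_bigr (fun a : R => a ^+ 2)); last by move=> a _ /=; rewrite real_normK ?num_real.
  set V := \sum_(_ <- _) _ => V0.
  have -> : @phase_avg R R (phases RealScalars) l (fun z : R => xlnx2 `|z|) 0 = rad l xlnx2 0.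
    by rewrite phase_avg_real; apply: eq_rad => z; rewrite /xlnx2 normr_id real_normK ?num_real.
  exact: rad_xlnx2_scaled.
rewrite /=; set V := \sum_(_ <- _) _ => V0.
have V2 : 0 < 2 * V by rewrite mulr_gt0.
apply: (@le_trans _ _ (@phase_avg R R[i] (phases ComplexScalars) l (fun z : R[i] => (ln (2 * V) - 1) / 2 * ComplexField.Normc.normc z ^+ 2
    + (4 * V)^-1 * ComplexField.Normc.normc z ^+ 4) 0)).
  apply: le_phase_avg => z; set N := ComplexField.Normc.normc z.
  have N0 : 0 <= N by apply: (@modulus_ge0 R ComplexScalars).
  apply: le_trans (xlnx2_le_tangent N V2) _.
  by rewrite le_eqVlt; apply/orP; left; apply/eqP; field; rewrite gt_eqF.
rewrite phase_avgD !phase_avgZ avg_normc2 -/V.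
have := avg_normc4 l 0; rewrite -/V ComplexField.Normc.normc0 !expr0n/= mulr0 mul0r !add0r => H4.
have iV : 0 <= (4 * V)^-1 by rewrite invr_ge0 mulr_ge0// ltW.
have := ler_wpM2l iV H4.
rewrite (_ : (4 * V)^-1 * (2 * V ^+ 2) = V / 2); last by field; rewrite gt_eqF.
rewrite lnM ?posrE// => H.
have := ler_wpM2l (ltW V0) (@ln2_le R).
lra.
Qed.

(** With respect to the weight |z|^2 the left-hand quantity is a mean of
    |z|^(q - 2), an exponential of ln |z|; Jensen's inequality, in the form of
    the tangent line of exp, reduces it to the entropy bound. *)
Lemma khinchine_avg l q : 0 < q <= 2 ->
  expR (- (2 - q) * (365 / 1000)) * (\sum_(a <- l) modulus a ^+ 2) `^ (q / 2)
    <= avg l (fun z => modulus z `^ q) 0.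
Proof.
move=> /andP[q0 q2].
have V0 : 0 <= \sum_(a <- l) modulus a ^+ 2 by apply: sumr_ge0 => a _; exact: sqr_ge0.
have [VE|Vn] := eqVneq (\sum_(a <- l) modulus a ^+ 2) 0.
  rewrite VE powR0 ?mulr0; last by rewrite mulf_neq0 ?invr_eq0 ?gt_eqF.
  rewrite -(@phase_avg_cst R K (phases s) (phases_gt0 s) l 0 0).
  by apply: le_phase_avg => z; exact: powR_ge0.
have {V0} Vp : 0 < \sum_(a <- l) modulus a ^+ 2 by rewrite lt_neqAle eq_sym Vn.
have H1 := avg_xlnx2 Vp; have H2 := avg_modulus2 l.
move: (\sum_(a <- l) modulus a ^+ 2) Vp H1 H2 {Vn} => V V0 H1 H2.
pose c := 365 / 1000 + ln V / 2; pose d := 2 - q.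
have d0 : 0 <= d by rewrite subr_ge0.
(* the tangent of exp is taken at the entropy bound c of the normalised sum *)
apply: (@le_trans _ _ (avg l (fun z => (expR (- (d * c)) * (1 + d * c)) * modulus z ^+ 2
   + (- (d * expR (- (d * c)))) * xlnx2 (modulus z)) 0)).
  rewrite phase_avgD !phase_avgZ H2.
  have -> : expR (- (2 - q) * (365 / 1000)) * V `^ (q / 2) = expR (- (d * c)) * V.
    have lnKV : expR (ln V) = V by rewrite lnK ?posrE.
    rewrite /powR gt_eqF// -expRD -[X in _ = _ * X]lnKV -expRD.
    by congr expR; rewrite /d /c; field.
  have E0 : 0 <= expR (- (d * c)) * d by rewrite mulr_ge0// expR_ge0.
  have := ler_wpM2l E0 H1; rewrite -/c; lra.
apply: le_phase_avg => z; set N := modulus z.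
have N0 : 0 <= N := modulus_ge0 z.
have [->|Nn] := eqVneq N 0.
  by rewrite /xlnx2 expr0n/= !(mulr0, mul0r) addr0 powR0// gt_eqF.
have Np : 0 < N by rewrite lt_neqAle eq_sym Nn.
have -> : N `^ q = N ^+ 2 * (expR (- (d * c)) * expR (- (d * (ln N - c)))).
  rewrite /powR (negPf Nn) -expRD -[N ^+ 2]lnK ?posrE ?exprn_gt0// -expRD lnXn//.
  by congr expR; rewrite /d mulr2n; ring.
rewrite /xlnx2 ger0_norm//.
have E := expR_ge1Dx (- (d * (ln N - c))).
rewrite (_ : _ + _ = N ^+ 2 * (expR (- (d * c)) * (1 - d * (ln N - c)))); last by ring.
by rewrite ler_wpM2l ?sqr_ge0// ler_wpM2l ?expR_ge0.
Qed.

Let ex_ge_avg (T : eqType) (r : seq T) (f : T -> R) : (0 < size r)%N ->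
  exists2 g, g \in r & (\sum_(h <- r) f h) / (size r)%:R <= f g.
Proof.
move=> r0; apply: contrapT => H.
set A := _ / _ in H.
have H2 g : g \in r -> f g < A.
  by move=> gr; rewrite ltNge; apply/negP => le; apply: H; exists g.
have sz : (0 : R) < (size r)%:R by rewrite ltr0n.
have : \sum_(h <- r) f h < \sum_(h <- r) A.
  rewrite big_seq [ltRHS]big_seq; apply: ltr_sum => //.
  by case: (r) r0 => [//|x r' _]; apply/hasP; exists x; rewrite mem_head.
rewrite big_const_seq count_predT iter_addr_0 -mulr_natr divfK ?gt_eqF//.
by rewrite ltxx.
Qed.

(** The sum over j of the averages is the average of the sum over j, so some
    choice of phases does at least as well as the average; fixing the phases
    one after the other finds it. *)
Lemma khinchine_family (J : finType) (n : nat) (c : J -> 'I_n -> K) q : 0 < q <= 2 ->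
  exists2 x : 'I_n -> K, (forall i, modulus (x i) = 1) &
    expR (- (2 - q) * (365 / 1000)) * \sum_j (\sum_i modulus (c j i) ^+ 2) `^ (q / 2)
      <= \sum_j modulus (\sum_i x i * c j i) `^ q.
Proof.
move=> q02.
pose F z := modulus (z : K) `^ q.
have derand (r : seq 'I_n) (u : J -> K) : uniq r ->
  exists2 x : 'I_n -> K, (forall i, modulus (x i) = 1) &
    \sum_j avg [seq c j i | i <- r] F (u j) <= \sum_j F (u j + \sum_(i <- r) x i * c j i).
  elim: r u => [|i r IH] u /=.
    move=> _; exists (fun=> 1) => [_|]; first exact: modulus1.
    by apply: ler_sum => j _; rewrite big_nil addr0.
  move=> /andP[ir ur].
  have [g gG Hg] := @ex_ge_avg _ (phases s)
    (fun g => \sum_j avg [seq c j i | i <- r] F (u j + g * c j i)) (phases_gt0 s).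
  have [x x1 Hx] := IH (fun j => u j + g * c j i) ur.
  exists (fun k => if k == i then g else x k).
    by move=> k; case: eqP => // _; exact: modulus_phases.
  rewrite -mulr_suml exchange_big/=; apply: (le_trans Hg); apply: (le_trans Hx).
  apply: ler_sum => j _; rewrite big_cons eqxx addrA.
  rewrite le_eqVlt; apply/orP; left; apply/eqP; congr (F (_ + _)).
  apply: eq_big_seq => k kr; case: eqP => // ki.
  by rewrite ki in kr; rewrite kr in ir.
have [x x1 Hx] := derand (index_enum 'I_n) (fun=> 0) (index_enum_uniq _).
exists x => //.
rewrite mulr_sumr.
apply: le_trans (_ : \sum_j avg [seq c j i | i <- index_enum 'I_n] F 0 <= _).
  apply: ler_sum => j _; have := khinchine_avg [seq c j i | i <- index_enum 'I_n] q02.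
  by rewrite big_map.
by apply: (le_trans Hx); apply: ler_sum => j _; rewrite add0r.
Qed.

End Khinchine.

(** * The Loomis-Whitney inequality *)

Lemma amgm_seq (R : realType) (T : Type) (r : seq T) (c : T -> R) : (forall i, 0 <= c i) ->
  (0 < size r)%N ->
  \prod_(i <- r) c i <= (\sum_(i <- r) c i ^+ size r) / (size r)%:R.
Proof.
move=> c0 r0; set N := size r.
have N0 : (0 : R) < N%:R by rewrite ltr0n.
have s0 (i : T) : 0 < N%:R / 2 :> R by rewrite divr_gt0.
have s1 : \sum_(i <- r) (2 * (N%:R / 2))^-1 = 1 :> R.
  rewrite big_const_seq count_predT iter_addr_0 -/N -mulr_natr.
  by field; rewrite gt_eqF.
have := @amgm_powR R T r c (fun=> N%:R / 2) s0 s1.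
rewrite (eq_bigr c) => [/le_trans|i _]; last by rewrite ger0_norm.
apply; rewrite mulr_suml le_eqVlt; apply/orP; left; apply/eqP; apply: eq_bigr => i _.
rewrite mulrCA divff ?pnatr_eq0// mulr1 mulrC; congr (_ / _).
by rewrite -powR_mulrn// -powRrM mulrCA divff ?pnatr_eq0// mulr1 powR_mulrn.
Qed.

Section Cube.
Context {R : realType} {m n : nat}.
Local Notation J := {ffun 'I_m -> 'I_n}.
Implicit Types (j : J) (k l : 'I_m) (i : 'I_n) (f g : J -> R) (A : {set 'I_m}).

Definition upd j k i : J := [ffun l => if l == k then i else j l].

Lemma updE j k i l : upd j k i l = if l == k then i else j l.
Proof. by rewrite ffunE. Qed.

Definition indep k (T : Type) (f : J -> T) := forall j i, f (upd j k i) = f j.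

Lemma upd_upd j k i i' : upd (upd j k i) k i' = upd j k i'.
Proof. by apply/ffunP => l; rewrite !updE; case: eqP. Qed.

Lemma upd_id j k : upd j k (j k) = j.
Proof. by apply/ffunP => l; rewrite !updE; case: eqP => // ->. Qed.

Lemma updC j k l i i' : k != l -> upd (upd j k i) l i' = upd (upd j l i') k i.
Proof.
move=> kl; apply/ffunP => t; rewrite !updE.
by case: (eqVneq t l) => // ->; case: eqP => // lk; rewrite lk eqxx in kl.
Qed.

(** The map (j, i) -> (upd j k i, j k) is an involution. *)
Lemma sum_upd (V : nmodType) k (F : J -> 'I_n -> V) :
  \sum_j \sum_i F (upd j k i) (j k) = \sum_j \sum_i F j i.
Proof.
rewrite !pair_big/=.
rewrite [RHS](reindex (fun p : J * 'I_n => (upd p.1 k p.2, p.1 k)))/=.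
  by apply: eq_bigr => -[j i].
exists (fun p : J * 'I_n => (upd p.1 k p.2, p.1 k)) => -[j i] _ /=;
  by rewrite upd_upd upd_id updE eqxx.
Qed.

Definition mean f : R := (\sum_j f j) / #|{: J}|%:R.
Definition cmean k f j : R := (\sum_i f (upd j k i)) / n%:R.

Lemma indep_cmean k f : indep k (cmean k f).
Proof. by move=> j i; rewrite /cmean; congr (_ / _); apply: eq_bigr => i' _; rewrite upd_upd. Qed.

Lemma indep_cmean_other k l f : indep l f -> indep l (cmean k f).
Proof.
have [->|kl] := eqVneq k l; first by move=> _; exact: indep_cmean.
move=> fl j i; rewrite /cmean; congr (_ / _); apply: eq_bigr => i' _.
by rewrite updC 1?eq_sym// fl.
Qed.

Lemma cmeanM k f g j : indep k g -> cmean k (fun j => g j * f j) j = g j * cmean k f j.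
Proof.
by move=> gk; rewrite /cmean mulrA mulr_sumr; congr (_ / _); apply: eq_bigr => i _; rewrite gk.
Qed.

Lemma cmean_ge0 k f j : (forall j, 0 <= f j) -> 0 <= cmean k f j.
Proof. by move=> f0; rewrite divr_ge0// sumr_ge0. Qed.

Lemma le_mean f g : (forall j, f j <= g j) -> mean f <= mean g.
Proof. by move=> fg; rewrite ler_wpM2r ?invr_ge0// ler_sum. Qed.

Lemma meanD f g : mean (fun j => f j + g j) = mean f + mean g.
Proof. by rewrite /mean -mulrDl -big_split. Qed.

Lemma meanZ c f : mean (fun j => c * f j) = c * mean f.
Proof. by rewrite /mean mulrA mulr_sumr. Qed.

Lemma mean_sum I (r : seq I) (P : pred I) (F : I -> J -> R) :
  mean (fun j => \sum_(x <- r | P x) F x j) = \sum_(x <- r | P x) mean (F x).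
Proof. by rewrite /mean exchange_big/= mulr_suml. Qed.

Hypothesis n0 : (0 < n)%N.

Lemma card_cube_gt0 : (0 < #|{: J}|)%N.
Proof. by rewrite card_ffun !card_ord expn_gt0 n0. Qed.

Lemma mean_cst c : mean (fun=> c) = c.
Proof.
by rewrite /mean sumr_const -(mulr_natr c) mulfK// pnatr_eq0 -lt0n card_cube_gt0.
Qed.

Lemma mean_cmean k f : mean (cmean k f) = mean f.
Proof.
rewrite /mean; congr (_ / _).
rewrite /cmean -mulr_suml (@sum_upd _ k (fun j _ => f j)).
under eq_bigr do rewrite sumr_const card_ord -mulr_natr.
by rewrite -mulr_suml mulfK// pnatr_eq0 -lt0n.
Qed.

Lemma cmean_eq0 k f j : (forall j, 0 <= f j) -> cmean k f j = 0 -> f j = 0.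
Proof.
move=> f0 /eqP; rewrite mulf_eq0 invr_eq0 pnatr_eq0 (gtn_eqF n0) orbF.
rewrite psumr_eq0// => /allP/(_ (j k)); rewrite mem_index_enum => /(_ isT)/eqP.
by rewrite upd_id.
Qed.

Let root p (x : R) : R := x `^ (p%:R^-1).
Let rootX p x : (0 < p)%N -> 0 <= x -> root p x ^+ p = x.
Proof.
move=> p0 x0; rewrite -powR_mulrn ?powR_ge0// -powRrM mulVf ?powRr1//.
by rewrite pnatr_eq0 -lt0n.
Qed.

(** The Hoelder inequality with several equal exponents, along one coordinate. *)
Let cmean_prod (T : Type) (r : seq T) k (G : T -> J -> R) j :
  (0 < size r)%N -> (forall t j, 0 <= G t j) ->
  cmean k (fun j => \prod_(t <- r) G t j) j <=
  \prod_(t <- r) root (size r) (cmean k (fun j => G t j ^+ size r) j).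
Proof.
move=> r0 G0; set p := size r.
pose a t := root p (cmean k (fun j => G t j ^+ p) j).
have Gp t : 0 <= cmean k (fun j => G t j ^+ p) j by apply: cmean_ge0 => j'; rewrite exprn_ge0.
have a0 t : 0 <= a t by exact: powR_ge0.
have [Z|NZ] := boolP (has (fun t => a t == 0) r).
  have -> : cmean k (fun j => \prod_(t <- r) G t j) j = 0.
    rewrite /cmean big1 ?mul0r// => i _.
    elim: (r) Z => [//|t l IH] /= /orP[/eqP at0|/IH H]; rewrite big_cons; last by rewrite H mulr0.
    have : cmean k (fun j => G t j ^+ p) (upd j k i) = 0.
      rewrite indep_cmean -(rootX r0 (Gp t)) -/(a t) at0 expr0n.
      by rewrite (gtn_eqF r0).
    move/cmean_eq0 => -/(_ (fun j => exprn_ge0 p (G0 t j)))/eqP.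
    by rewrite expf_eq0 => /andP[_ /eqP ->]; rewrite mul0r.
  by apply: prodr_ge0 => t _; exact: a0.
have ap : all (fun t => 0 < a t) r.
  apply: sub_all (_ : all (fun t => a t != 0) r); last by rewrite all_predC.
  by move=> t at0; rewrite lt_neqAle eq_sym at0 a0.
have prodap : 0 < \prod_(t <- r) a t.
  by elim: (r) ap => [|t l IH] /=; rewrite ?big_nil// big_cons => /andP[h /IH]; exact: mulr_gt0.
rewrite -[leRHS]mul1r -ler_pdivrMr//.
apply: (@le_trans _ _ (cmean k (fun j => (\sum_(t <- r) (G t j / a t) ^+ p) / p%:R) j)).
  rewrite /cmean mulrAC ler_wpM2r ?invr_ge0// mulr_suml; apply: ler_sum => i _.
  have := @amgm_seq R T r (fun t => G t (upd j k i) / a t) (fun t => divr_ge0 (G0 _ _) (a0 _)) r0.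
  by rewrite big_split/= prodfV.
have p0 : (p%:R : R) != 0 by rewrite pnatr_eq0 -lt0n.
have -> : cmean k (fun j => (\sum_(t <- r) (G t j / a t) ^+ p) / p%:R) j =
   (\sum_(t <- r) cmean k (fun j => G t j ^+ p) j / a t ^+ p) / p%:R.
  rewrite /cmean -mulr_suml exchange_big/= mulrAC; congr (_ / _).
  rewrite mulr_suml; apply: eq_bigr => t _.
  by rewrite mulrAC; congr (_ / _); rewrite mulr_suml; apply: eq_bigr => i _; rewrite expr_div_n.
have p1 : (0 : R) < p%:R by rewrite ltr0n.
rewrite ler_pdivrMr// mul1r (_ : p%:R = \sum_(t <- r) 1); last by rewrite big_const_seq count_predT iter_addr_0.
rewrite le_eqVlt; apply/orP; left; apply/eqP.
elim: (r) ap => [|t l IH] /=; rewrite ?big_nil// !big_cons => /andP[h /IH ->].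
congr (_ + _); rewrite [X in _ / X]rootX// divff//.
by rewrite -(rootX r0 (Gp t)) expf_neq0// gt_eqF.
Qed.

(** The Loomis-Whitney inequality in the form of Finner. The coordinates in A
    are averaged out one after the other: the factor that misses the current
    coordinate passes through the average, and the Hoelder inequality treats
    the p others. *)
Lemma loomis_whitney A (F : 'I_m -> J -> R) p : #|A| = p.+1 -> (0 < p)%N ->
  (forall k j, 0 <= F k j) ->
  (forall k, k \in A -> indep k (F k)) ->
  (forall k l, l \notin A -> indep l (F k)) ->
  (forall k, k \in A -> mean (fun j => F k j ^+ p) <= 1) ->
  mean (fun j => \prod_(k in A) F k j) <= 1.
Proof.
move=> cA p0 F0 Fk Fl F1.
(* r lists the coordinates that have not been averaged out yet *)
suff : forall (r : seq 'I_m), {subset r <= A} ->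
  forall F : 'I_m -> J -> R, (forall k j, 0 <= F k j) ->
  (forall k, k \in A -> indep k (F k)) ->
  (forall k l, l \notin r -> indep l (F k)) ->
  (forall k, k \in A -> mean (fun j => F k j ^+ p) <= 1) ->
  mean (fun j => \prod_(k in A) F k j) <= 1.
  move=> /(_ (enum A)); apply => //; first by move=> k; rewrite mem_enum.
  by move=> k l; rewrite mem_enum; exact: Fl.
move=> r; elim: r => [|t r IH] rA {Fk Fl F1 F0}F F0 Fk Fl F1.
  have cst k j j' : F k j = F k j'.
    have H : forall l : seq 'I_m, F k j = F k [ffun x => if x \in l then j' x else j x].
      elim=> [|x l IHl]; first by congr (F k _); apply/ffunP => y; rewrite ffunE.
      rewrite IHl -(Fl k x isT _ (j' x)); congr (F k _); apply/ffunP => y.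
      by rewrite updE !ffunE inE; case: eqP => // ->.
    by rewrite (H (enum 'I_m)); congr (F k _); apply/ffunP => y; rewrite ffunE mem_enum.
  rewrite -[leRHS](mean_cst 1); apply: le_mean => j /=.
  apply: prodr_ile1 => k kA; rewrite F0/=.
  have := F1 k kA; rewrite (_ : (fun _ => _) = (fun=> F k j ^+ p)).
    by rewrite mean_cst expr_le1.
  by apply/funext => j'; rewrite (cst k j' j).
have tA : t \in A by apply: rA; rewrite mem_head.
pose F' k j := if k == t then F k j else root p (cmean t (fun j => F k j ^+ p) j).
have Fp k j : 0 <= cmean t (fun j => F k j ^+ p) j by apply: cmean_ge0 => j'; rewrite exprn_ge0.
apply: (@le_trans _ _ (mean (fun j => \prod_(k in A) F' k j))); last first.
  apply: (IH _ F').
  - by move=> k kr; apply: rA; rewrite inE kr orbT.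
  - by move=> k j; rewrite /F'; case: eqP => // _; exact: powR_ge0.
  - move=> k kA; rewrite /F'; case: eqP => _; first exact: Fk.
    move=> j i; congr (root _ _); apply: indep_cmean_other => {}j {}i.
    by rewrite (Fk k kA).
  - move=> k l lr j i; rewrite /F'.
    have [lt|lt] := eqVneq l t.
      case: eqP => [->|_]; first by rewrite lt (Fk t tA).
      by rewrite lt; congr (root _ _); exact: indep_cmean.
    have ln : l \notin t :: r by rewrite inE negb_or lt.
    case: eqP => _; first exact: Fl.
    by congr (root _ _); apply: indep_cmean_other => {}j {}i; rewrite (Fl k l ln).
  - move=> k kA; rewrite /F'; case: eqP => _; first exact: F1.
    rewrite (_ : (fun _ => _) = cmean t (fun j => F k j ^+ p)); first by rewrite mean_cmean; exact: F1.
    by apply/funext => j; rewrite rootX.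
rewrite -(mean_cmean t (fun j => \prod_(k in A) F k j)); apply: le_mean => j.
have prodt (H : 'I_m -> J -> R) j' : \prod_(k in A) H k j' = H t j' * \prod_(k <- enum (A :\ t)) H k j'.
  rewrite (bigD1 t)//= big_enum/=; congr (_ * _); apply: eq_bigl => k.
  by rewrite !inE andbC.
rewrite (_ : (fun _ => _) = (fun j => F t j * \prod_(k <- enum (A :\ t)) F k j)); last first.
  by apply/funext => j'; exact: prodt.
rewrite cmeanM; last exact: Fk.
rewrite prodt {1}/F' eqxx ler_wpM2l//.
have sz : size (enum (A :\ t)) = p.
  by rewrite -cardE; have := cardsD1 t A; rewrite tA cA add1n => -[].
apply: le_trans (@cmean_prod _ (enum (A :\ t)) t F j _ F0) _; first by rewrite sz.
rewrite sz le_eqVlt; apply/orP; left; apply/eqP.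
apply: eq_big_seq => k; rewrite mem_enum !inE => /andP[kt _].
by rewrite /F' (negPf kt).
Qed.

End Cube.

(** * The inequality of Blei *)

Section Blei.
Context {R : realType} {m n : nat}.
Local Notation J := {ffun 'I_m -> 'I_n}.
Implicit Types (j : J) (k l : 'I_m) (i : 'I_n) (A : {set 'I_m}).
Hypothesis n0 : (0 < n)%N.

(** The inner quadratic norm of the mixed norms that occur below. *)
Definition slice2 (a : J -> R) k j : R := Num.sqrt (cmean k (fun j => a j ^+ 2) j).

(** Blei's mixed norm inequality. Pointwise, the arithmetic-geometric mean of
    the numbers a^2 slice_k^(-b), k in A, and of the product of the slice_k^b is
    the left-hand power of a, as the slices cancel. The average of the first
    terms is given by the hypothesis, since slice_k^2 is the average of a^2 over
    slot k; that of the product is the Loomis-Whitney inequality. *)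
Lemma blei A d (a : J -> R) : #|A| = d.+1 -> (0 < d)%N -> (forall j, 0 <= a j) ->
  (forall l, l \notin A -> indep l a) ->
  (forall k, k \in A -> mean (fun j => slice2 a k j `^ (2 * d%:R / d.+1%:R)) <= 1) ->
  mean (fun j => a j `^ (2 * d.+1%:R / d.+2%:R)) <= 1.
Proof.
move=> cA d0 a0 al sl.
have sq k j : slice2 a k j ^+ 2 = cmean k (fun j => a j ^+ 2) j.
  by rewrite sqr_sqrtr// cmean_ge0// => j'; rewrite sqr_ge0.
have s0 k j : 0 <= slice2 a k j by exact: sqrtr_ge0.
have sk k : indep k (slice2 a k).
  by move=> j i; congr (Num.sqrt _); exact: indep_cmean.
have Dn : (d.+1%:R : R) != 0 by rewrite pnatr_eq0.
have Nn : (d.+2%:R : R) != 0 by rewrite pnatr_eq0.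
have DE : d.+1%:R = d%:R + 1 :> R by rewrite natr1.
have d0' : (0 : R) < d%:R by rewrite ltr0n.
pose b : R := 2 / d.+1%:R.
have pt j : d.+2%:R * a j `^ (2 * d.+1%:R / d.+2%:R) <=
   \sum_(k in A) a j ^+ 2 * slice2 a k j `^ (- b) + \prod_(k in A) slice2 a k j `^ b.
  have [aj0|aj0] := eqVneq (a j) 0.
    rewrite aj0 powR0; last by rewrite !mulf_neq0 ?invr_eq0.
    rewrite mulr0 addr_ge0//; last by apply: prodr_ge0 => k _; exact: powR_ge0.
    by apply: sumr_ge0 => k _; rewrite mulr_ge0 ?sqr_ge0 ?powR_ge0.
  have ap : 0 < a j by rewrite lt_neqAle eq_sym aj0 a0.
  have sp k : 0 < slice2 a k j.
    rewrite lt_neqAle eq_sym s0 andbT; apply/eqP => sk0.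
    have : cmean k (fun j => a j ^+ 2) j = 0 by rewrite -sq sk0 expr0n.
    move/(cmean_eq0 n0 (fun j => sqr_ge0 (a j)))/eqP.
    by rewrite sqrf_eq0 (negPf aj0).
  pose r := None :: [seq Some k | k <- enum A].
  have sr : size r = d.+2 by rewrite /= size_map -cardE cA.
  pose y : R := b / d.+2%:R.
  pose c (o : option 'I_m) : R := if o is Some k then a j `^ (2 / d.+2%:R) * slice2 a k j `^ (- y)
     else \prod_(k in A) slice2 a k j `^ y.
  have c0 o : 0 <= c o.
    case: o => [k|] /=; first by rewrite mulr_ge0 ?powR_ge0.
    by apply: prodr_ge0 => k _; exact: powR_ge0.
  have H := @amgm_seq R _ r c c0 (ltn0Sn _).
  rewrite sr in H; rewrite mulrC -ler_pdivlMr; last by rewrite ltr0n.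
  have Nmul (x : R) : x / d.+2%:R * d.+2%:R = x by rewrite divfK.
  suff [E1 E2] : \prod_(o <- r) c o = a j `^ (2 * d.+1%:R / d.+2%:R) /\
     \sum_(o <- r) c o ^+ d.+2 = \sum_(k in A) a j ^+ 2 * slice2 a k j `^ (- b) + \prod_(k in A) slice2 a k j `^ b.
    by rewrite -E1 -E2.
  split.
    rewrite big_cons big_map big_enum/= -big_split/=.
    rewrite (eq_bigr (fun=> a j `^ (2 / d.+2%:R))); last first.
      by move=> k _; rewrite mulrCA -powRD ?subrr ?powRr0 ?mulr1// (gt_eqF (sp k)) implybT.
    by rewrite prodr_const cA -powR_mulrn ?powR_ge0// -powRrM mulrAC.
  rewrite big_cons big_map big_enum/= addrC -prodrXl; congr (_ + _).
    apply: eq_bigr => k _; rewrite exprMn -!powR_mulrn ?powR_ge0//; try exact: ltW.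
    by rewrite -!powRrM Nmul mulNr Nmul.
  by apply: eq_bigr => k _; rewrite -powR_mulrn ?powR_ge0// -powRrM Nmul.
have N0 : (0 : R) < d.+2%:R by rewrite ltr0n.
have Hm : d.+2%:R * mean (fun j => a j `^ (2 * d.+1%:R / d.+2%:R)) <=
   \sum_(k in A) mean (fun j => slice2 a k j `^ (2 * d%:R / d.+1%:R)) + mean (fun j => \prod_(k in A) slice2 a k j `^ b).
  rewrite -meanZ; apply: le_trans (le_mean pt) _.
  rewrite meanD mean_sum lerD2r; apply: ler_sum => k kA.
  rewrite -(mean_cmean n0 k (fun j => a j ^+ 2 * _)).
  rewrite le_eqVlt; apply/orP; left; apply/eqP; congr mean; apply/funext => j.
  under [X in cmean k X]eq_fun do rewrite mulrC.
  rewrite cmeanM; last by move=> j' i; rewrite sk.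
  rewrite -sq.
  have [s0'|sn] := eqVneq (slice2 a k j) 0.
    rewrite s0' expr0n/= mulr0 powR0// !mulf_neq0 ?invr_eq0 ?pnatr_eq0//.
    by rewrite -lt0n.
  rewrite -powR_mulrn// -powRD ?(negPf sn) ?implybT//; congr (_ `^ _).
  by rewrite /b DE; field; rewrite -DE.
have LW : mean (fun j => \prod_(k in A) slice2 a k j `^ b) <= 1.
  apply: (@loomis_whitney R m n n0 A (fun k j => slice2 a k j `^ b) d) => //.
  - by move=> k j; exact: powR_ge0.
  - by move=> k _ j i; rewrite sk.
  - move=> k l lA j i; rewrite (_ : slice2 a k (upd j l i) = slice2 a k j)//.
    congr (Num.sqrt _); apply: indep_cmean_other => {}j {}i.
    by rewrite (al l lA).
  - move=> k kA; apply: le_trans (sl k kA).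
    rewrite le_eqVlt; apply/orP; left; apply/eqP; congr mean; apply/funext => j.
    rewrite -powR_mulrn ?powR_ge0// -powRrM; congr (_ `^ _).
    by rewrite /b; ring.
rewrite -(ler_pM2l N0) mulr1; apply: (le_trans Hm).
rewrite (_ : d.+2%:R = \sum_(k in A) 1 + 1); last by rewrite sumr_const cA natr1.
by rewrite lerD//; apply: ler_sum.
Qed.

End Blei.

(** * The Bohnenblust-Hille inequality *)

Section BohnenblustHille.
Context {R : realType} {m n : nat}.
Variable s : scalars.
Local Notation K := (base_field R s).
Local Notation J := {ffun 'I_m -> 'I_n}.
Implicit Types (j : J) (k l : 'I_m) (i : 'I_n) (A : {set 'I_m}).
Hypothesis n0 : (0 < n)%N.

Let c : R := Num.sqrt n%:R.
Let c0 : 0 < c. Proof. by rewrite sqrtr_gt0 ltr0n. Qed.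
Let c2 : c ^+ 2 = n%:R. Proof. by rewrite sqr_sqrtr. Qed.

(** The product of the Khinchine constants exp (0.365 / k) for k = 1, ..., d. *)
Definition bh_const d : R := expR (365 / 1000 * harm d).

(** Only vectors with unimodular entries are tested. The sum runs over all m
    indices, also over those outside A, which the division by the number of
    indices compensates when a does not depend on them. *)
Definition torus_bound A (a : J -> K) (M : R) :=
  forall x : 'I_m -> 'I_n -> K, (forall k i, modulus (x k i) = 1) ->
  modulus (\sum_j a j * \prod_(k in A) x k (j k)) <= #|{: J}|%:R * M.

(** In one slot, unimodular entries can turn every coefficient positive. *)
Let bh_base A (a : J -> K) M : #|A| = 1%N -> (forall l, l \notin A -> indep l a) ->
  torus_bound A a M -> mean (fun j => modulus (a j)) <= M.
Proof.
move=> /eqP/cards1P[k ->] al aM.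
have /choice[u uP] : forall i, exists u : K, modulus u = 1 /\
    u * a [ffun=> i] = emb s (modulus (a [ffun=> i])).
  by move=> i; have [u u1 u2] := modulus_phase (a [ffun=> i]); exists u.
have ak j : a j = a [ffun=> j k].
  have H (r : seq 'I_m) : a j = a [ffun x => if x \in r then j k else j x].
    elim: r => [|x r IH]; first by congr a; apply/ffunP => y; rewrite ffunE.
    rewrite IH; have [->|xk] := eqVneq x k.
      congr a; apply/ffunP => y; rewrite !ffunE inE.
      by case: eqP => [->|//] /=; rewrite if_same.
    rewrite -(al x _ _ (j k)); last by rewrite inE.
    congr a; apply/ffunP => y; rewrite updE !ffunE inE.
    by case: eqP.
  rewrite (H (enum 'I_m)); congr a; apply/ffunP => y.
  by rewrite !ffunE mem_enum.
have := aM (fun _ i => u i) (fun _ i => (uP i).1).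
rewrite (eq_bigr (fun j => emb s (modulus (a j)))); last first.
  by move=> j _; rewrite big_set1 mulrC ak (uP (j k)).2.
rewrite -emb_sum modulus_emb ger0_norm; last by apply: sumr_ge0 => j _; exact: modulus_ge0.
by rewrite /mean ler_pdivrMr ?ltr0n ?card_cube_gt0// mulrC.
Qed.

(** The Khinchine inequality replaces the square mean in slot k by evaluation at
    a vector of phases, which leaves a form in one slot less with a bound of
    the same kind. *)
Let bh_slice d A k (a : J -> K) (M : R) : #|A| = d.+2 -> k \in A ->
  (forall (B : {set 'I_m}) (b : J -> K) (M' : R), #|B| = d.+1 -> (forall l, l \notin B -> indep l b) -> 0 < M' ->
    torus_bound B b M' ->
    mean (fun j => modulus (b j) `^ (2 * d.+1%:R / d.+2%:R)) <=
      (bh_const d * c ^+ d * M') `^ (2 * d.+1%:R / d.+2%:R)) ->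
  (forall l, l \notin A -> indep l a) -> 0 < M -> torus_bound A a M ->
  mean (fun j => slice2 (fun j => modulus (a j)) k j `^ (2 * d.+1%:R / d.+2%:R)) <=
    (bh_const d.+1 * c ^+ d.+1 * M) `^ (2 * d.+1%:R / d.+2%:R).
Proof.
move=> cA kA IH al M0 aM.
pose q : R := 2 * d.+1%:R / d.+2%:R; rewrite -/q in IH *.
have d1 : (0 : R) < d.+1%:R by rewrite ltr0n.
have d2 : (0 : R) < d.+2%:R by rewrite ltr0n.
have d12 : d.+2%:R = d.+1%:R + 1 :> R by rewrite natr1.
have q0 : 0 < q by rewrite divr_gt0// mulr_gt0.
have q2 : q <= 2 by rewrite ler_pdivrMr// d12; lra.
have [xi xi1 Hxi] := @khinchine_family R s {: J} n (fun j i => a (upd j k i)) q (introT andP (conj q0 q2)).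
pose b j := \sum_i xi i * a (upd j k i).
have cB : #|A :\ k| = d.+1 by have := cardsD1 k A; rewrite kA cA add1n => -[].
have bl l : l \notin A :\ k -> indep l b.
  rewrite !inE negb_and negbK => /orP[/eqP ->|lA] j i.
    by rewrite /b; apply: eq_bigr => i' _; rewrite upd_upd.
  have lk : k != l by apply: contraNneq lA => <-.
  by rewrite /b; apply: eq_bigr => i' _; rewrite updC 1?eq_sym// (al l lA).
have bM : torus_bound (A :\ k) b (n%:R * M).
  move=> x x1.
  pose y l i := if l == k then xi i else x l i.
  have y1 l i : modulus (y l i) = 1 by rewrite /y; case: eqP.
  have -> : \sum_j b j * \prod_(l in A :\ k) x l (j l) = \sum_j \sum_(i < n) a j * \prod_(l in A) y l (j l).
    rewrite -(@sum_upd m n _ k (fun j _ => a j * \prod_(l in A) y l (j l))).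
    apply: eq_bigr => j _; rewrite /b mulr_suml; apply: eq_bigr => i _.
    rewrite [in RHS](bigD1 k kA)/= {1}/y eqxx updE eqxx mulrCA mulrA; congr (_ * _).
    apply: eq_big => [l|l]; first by rewrite !inE andbC.
    rewrite !inE => /andP[lk lA].
    by rewrite /y updE (negPf lk).
  under eq_bigr do rewrite sumr_const card_ord.
  rewrite sumrMnl -[X in modulus X]mulr_natr modulusM.
  have -> : n%:R = emb s n%:R :> K.
    by elim: (n) => [|t IHt]; rewrite ?emb0// -!natr1 embD emb1 IHt.
  rewrite modulus_emb normr_nat mulrA mulrC [leRHS]mulrAC mulrC ler_wpM2r//.
  exact: aM.
have nM : 0 < n%:R * M by rewrite mulr_gt0// ltr0n.
have := IH _ b _ cB bl nM bM.
have Jp : (0 : R) < #|{: J}|%:R by rewrite ltr0n card_cube_gt0.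
have sl0 j : 0 <= slice2 (fun j => modulus (a j)) k j by exact: sqrtr_ge0.
have inner j : (\sum_i modulus (a (upd j k i)) ^+ 2) `^ (q / 2) =
    c `^ q * slice2 (fun j => modulus (a j)) k j `^ q.
  rewrite -powRM ?(ltW c0)//.
  have -> : \sum_i modulus (a (upd j k i)) ^+ 2 = (c * slice2 (fun j => modulus (a j)) k j) ^+ 2.
    rewrite exprMn c2 sqr_sqrtr; last by apply: cmean_ge0 => j'; exact: sqr_ge0.
    by rewrite /cmean mulrC divfK// pnatr_eq0 -lt0n.
  rewrite -powR_mulrn ?mulr_ge0 ?(ltW c0)// -powRrM; congr (_ `^ _).
  by rewrite mulrCA divff ?mulr1.
have := Hxi; rewrite (eq_bigr (fun j => c `^ q * slice2 (fun j => modulus (a j)) k j `^ q)); last by move=> j _; exact: inner.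
rewrite -mulr_sumr -/b => H1 H2.
pose S := mean (fun j => slice2 (fun j => modulus (a j)) k j `^ q); rewrite -/S.
have H3 : expR (- (2 - q) * (365 / 1000)) * (c `^ q * S) <= (bh_const d * c ^+ d * (n%:R * M)) `^ q.
  apply: le_trans H2; move: H1; set e := expR _ => H1.
  by rewrite /S /mean !mulrA ler_wpM2r ?invr_ge0 ?(ltW Jp)// -mulrA.
have cq : 0 < c `^ q by rewrite powR_gt0.
have e0 := expR_gt0 (- (2 - q) * (365 / 1000) : R).
rewrite mulrA in H3.
rewrite -(ler_pM2l (mulr_gt0 e0 cq)); apply: (le_trans H3).
have Bp : 0 <= bh_const d.+1 * c ^+ d.+1 * M.
  by rewrite !mulr_ge0 ?expR_ge0 ?exprn_ge0 ?(ltW c0) ?(ltW M0).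
have -> : expR (- (2 - q) * (365 / 1000)) = (expR (- (365 / 1000) / d.+1%:R)) `^ q.
  rewrite -expRM; congr expR; rewrite /q d12.
  have := d1; move: (d.+1%:R) => y y0; field; rewrite !gt_eqF//; lra.
rewrite -!powRM ?mulr_ge0 ?expR_ge0 ?exprn_ge0 ?(ltW c0) ?(ltW M0) ?(ltW nM)//.
rewrite le_eqVlt; apply/orP; left; apply/eqP; congr (_ `^ _).
have -> : expR (- (365 / 1000) / d.+1%:R) * c * (bh_const d.+1 * c ^+ d.+1 * M) =
   (expR (- (365 / 1000) / d.+1%:R) * bh_const d.+1) * (c ^+ d * c ^+ 2 * M).
  by rewrite !exprS; ring.
rewrite c2 /bh_const -expRD harmS.
have -> : - (365 / 1000) / d.+1%:R + 365 / 1000 * (harm d + d.+1%:R^-1) = 365 / 1000 * harm d :> R by ring.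
by ring.
Qed.

(** The Bohnenblust-Hille inequality, by induction on the number of slots: the
    inequality of Blei bounds the norm by the mixed norms, and these are
    estimated with the Khinchine inequality and the case of one slot less.
    Keeping all m indices and recording in A those that matter avoids changing
    the index type along the induction; means instead of sums make the idle
    indices disappear, at the cost of the powers of c. *)
Theorem bohnenblust_hille d A (a : J -> K) M : #|A| = d.+1 ->
  (forall l, l \notin A -> indep l a) -> 0 < M -> torus_bound A a M ->
  mean (fun j => modulus (a j) `^ (2 * d.+1%:R / d.+2%:R)) <=
    (bh_const d * c ^+ d * M) `^ (2 * d.+1%:R / d.+2%:R).
Proof.
elim: d A a M => [|d IH] A a M cA al M0 aM.
  rewrite mulr1 divff// /bh_const harm0 mulr0 expR0 !mul1r powRr1 ?(ltW M0)//.
  rewrite (_ : (fun j => _) = (fun j => modulus (a j))); first exact: (bh_base cA).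
  by apply/funext => j; rewrite powRr1// modulus_ge0.
pose D := bh_const d.+1 * c ^+ d.+1 * M; rewrite -/D.
have D0 : 0 < D by rewrite !mulr_gt0 ?expR_gt0 ?exprn_gt0.
have iD0 : 0 <= D^-1 by rewrite invr_ge0 ltW.
pose f j := modulus (a j) / D.
have f0 j : 0 <= f j by rewrite divr_ge0 ?modulus_ge0// ltW.
have sf k j : slice2 f k j = slice2 (fun j => modulus (a j)) k j / D.
  rewrite /slice2 -[X in _ / X](gtr0_norm D0) -normfV -sqrtr_sqr -sqrtrM; last first.
    by apply: cmean_ge0 => j'; exact: sqr_ge0.
  congr Num.sqrt; rewrite /cmean /f mulrAC; congr (_ / _); rewrite mulr_suml.
  by apply: eq_bigr => i _; rewrite exprMn.
have fl l : l \notin A -> indep l f by move=> lA j i; rewrite /f (al l lA).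
have H := @blei R m n n0 A d.+1 f cA (ltn0Sn d) f0 fl.
have {H} : mean (fun j => f j `^ (2 * d.+2%:R / d.+3%:R)) <= 1.
  apply: H => k kA; have := bh_slice cA kA IH al M0 aM; rewrite -/D.
  set q := 2 * _ / _ => H.
  have -> : (fun j => slice2 f k j `^ q) = (fun j => (D `^ q)^-1 * slice2 (fun j => modulus (a j)) k j `^ q).
    apply/funext => j; rewrite sf powRM ?sqrtr_ge0// mulrC; congr (_ * _).
    by rewrite -powRN -powR_inv1 ?(ltW D0)// -powRrM mulN1r.
  rewrite meanZ mulrC ler_pdivrMr ?powR_gt0// mul1r; exact: H.
set r := 2 * _ / _.
have -> : (fun j => f j `^ r) = (fun j => (D `^ r)^-1 * modulus (a j) `^ r).
  apply/funext => j; rewrite /f powRM ?modulus_ge0// mulrC; congr (_ * _).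
  by rewrite -powRN -powR_inv1 ?(ltW D0)// -powRrM mulN1r.
by rewrite meanZ mulrC ler_pdivrMr ?powR_gt0// mul1r.
Qed.

End BohnenblustHille.

(** * Multilinear forms *)

Section Forms.
Context {R : realType} {m n : nat}.
Variable s : scalars.
Local Notation K := (base_field R s).
Local Notation J := {ffun 'I_m -> 'I_n}.
Implicit Types (T : ('I_m -> 'rV[K]_n) -> K) (j : J) (k l : 'I_m) (i : 'I_n).
Implicit Types (x : 'I_m -> 'rV[K]_n).

Let repl x k (u : 'rV[K]_n) : 'I_m -> 'rV[K]_n := @dfwith _ (fun=> 'rV[K]_n) x k u.

Let scalar_sum (f : 'rV[K]_n -> K) : scalar f ->
  forall (I : Type) (r : seq I) (c : I -> K) (u : I -> 'rV[K]_n),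
  f (\sum_(i <- r) c i *: u i) = \sum_(i <- r) c i * f (u i).
Proof.
move=> lf I r c u; have f0 : f 0 = 0.
  have := lf (-1) 0 0; rewrite scaleN1r oppr0 addr0 => {1}->.
  by rewrite mulN1r addNr.
by elim: r => [|i r IH]; rewrite ?big_nil// !big_cons lf IH.
Qed.

(** The slots are expanded one after the other in the standard basis. All
    sums run over full indices j, also when only the slots in r have been
    expanded, which accounts for the powers of n. *)
Lemma multilinear_expand T x : (0 < n)%N -> multilinear_form T ->
  T x = \sum_j coef T j * \prod_k x k 0 (j k).
Proof.
move=> n0 mT.
pose Y (r : seq 'I_m) j k := if k \in r then delta_mx 0 (j k) else x k.
pose G (r : seq 'I_m) j := T (Y r j) * \prod_(k <- r) x k 0 (j k).
have nK : (n%:R : K) != 0 by rewrite pnatr_eq0 -lt0n.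
have main (r : seq 'I_m) : uniq r -> \sum_(j : J) T x = n%:R ^+ size r * \sum_j G r j.
  elim: r => [_|k r IH /= /andP[kr ur]].
    rewrite expr0 mul1r; apply: eq_bigr => j _; rewrite /G big_nil mulr1.
    by congr T.
  rewrite IH// exprSr -mulrA; congr (_ * _).
  have -> : \sum_j G r j = \sum_j \sum_i G (k :: r) (upd j k i).
    apply: eq_bigr => j _.
    have TY : T (Y r j) = \sum_i x k 0 i * T (Y (k :: r) (upd j k i)).
      have -> : Y r j = repl (Y r j) k (\sum_i x k 0 i *: delta_mx 0 i).
        apply/funext => l; rewrite /repl -row_sum_delta.
        have [<-|kl] := eqVneq k l; last by rewrite dfwithout.
        by rewrite dfwithin /Y (negPf kr).
      rewrite (scalar_sum (mT k (Y r j))); apply: eq_bigr => i _.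
      congr (_ * T _); apply/funext => l; rewrite /Y inE.
      have [->|lk] := eqVneq l k; first by rewrite dfwithin updE eqxx.
      by rewrite dfwithout 1?eq_sym// updE (negPf lk).
    rewrite /G TY mulr_suml; apply: eq_bigr => i _.
    rewrite big_cons updE eqxx -mulrA mulrCA; congr (_ * (_ * _)).
    apply: eq_big_seq => l lr; rewrite updE; case: eqP => // lk.
    by rewrite lk (negPf kr) in lr.
  rewrite (@sum_upd m n _ k (fun j _ => G (k :: r) j)) mulr_sumr.
  by apply: eq_bigr => j _; rewrite sumr_const card_ord mulr_natl.
have := main (enum 'I_m) (enum_uniq _).
rewrite size_enum_ord (_ : \sum_(j : J) T x = n%:R ^+ m * T x); last first.
  by rewrite sumr_const card_ffun !card_ord -natrX mulr_natl.
move/(mulfI (expf_neq0 m nK)) => ->.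
apply: eq_bigr => j _; rewrite /G /coef big_enum/=; congr (T _ * _).
by apply/funext => k; rewrite /Y mem_enum.
Qed.

Lemma lp_coord (p : \bar R) (u : 'rV[K]_n) i : (0 < p)%E -> lp_norm p u <= 1 -> modulus (u 0 i) <= 1.
Proof.
case: p => [q| |//]; last first.
  move=> _ H; apply: le_trans H.
  exact: (le_bigmax 0 (fun i => modulus (u 0 i)) i).
rewrite lte_fin => q0 /= H.
have pw1 (t : R) : 1 `^ t = 1 by rewrite powR1.
set S := \sum_(_ < n) _ in H.
have S0 : 0 <= S by apply: sumr_ge0 => j _; exact: powR_ge0.
have S1 : S <= 1.
  rewrite leNgt; apply/negP => S1.
  have : 1 < S `^ q^-1.
    by rewrite -[ltLHS](pw1 q^-1) gt0_ltr_powR ?nnegrE ?invr_gt0// ltW.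
  by rewrite ltNge H.
have uS : modulus (u 0 i) `^ q <= 1.
  apply: le_trans S1; rewrite /S (bigD1 i)//= lerDl; apply: sumr_ge0 => j _; exact: powR_ge0.
rewrite leNgt; apply/negP => u1.
have : 1 < modulus (u 0 i) `^ q.
  by rewrite -[ltLHS](pw1 q) gt0_ltr_powR ?nnegrE ?modulus_ge0// ltW.
by rewrite ltNge uS.
Qed.

Lemma lp_norm0 (p : \bar R) : (0 < p)%E -> lp_norm p (0 : 'rV[K]_n) = 0.
Proof.
case: p => [q| |//]; rewrite ?lte_fin => q0 /=.
  rewrite big1 ?powR0// ?gt_eqF ?invr_gt0// => i _.
  by rewrite mxE modulus0 powR0// gt_eqF.
by apply: (big_ind (fun z => z = 0)) => [//|x y -> ->|i _]; rewrite ?maxxx// mxE modulus0.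
Qed.

Lemma form_norm_ge p T x : (0 < n)%N -> (0 < p)%E -> multilinear_form T ->
  (forall k, lp_norm p (x k) <= 1) -> modulus (T x) <= form_norm p T.
Proof.
move=> n0 p0 mT x1; apply: ub_le_sup; last by exists x.
exists (\sum_j modulus (coef T j)) => _ /= [y y1 <-].
rewrite multilinear_expand//; apply: le_trans (modulus_sum _ _ _) _.
apply: ler_sum => j _; rewrite modulusM ler_piMr ?modulus_ge0//.
rewrite modulus_prod; apply: prodr_ile1 => k _.
by rewrite modulus_ge0/= (lp_coord _ p0).
Qed.

Lemma form_norm_le p T (B : R) : (0 < p)%E ->
  (forall x, (forall k, lp_norm p (x k) <= 1) -> modulus (T x) <= B) -> form_norm p T <= B.
Proof.
move=> p0 H; apply: ge_sup; last by move=> _ /= [x x1 <-]; exact: H.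
by exists (modulus (T (fun=> 0))) => /=; exists (fun=> 0) => // k; rewrite lp_norm0.
Qed.

End Forms.

(** * Lower bounds for the norm of a unimodular form *)

Section UpperBound.
Context {R : realType} {m n : nat}.
Variable s : scalars.
Local Notation K := (base_field R s).
Local Notation J := {ffun 'I_m -> 'I_n}.
Implicit Types (T : ('I_m -> 'rV[K]_n) -> K) (p : \bar R).

Definition inv_exponent p : R := if p is q%:E then q^-1 else 0.

(** For unimodular forms the coefficient norm is a power of n, so that the
    whole question is about the smallest possible norm of such a form. *)
Lemma coef_sum_normE (r : R) T : unimodular T ->
  coef_sum_norm r T = n%:R `^ (m%:R * r^-1).
Proof.
move=> uT; rewrite /coef_sum_norm.
rewrite (eq_bigr (fun=> 1)); last by move=> j _; rewrite uT powR1.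
rewrite sumr_const card_ffun !card_ord natrX -powR_mulrn//.
by rewrite -powRrM.
Qed.

Hypotheses (n0 : (0 < n)%N) (m0 : (0 < m)%N).
Let nR : (0 : R) < n%:R. Proof. by rewrite ltr0n. Qed.

Lemma lp_norm_flat p (c : R) (u : 'rV[K]_n) : (0 < p)%E -> 0 <= c ->
  (forall i, modulus (u 0 i) <= c) -> c * n%:R `^ inv_exponent p <= 1 -> lp_norm p u <= 1.
Proof.
case: p => [q| |//]; rewrite ?lte_fin => p0 c0 uc /= cn.
  apply: le_trans cn.
  have qi : 0 <= q^-1 by rewrite invr_ge0 ltW.
  have -> : c * n%:R `^ q^-1 = (c `^ q * n%:R) `^ q^-1.
    by rewrite powRM ?powR_ge0// -powRrM divff ?powRr1// gt_eqF.
  apply: ge0_ler_powR; rewrite ?nnegrE//.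
  - by apply: sumr_ge0 => i _; exact: powR_ge0.
  - by rewrite mulr_ge0 ?powR_ge0.
  rewrite mulr_natr -[n in _ *+ n]card_ord -sumr_const; apply: ler_sum => i _.
  by apply: ge0_ler_powR; rewrite ?nnegrE ?modulus_ge0 ?(ltW p0).
rewrite powRr0 mulr1 in cn.
by apply: bigmax_le => // i _; exact: le_trans (uc i) cn.
Qed.

(** The unit ball contains the vectors whose entries have modulus n^(-1/p), so
    on vectors with unimodular entries the form is at most n^(m/p) times its
    norm. The Bohnenblust-Hille inequality applies there, and the powers of the
    coefficients that it involves are all 1. *)
Lemma unimodular_norm_ge p T : (0 < p)%E -> multilinear_form T -> unimodular T ->
  n%:R `^ ((m%:R + 1) / 2 - m%:R * inv_exponent p) <= bh_const m.-1 * form_norm p T.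
Proof.
move=> p0 mT uT.
set th := inv_exponent p; set N := form_norm p T.
have card_n : (#|{: J}|%:R : R) = n%:R ^+ m by rewrite card_ffun !card_ord natrX.
pose c : R := n%:R `^ (- th).
have c0 : 0 < c by exact: powR_gt0.
have cth : c * n%:R `^ th = 1 by rewrite -powRD ?addNr ?powRr0// (gt_eqF nR) implybT.
have bound : torus_bound (finset.setTfor 'I_m) (coef T) (N / (c * n%:R) ^+ m).
  move=> x x1.
  pose y k : 'rV[K]_n := \row_i (emb s c * x k i).
  have y1 k : lp_norm p (y k) <= 1.
    apply: (lp_norm_flat p0 (ltW c0)); last by rewrite cth.
    by move=> i; rewrite mxE modulusM x1 mulr1 modulus_emb gtr0_norm.
  have := form_norm_ge n0 p0 mT y1; rewrite -/N multilinear_expand//.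
  have -> : \sum_j coef T j * \prod_k y k 0 (j k) =
      emb s (c ^+ m) * \sum_j coef T j * \prod_(k in (finset.setTfor 'I_m)) x k (j k).
    rewrite mulr_sumr; apply: eq_bigr => j _; rewrite mulrCA; congr (_ * _).
    under eq_bigr do rewrite mxE.
    rewrite big_split/= -emb_prod prodr_const card_ord; congr (_ * _).
    by apply: eq_bigl => k; rewrite finset.in_setT.
  rewrite modulusM modulus_emb ger0_norm ?exprn_ge0 ?(ltW c0)// mulrC => H.
  rewrite card_n exprMn (_ : n%:R ^+ m * (N / (c ^+ m * n%:R ^+ m)) = N / c ^+ m).
    by rewrite ler_pdivlMr ?exprn_gt0.
  by field; rewrite !expf_neq0 ?gt_eqF.
have BH M : 0 < M -> torus_bound (finset.setTfor 'I_m) (coef T) M ->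
    1 <= bh_const m.-1 * Num.sqrt n%:R ^+ m.-1 * M.
  move=> M0 /(@bohnenblust_hille R m n s n0 m.-1 (finset.setTfor 'I_m) (coef T) M) H.
  have := H (etrans (finset.cardsT _) (etrans (card_ord m) (esym (prednK m0)))).
  have -> : (fun j => modulus (coef T j) `^ (2 * m.-1.+1%:R / m.-1.+2%:R)) = (fun=> 1).
    by apply/funext => j; rewrite uT powR1.
  rewrite mean_cst// => {}H.
  have {}H : 1 <= (bh_const m.-1 * Num.sqrt n%:R ^+ m.-1 * M) `^ (2 * m.-1.+1%:R / m.-1.+2%:R).
    by apply: H => // l; rewrite finset.in_setT.
  rewrite leNgt; apply/negP => lt1; move: H; rewrite leNgt => /negP; apply.
  have pw1 (t : R) : 1 `^ t = 1 by rewrite powR1.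
  have e0 : 0 < 2 * m.-1.+1%:R / m.-1.+2%:R :> R by rewrite divr_gt0 ?mulr_gt0 ?ltr0n.
  have b0 : 0 <= bh_const m.-1 * Num.sqrt n%:R ^+ m.-1 * M.
    by rewrite !mulr_ge0 ?expR_ge0 ?exprn_ge0 ?sqrtr_ge0// ltW.
  by rewrite -[ltRHS](pw1 (2 * m.-1.+1%:R / m.-1.+2%:R)) gt0_ltr_powR// nnegrE.
pose B : R := bh_const m.-1 * Num.sqrt n%:R ^+ m.-1.
have B0 : 0 < B by rewrite mulr_gt0 ?expR_gt0 ?exprn_gt0 ?sqrtr_gt0.
have {BH bound} main : 1 <= B * (N / (c * n%:R) ^+ m).
  rewrite leNgt; apply/negP => lt1.
  (* the norm is not known to be positive beforehand, whence the maximum *)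
  pose M := Num.max (N / (c * n%:R) ^+ m) (2 * B)^-1.
  have M0 : 0 < M.
    by rewrite lt_max; apply/orP; right; rewrite invr_gt0; apply: mulr_gt0.
  have Mb : torus_bound (finset.setTfor 'I_m) (coef T) M.
    move=> x x1; apply: le_trans (bound x x1) _.
    by rewrite ler_wpM2l// le_max lexx.
  have := BH M M0 Mb; rewrite leNgt => /negP; apply.
  rewrite -/B /M maxr_pMr ?(ltW B0)// gt_max lt1/= invfM mulrCA divff ?gt_eqF// mulr1.
  by rewrite invf_lt1// ltr1n.
have cn0 : 0 < (c * n%:R) ^+ m by rewrite exprn_gt0// mulr_gt0.
move: main; rewrite mulrA ler_pdivlMr// mul1r => main.
have sq0 : 0 < Num.sqrt n%:R ^+ m.-1 :> R by rewrite exprn_gt0// sqrtr_gt0.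
rewrite -(ler_pM2r sq0); apply: (le_trans _ (_ : bh_const m.-1 * Num.sqrt n%:R ^+ m.-1 * N <= _)); last first.
  by rewrite mulrAC.
apply: le_trans main.
rewrite le_eqVlt; apply/orP; left; apply/eqP.
have nn0 : (n%:R : R) != 0 by rewrite gt_eqF.
rewrite -powR12_sqrt ?(ltW nR)// -!powR_mulrn ?mulr_ge0 ?powR_ge0 ?(ltW c0)//.
rewrite -[in RHS](powRr1 (ltW nR)) /c -!powRD ?nn0 ?implybT// -!powRrM -powRD ?nn0 ?implybT//.
congr (_ `^ _); rewrite -[m in RHS](prednK m0) -[in LHS](prednK m0) -natr1.
by field.
Qed.

(** The number 213 / 1000 exceeds 365 / 1000 * 7 / 12, and its exponential is
    about 1.24. *)
Lemma bh_const_le : bh_const m.-1 <= 13 / 10 * m%:R `^ (365 / 1000) :> R.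
Proof.
have mR : (0 : R) < m%:R by rewrite ltr0n.
have H := @harm_le_ln R m m0.
rewrite /bh_const /powR gt_eqF//.
apply: (@le_trans _ _ (expR (213 / 1000 + 365 / 1000 * ln m%:R))).
  by rewrite ler_expR; lra.
rewrite expRD ler_wpM2r ?expR_ge0//.
have E : expR (- (213 / 1000)) * expR (213 / 1000) = 1 :> R by rewrite -expRD addNr expR0.
have := expR_ge1Dx (- (213 / 1000) : R).
have := expR_gt0 (213 / 1000 : R).
move: (expR _) (expR _) E => a b E b0 a0.
nra.
Qed.

Lemma HL_exponentE p : ((2 * m%:R / (m%:R + 1))%:E < p)%E ->
  0 < HL_exponent m p /\
  m%:R * (HL_exponent m p)^-1 = (m%:R + 1) / 2 - m%:R * inv_exponent p.
Proof.
have mR : (0 : R) < m%:R by rewrite ltr0n.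
case: p => [q| |//].
  rewrite lte_fin ltr_pdivrMr; last lra.
  move=> H; have q0 : 0 < q by nra.
  have D : 0 < m%:R * q + q - 2 * m%:R by lra.
  split; first by rewrite divr_gt0// !mulr_gt0.
  by rewrite /=; field; rewrite ?gt_eqF.
move=> _; split; first by rewrite divr_gt0 ?mulr_gt0//; lra.
by rewrite /= mulr0 subr0; field; rewrite ?gt_eqF//; lra.
Qed.

Lemma lt_exponent_gt0 p : ((2 * m%:R / (m%:R + 1))%:E < p)%E -> (0 < p)%E.
Proof.
have mR : (0 : R) < m%:R by rewrite ltr0n.
apply: le_lt_trans; rewrite lee_fin divr_ge0//; lra.
Qed.

Theorem unimodular_HL p T : ((2 * m%:R / (m%:R + 1))%:E < p)%E ->
  multilinear_form T -> unimodular T ->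
  coef_sum_norm (HL_exponent m p) T <= 13 / 10 * m%:R `^ (365 / 1000) * form_norm p T.
Proof.
move=> Hp mT uT; have p0 := lt_exponent_gt0 Hp.
rewrite coef_sum_normE//; have [_ ->] := HL_exponentE Hp.
apply: le_trans (unimodular_norm_ge p0 mT uT) _.
rewrite ler_wpM2r ?bh_const_le//.
have x0 (k : 'I_m) : lp_norm p (0 : 'rV[K]_n) <= 1 by rewrite lp_norm0.
exact: le_trans (modulus_ge0 _) (form_norm_ge n0 p0 mT x0).
Qed.

End UpperBound.

(** * Random signs *)

Section CoshBound.
Context {R : realType}.
Implicit Types (x y : R).

Lemma has_deriv_expR x : has_deriv (@expR R) x (expR x).
Proof. exact: is_derive_expR. Qed.

Let has_deriv_expRf (f : R -> R) x a : has_deriv f x a ->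
  has_deriv (fun u => expR (f u)) x (expR (f x) * a).
Proof. by move=> fa; exact: (has_deriv_comp fa (has_deriv_expR _)). Qed.

Let sinh_le y : 0 <= y -> expR y - expR (- y) <= y * (expR y + expR (- y)).
Proof.
move=> y0; rewrite -subr_ge0.
have <- : 0 * (expR 0 + expR (- 0)) - (expR 0 - expR (- 0)) = 0 :> R by rewrite oppr0 subrr subr0 mul0r.
apply: (@has_deriv_ndecr R (fun u => u * (expR u + expR (- u)) - (expR u - expR (- u)))
  (fun u => u * (expR u - expR (- u)))) => // u /andP[u0 _].
  apply: has_deriv_eq.
    apply: has_derivD.
      apply: has_derivM; first exact: has_deriv_id.
      apply: has_derivD; first exact: has_deriv_expR.
      by apply: has_deriv_expRf; has_deriv.
    apply: has_derivN; apply: has_derivD; first exact: has_deriv_expR.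
    by apply: has_derivN; apply: has_deriv_expRf; has_deriv.
  by rewrite /=; ring.
by rewrite mulr_ge0// subr_ge0 ler_expR; lra.
Qed.

(** Rademacher variables are subgaussian. *)
Lemma cosh_le y : expR y + expR (- y) <= 2 * expR (y ^+ 2 / 2).
Proof.
wlog y0 : y / 0 <= y => [H|].
  have [/H//|/ltW y0] := leP 0 y.
  by rewrite -[y in expR y]opprK addrC -(sqrrN y) H// oppr_ge0.
have : - 2 <= - ((expR y + expR (- y)) * expR (- (y ^+ 2 / 2))).
  have -> : - 2 = - ((expR 0 + expR (- 0)) * expR (- (0 ^+ 2 / 2))) :> R.
    by rewrite expr0n mul0r oppr0 expR0 mulr1.
  apply: (@has_deriv_ndecr R (fun u => - ((expR u + expR (- u)) * expR (- (u ^+ 2 / 2))))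
   (fun u => (u * (expR u + expR (- u)) - (expR u - expR (- u))) * expR (- (u ^+ 2 / 2)))) => // u /andP[u0 _].
    apply: has_deriv_eq.
      apply: has_derivN; apply: has_derivM.
        apply: has_derivD; first exact: has_deriv_expR.
        by apply: has_deriv_expRf; has_deriv.
      by apply: has_deriv_expRf; has_deriv.
    by rewrite /=; field.
  by rewrite mulr_ge0 ?expR_ge0// subr_ge0 sinh_le.
by rewrite lerN2 (expRN (y ^+ 2 / 2)) ler_pdivrMr ?expR_gt0.
Qed.

End CoshBound.

Section RandomSigns.
Context {R : realType} {m n : nat}.
Local Notation J := {ffun 'I_m -> 'I_n}.
Local Notation U := {ffun 'I_m -> {ffun 'I_n -> 'I_3}}.
Hypotheses (m0 : (0 < m)%N) (n0 : (0 < n)%N).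

Definition sgn (b : bool) : R := if b then 1 else -1.

Definition trit (z : 'I_3) : R := z%:R - 1.

Definition supp (w : {ffun 'I_n -> 'I_3}) : R := \sum_i trit (w i) ^+ 2.

Let cf (u : U) (j : J) : R := \prod_k trit (u k (j k)).
Let X (w : {ffun J -> bool}) (u : U) : R := \sum_j sgn (w j) * cf u j.
Let P (u : U) : R := \prod_k supp (u k).
Let L : R := ln (8 * n * m)%:R.
(** The exponent up to which the sum X _ u is controlled. It grows with the
    number of nonzero entries of u, so that the union bound over all u, weighted
    by exp (- Lam u), costs only a logarithm per nonzero entry. *)
Let Lam (u : U) : R := L * (\sum_k supp (u k)) + 2.
(** The optimal parameter for the exponential moment of X _ u. *)
Let t (u : U) : R := Num.sqrt (2 * Lam u / P u).

Let supp_ge0 w : 0 <= supp w. Proof. by apply: sumr_ge0 => i _; exact: sqr_ge0. Qed.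
Let supp_ge1 w : supp w != 0 -> 1 <= supp w.
Proof.
move=> w0; have [i wi] : exists i, trit (w i) != 0.
  apply: contrapT => H; move/eqP: w0; apply; apply: big1 => i _.
  by have [->|wi] := eqVneq (trit (w i)) 0; [rewrite expr0n | case: H; exists i].
rewrite /supp (bigD1 i)//=; apply: (@le_trans _ _ (trit (w i) ^+ 2)); last first.
  by rewrite lerDl; apply: sumr_ge0 => j _; exact: sqr_ge0.
move: wi; rewrite /trit; case: (w i) => [[|[|[|//]]] ?] /=; rewrite ?subrr ?eqxx//.
  by rewrite sub0r sqrrN expr1n.
by rewrite (_ : 2 - 1 = 1 :> R) ?expr1n//; ring.
Qed.

Let P_ge0 u : 0 <= P u. Proof. by apply: prodr_ge0 => k _; exact: supp_ge0. Qed.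
Let q0 : (0 : R) < (8 * n * m)%:R. Proof. by rewrite ltr0n !muln_gt0 n0. Qed.
Let L_ge0 : 0 <= L. Proof. by apply: ln_ge0; rewrite ler1n !muln_gt0 n0. Qed.
Let Lam_ge2 u : 2 <= Lam u.
Proof. by rewrite /Lam lerDr mulr_ge0// sumr_ge0. Qed.

Let cf_sqr u : \sum_j cf u j ^+ 2 = P u.
Proof.
rewrite /P /supp bigA_distr_bigA; apply: eq_bigr => j _.
by rewrite /cf prodrXl.
Qed.

Let mgf (u : U) (c : R) :
  \sum_(w : {ffun J -> bool}) expR (c * X w u) <= 2 ^+ #|{: J}| * expR (c ^+ 2 * P u / 2).
Proof.
have -> : \sum_(w : {ffun J -> bool}) expR (c * X w u) =
  \sum_(w : {ffun J -> bool}) \prod_j expR (c * (sgn (w j) * cf u j)).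
  apply: eq_bigr => w _; rewrite -expR_sum /X mulr_sumr.
  by [].
rewrite -(bigA_distr_bigA (fun j b => expR (c * (sgn b * cf u j)))).
have -> : 2 ^+ #|{: J}| * expR (c ^+ 2 * P u / 2) = \prod_(j : J) (2 * expR ((c * cf u j) ^+ 2 / 2)).
  rewrite big_split prodr_const/= -expR_sum; congr (_ * expR _).
  by rewrite -mulr_suml -cf_sqr mulr_sumr; congr (_ / _); apply: eq_bigr => j _; rewrite exprMn.
apply: ler_prod => j _; rewrite big_bool /sgn mul1r mulN1r mulrN.
by rewrite addr_ge0 ?expR_ge0//= cosh_le.
Qed.

Let weight_sum : \sum_u expR (- Lam u) < 1 / 2.
Proof.
have -> : \sum_u expR (- Lam u) = expR (- 2) * (1 + 2 * (8 * n * m)%:R^-1) ^+ (n * m).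
  have E : expR (- L) = (8 * n * m)%:R^-1 by rewrite expRN lnK.
  have -> : (1 + 2 * (8 * n * m)%:R^-1) ^+ (n * m) =
      \prod_(k < m) \prod_(i < n) \sum_z expR (- L * trit z ^+ 2).
    rewrite !big_ord_recr big_ord0/= /trit sub0r subrr sqrrN expr0n expr1n/= mulr0 expR0 !mulr1 E.
    rewrite (_ : 2 - 1 = 1); last by ring.
    rewrite expr1n mulr1 E !prodr_const !card_ord -exprM; congr (_ ^+ _); ring.
  under [X in _ = _ * X]eq_bigr do
    rewrite (bigA_distr_bigA (fun=> fun z => expR (- L * trit z ^+ 2))).
  rewrite (bigA_distr_bigA (fun=> fun w : {ffun 'I_n -> 'I_3} =>
    \prod_i expR (- L * trit (w i) ^+ 2))) mulr_sumr; apply: eq_bigr => u _.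
  rewrite /Lam opprD addrC expRD; congr (_ * _).
  rewrite -mulNr /supp mulr_sumr expR_sum; apply: eq_bigr => k _.
  by rewrite mulr_sumr expR_sum.
have H : (1 + 2 * (8 * n * m)%:R^-1) ^+ (n * m) <= expR (1 / 4) :> R.
  have E : 1 / 4 = (n * m)%:R * (2 * (8 * n * m)%:R^-1) :> R.
    rewrite -mulnA natrM; field.
    by rewrite !pnatr_eq0 -!lt0n n0 m0.
  rewrite E expRM_natl lerXn2r ?nnegrE ?expR_ge0 ?expR_ge1Dx//.
apply: (@le_lt_trans _ _ (expR (- (7 / 4)))).
  rewrite (_ : - (7 / 4) = - 2 + 1 / 4); last by field.
  by rewrite expRD ler_wpM2l ?expR_ge0.
have E : expR (- (7 / 4)) * expR (7 / 4) = 1 :> R by rewrite -expRD addNr expR0.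
have := expR_ge1Dx (7 / 4 : R); have := expR_gt0 (- (7 / 4) : R).
move: (expR _) (expR _) E => a b E a0 b0; nra.
Qed.

(** For independent random signs, the sum is subgaussian with variance
    \prod_k supp (u k), and the logarithm of the number of competing u with
    given supports is of the order of \sum_k supp (u k) times a logarithm. The
    average over the signs of the sum Z of all weighted exponential moments is
    below 1, so some choice of signs keeps every term below 1. *)
Lemma random_signs : exists w : {ffun J -> bool}, forall u : U,
  (\sum_j sgn (w j) * \prod_k trit (u k (j k))) ^+ 2 <=
    2 * (L + 2) * (\prod_k supp (u k)) * (\sum_k supp (u k)).
Proof.
pose Z w : R := \sum_u expR (- (2 * Lam u)) * (expR (t u * X w u) + expR (- t u * X w u)).
have tP u : t u ^+ 2 * P u / 2 <= Lam u.
  have Lp : 0 <= Lam u by apply: le_trans (Lam_ge2 u).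
  rewrite /t sqr_sqrtr; last by rewrite divr_ge0 ?mulr_ge0.
  have [->|Pn] := eqVneq (P u) 0; first by rewrite mulr0 mul0r.
  by rewrite divfK// mulrC mulKf.
have [w Zw] : exists w, Z w < 1.
  apply: contrapT => H.
  have ge1 w : 1 <= Z w by rewrite leNgt; apply/negP => lt1; apply: H; exists w.
  have : \sum_(w : {ffun J -> bool}) 1 <= \sum_w Z w by apply: ler_sum => w _; exact: ge1.
  rewrite sumr_const card_ffun card_bool.
  apply/negP; rewrite -ltNge /Z exchange_big/=.
  have -> : (2 ^ #|{: J}|)%:R = 2 ^+ #|{: J}| :> R by rewrite natrX.
  apply: (@le_lt_trans _ _ (\sum_u 2 ^+ #|{: J}| * (2 * expR (- Lam u)))).
    apply: ler_sum => u _; rewrite -mulr_sumr big_split/=.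
    have H1 := mgf u (t u); have H2 := mgf u (- t u); rewrite sqrrN in H2.
    have E : expR (t u ^+ 2 * P u / 2) <= expR (Lam u) by rewrite ler_expR.
    have p2 : (0 : R) <= 2 ^+ #|{: J}| by rewrite exprn_ge0.
    move: (2 ^+ _) p2 H1 H2 => c p2 H1 H2; have E2 := ler_wpM2l p2 E.
    have -> : c * (2 * expR (- Lam u)) = expR (- (2 * Lam u)) * (2 * (c * expR (Lam u))).
      rewrite (_ : - Lam u = - (2 * Lam u) + Lam u); last by ring.
      by rewrite expRD; ring.
    rewrite ler_wpM2l ?expR_ge0//; lra.
  rewrite -mulr_sumr -mulr_sumr -[ltRHS]mulr1 ltr_pM2l ?exprn_gt0//.
  by have := weight_sum; lra.
exists w => u; rewrite -/(cf u _).
have Lp := Lam_ge2 u.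
have [P0|Pn] := eqVneq (P u) 0.
  have c0 j : cf u j = 0.
    have : cf u j ^+ 2 = 0.
      move: P0; rewrite -cf_sqr => /eqP; rewrite psumr_eq0 => [|? _]; last exact: sqr_ge0.
      by move/allP/(_ j (mem_index_enum _))/eqP.
    by move/eqP; rewrite sqrf_eq0 => /eqP.
  rewrite big1 ?expr0n/= -/(P u) ?P0 ?mulr0 ?mul0r// => j _.
  by rewrite -/(cf u j) c0 mulr0.
have Pp : 0 < P u by rewrite lt_neqAle eq_sym Pn P_ge0.
have tp : 0 < t u by rewrite sqrtr_gt0 divr_gt0// mulr_gt0//; lra.
have Zu : expR (- (2 * Lam u)) * (expR (t u * X w u) + expR (- t u * X w u)) < 1.
  apply: le_lt_trans Zw; rewrite /Z (bigD1 u)//= lerDl; apply: sumr_ge0 => v _.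
  by rewrite mulr_ge0 ?addr_ge0 ?expR_ge0.
have Xb : t u * `|X w u| <= 2 * Lam u.
  rewrite -subr_le0 addrC -ler_expR expR0 expRD; apply: le_trans (ltW Zu).
  rewrite ler_wpM2l ?expR_ge0//.
  have e1 := expR_ge0 (t u * X w u); have e2 := expR_ge0 (- t u * X w u).
  case: (ger0P (X w u)) => _; first by rewrite lerDl.
  by rewrite mulrN -mulNr lerDr.
have X2 : X w u ^+ 2 <= 2 * Lam u * P u.
  have t2 : t u ^+ 2 = 2 * Lam u / P u by rewrite sqr_sqrtr// divr_ge0 ?mulr_ge0 ?P_ge0//; lra.
  have : (t u * `|X w u|) ^+ 2 <= (2 * Lam u) ^+ 2.
    by apply: lerXn2r; rewrite ?nnegrE// ?mulr_ge0 ?(ltW tp)//; lra.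
  have a0 : 0 < 2 * Lam u by lra.
  rewrite exprMn real_normK ?num_real// t2 mulrAC ler_pdivrMr//.
  by rewrite expr2 -(mulrA (2 * Lam u) (2 * Lam u)) ler_pM2l.
have S1 : 1 <= \sum_k supp (u k).
  have [k _] : exists k : 'I_m, True by exists (Ordinal m0).
  rewrite (bigD1 k)//=; apply: (@le_trans _ _ (supp (u k))); last by rewrite lerDl sumr_ge0.
  apply: supp_ge1; apply/eqP => uk; move: Pn; rewrite /P (bigD1 k)//= uk mul0r eqxx //.
apply: (le_trans X2); rewrite -/(P u) /Lam.
have L0 := L_ge0; move: (P u) (\sum_k _) L S1 (P_ge0 u) L0 => p S l S1 p0 l0.
have -> : 2 * (l + 2) * p * S = 2 * (l * S + 2) * p + 4 * (S - 1) * p by ring.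
by rewrite lerDl !mulr_ge0// subr_ge0.
Qed.

End RandomSigns.

(** * Forms with random signs on flat vectors *)

Section FlatBound.
Context {R : realType}.

(** A point of the cube is the barycentre of the vertices for the product of
    the Bernoulli laws with the coordinates as means. *)
Lemma cube_mean (I : finType) (y : I -> R) : (forall i, `|y i| <= 1) ->
  exists W : {ffun I -> bool} -> R, [/\ forall t, 0 <= W t, \sum_t W t = 1 &
    forall i, \sum_t W t * sgn (t i) = y i].
Proof.
move=> y1; pose q i b : R := (1 + sgn b * y i) / 2.
have q0 i b : 0 <= q i b.
  have := y1 i; rewrite ler_norml => /andP[a c].
  by rewrite /q /sgn; case: b; lra.
have q1 i : \sum_b q i b = 1 by rewrite big_bool /q /sgn /=; field.
exists (fun t : {ffun I -> bool} => \prod_i q i (t i)); split.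
- by move=> t; apply: prodr_ge0.
- by rewrite -(bigA_distr_bigA q) big1.
move=> i.
pose q' j b := q j b * (if j == i then sgn b else 1).
have E (t : {ffun I -> bool}) : \prod_j q j (t j) * sgn (t i) = \prod_j q' j (t j).
  rewrite /q' [RHS]big_split/=; congr (_ * _).
  by rewrite (bigD1 i)//= eqxx big1 ?mulr1// => j /negPf ->.
under eq_bigr do rewrite E.
rewrite -(bigA_distr_bigA q') (bigD1 i)//= [X in _ * X]big1 ?mulr1.
  by rewrite big_bool /q' eqxx /q /sgn /=; field.
by move=> j /negPf ji; rewrite -[RHS](q1 j); apply: eq_bigr => b _; rewrite /q' ji mulr1.
Qed.

Context {m n : nat}.
Local Notation J := {ffun 'I_m -> 'I_n}.
Local Notation U := {ffun 'I_m -> {ffun 'I_n -> 'I_3}}.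

Variables (w : {ffun J -> bool}) (c : R).
Hypothesis wP : forall u : U, (\sum_j sgn (w j) * \prod_k trit (u k (j k))) ^+ 2 <=
    c * (\prod_k @supp R n (u k)) * (\sum_k supp (u k)).

Let unit_bound (A : 'I_m -> {set 'I_n}) (y : 'I_m -> 'I_n -> R) :
  (forall k i, `|y k i| <= 1) ->
  `|\sum_j sgn (w j) * \prod_k ((j k \in A k)%:R * y k (j k))| <=
    Num.sqrt (c * (\prod_k #|A k|%:R) * \sum_k #|A k|%:R).
Proof.
move=> y1; set B := Num.sqrt _.
have [W WP] : exists W : 'I_m -> {ffun 'I_n -> bool} -> R, forall k,
    [/\ forall t, 0 <= W k t, \sum_t W k t = 1 & forall i, \sum_t W k t * sgn (t i) = y k i].
  exists (fun k => projT1 (cid (cube_mean (y1 k)))) => k.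
  by case: cid => W [].
pose u (v : {ffun 'I_m -> {ffun 'I_n -> bool}}) : U :=
  [ffun k => [ffun i => if i \in A k then (if v k i then inord 2 else inord 0) else inord 1]].
have uE v k i : trit (u v k i) = (i \in A k)%:R * sgn (v k i) :> R.
  rewrite /trit !ffunE /sgn; case: (i \in A k); last by rewrite inordK// subrr mul0r.
  rewrite mul1r; case: (v k i); rewrite inordK ?sub0r//.
  by rewrite (_ : 2 - 1 = 1)//; ring.
have suppE v k : supp (u v k) = #|A k|%:R :> R.
  rewrite /supp -sum1_card natr_sum [RHS]big_mkcond/=; apply: eq_bigr => i _.
  rewrite uE /sgn; case: (i \in A k); last by rewrite mul0r expr0n.
  by rewrite mul1r; case: (v k i); rewrite ?sqrrN expr1n.
have signs (v : {ffun 'I_m -> {ffun 'I_n -> bool}}) : `|\sum_j sgn (w j) * \prod_k ((j k \in A k)%:R * sgn (v k (j k)))| <= B.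
  rewrite -sqrtr_sqr ler_wsqrtr//.
  have -> : \prod_k #|A k|%:R = \prod_k supp (u v k) :> R.
    by apply: eq_bigr => k _; rewrite suppE.
  have -> : \sum_k #|A k|%:R = \sum_k supp (u v k) :> R.
    by apply: eq_bigr => k _; rewrite suppE.
  apply: le_trans (wP (u v)); rewrite le_eqVlt; apply/orP; left; apply/eqP.
  congr (_ ^+ 2); apply: eq_bigr => j _; congr (_ * _).
  by apply: eq_bigr => k _; rewrite uE.
have -> : \sum_j sgn (w j) * \prod_k ((j k \in A k)%:R * y k (j k)) =
    \sum_(v : {ffun 'I_m -> {ffun 'I_n -> bool}}) (\prod_k W k (v k)) *
      \sum_j sgn (w j) * \prod_k ((j k \in A k)%:R * sgn (v k (j k))).
  under [RHS]eq_bigr do rewrite mulr_sumr.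
  rewrite exchange_big/=; apply: eq_bigr => j _.
  have -> : \prod_k ((j k \in A k)%:R * y k (j k)) =
     \prod_k \sum_t W k t * ((j k \in A k)%:R * sgn (t (j k))).
    apply: eq_bigr => k _; have [_ _ <-] := WP k; rewrite mulr_sumr.
    by apply: eq_bigr => t _; ring.
  rewrite (bigA_distr_bigA (fun k t => W k t * ((j k \in A k)%:R * sgn (t (j k))))) mulr_sumr.
  by apply: eq_bigr => v _; rewrite big_split/= mulrCA.
apply: le_trans (ler_norm_sum _ _ _) _.
have <- : \sum_(v : {ffun 'I_m -> {ffun 'I_n -> bool}}) (\prod_k W k (v k)) * B = B.
  rewrite -mulr_suml -(bigA_distr_bigA W) big1 ?mul1r// => k _.
  by case: (WP k).
have W0 (v : {ffun 'I_m -> {ffun 'I_n -> bool}}) : 0 <= \prod_k W k (v k).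
  by apply: prodr_ge0 => k _; case: (WP k).
by apply: ler_sum => v _; rewrite normrM ger0_norm// ler_wpM2l.
Qed.

(** The form is affine in every entry of every vector, so that its maximum over
    a box is attained at a vertex, where the entries are signs. *)
Lemma flat_bound (A : 'I_m -> {set 'I_n}) (h : 'I_m -> R) (z : 'I_m -> 'I_n -> R) :
  (forall k, 0 < h k) -> (forall k i, i \notin A k -> z k i = 0) ->
  (forall k i, `|z k i| <= h k) ->
  `|\sum_j sgn (w j) * \prod_k z k (j k)| <=
    \prod_k h k * Num.sqrt (c * (\prod_k #|A k|%:R) * \sum_k #|A k|%:R).
Proof.
move=> h0 zA zh.
have -> : \sum_j sgn (w j) * \prod_k z k (j k) =
  \prod_k h k * \sum_j sgn (w j) * \prod_k ((j k \in A k)%:R * (z k (j k) / h k)).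
  rewrite mulr_sumr; apply: eq_bigr => j _; rewrite mulrCA -big_split/=; congr (_ * _).
  apply: eq_bigr => k _; have [kA|kA] := boolP (j k \in A k).
    by rewrite mul1r mulrC divfK// gt_eqF.
  by rewrite zA// mul0r !mulr0.
have H0 : 0 <= \prod_k h k by apply: prodr_ge0 => k _; exact: ltW.
rewrite normrM ger0_norm// ler_wpM2l//.
apply: (@unit_bound A (fun k i => z k i / h k)) => k i.
by rewrite normrM normfV (gtr0_norm (h0 k)) ler_pdivrMr// mul1r.
Qed.

End FlatBound.

(** * Forms with random signs on the unit ball *)

Section Levels.
Context {R : realType}.

(** The last level collects all numbers at most c^N, however small. *)
Lemma level_exists (N : nat) (c a : R) : a <= 1 ->
  exists t : 'I_N.+1, a <= c ^+ t /\ ((t < N)%N -> c ^+ t.+1 < a).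
Proof.
move=> a1; pose P t := (t <= N)%N && (a <= c ^+ t).
have P0 : exists t, P t by exists 0%N; rewrite /P expr0.
have Pb t : P t -> (t <= N)%N by move=> /andP[].
case: (ex_maxnP P0 Pb) => t /andP[tN ta] tmax.
exists (Ordinal (tN : (t < N.+1)%N)); split => //= lt_tN.
rewrite ltNge; apply/negP => ta1.
by have := tmax t.+1; rewrite /P lt_tN ta1 ltnn => /(_ isT).
Qed.

Variable s : scalars.
Local Notation K := (base_field R s).

(** The Markov inequality. *)
Lemma lp_norm_many n p (u : 'rV[K]_n) (A : {set 'I_n}) (d : R) : (0 < p)%E ->
  lp_norm p u <= 1 -> 0 <= d <= 1 -> (forall i, i \in A -> d <= modulus (u 0 i)) ->
  #|A|%:R `^ inv_exponent p * d <= 1.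
Proof.
case: p => [q| |//]; rewrite ?lte_fin => q0 u1 /andP[d0 d1] ud; last by rewrite powRr0 mul1r.
rewrite /=; apply: le_trans u1.
have -> : #|A|%:R `^ q^-1 * d = (#|A|%:R * d `^ q) `^ q^-1.
  by rewrite powRM ?powR_ge0// -powRrM divff ?powRr1// gt_eqF.
apply: ge0_ler_powR; rewrite ?nnegrE ?invr_ge0 ?(ltW q0)//.
- by rewrite mulr_ge0 ?powR_ge0.
- by apply: sumr_ge0 => i _; exact: powR_ge0.
rewrite mulr_natl -sumr_const [leRHS](bigID (mem A))/= -[leLHS]addr0; apply: lerD.
  by apply: ler_sum => i iA; rewrite ge0_ler_powR ?nnegrE ?modulus_ge0 ?(ltW q0) ?ud.
by apply: sumr_ge0 => i _; exact: powR_ge0.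
Qed.

(** The hypothesis h s^th <= b gives h^2 s <= b^2 s^(1 - 2 th) for a piece of
    size s, so that s_l \prod_k s_k^(1 - 2 th) is to be bounded. For th <= 1/2
    it is largest when all pieces have size n, which is the first condition on
    e; for th >= 1/2 it is largest when s_l = n and the others have size 1,
    which is the second. *)
Lemma flat_piece_bound (m n : nat) (th e b c : R) (N : 'I_m -> nat) (h : 'I_m -> R) :
  (0 < n)%N -> 0 <= th <= 1 -> (m%:R + 1) / 2 - m%:R * th <= e -> 1 - th <= e ->
  0 <= b -> 0 <= c -> (forall k, (N k <= n)%N) -> (forall k, 0 <= h k) ->
  (forall k, (N k)%:R `^ th * h k <= b) ->
  \prod_k h k * Num.sqrt (c * (\prod_k (N k)%:R) * \sum_k (N k)%:R) <=
    b ^+ m * Num.sqrt (c * m%:R) * n%:R `^ e.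
Proof.
move=> n0 /andP[th0 th1] e1 e2 b0 c0 Nn h0 Nh.
have nR : (1 : R) <= n%:R by rewrite ler1n.
have rhs0 : 0 <= b ^+ m * Num.sqrt (c * m%:R) * n%:R `^ e.
  by rewrite !mulr_ge0 ?exprn_ge0 ?sqrtr_ge0 ?powR_ge0.
have [[k Nk0]|Npos] := pselect (exists k, N k = 0%N).
  by rewrite [X in c * X * _](bigD1 k)//= Nk0 mulr0n mul0r mulr0 mul0r sqrtr0 mulr0.
have {Npos} N1 k : (0 < N k)%N.
  by rewrite lt0n; apply/eqP => Nk; apply: Npos; exists k.
have NR k : (0 : R) < (N k)%:R by rewrite ltr0n.
have H0 : 0 <= \prod_k h k by apply: prodr_ge0.
have -> : \prod_k h k = Num.sqrt ((\prod_k h k) ^+ 2) by rewrite sqrtr_sqr ger0_norm.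
rewrite -sqrtrM ?sqr_ge0//.
have -> : b ^+ m * Num.sqrt (c * m%:R) * n%:R `^ e =
   Num.sqrt (b ^+ (2 * m) * (c * m%:R) * n%:R `^ (2 * e)).
  rewrite (mulrC 2 e) powRrM powR_mulrn ?powR_ge0// mulnC exprM.
  rewrite [RHS]sqrtrM ?mulr_ge0 ?exprn_ge0// (sqrtrM (c * m%:R)) ?sqr_ge0//.
  by rewrite !sqrtr_sqr !ger0_norm ?exprn_ge0 ?powR_ge0.
apply: ler_wsqrtr.
have E k : h k ^+ 2 * (N k)%:R <= b ^+ 2 * (N k)%:R `^ (1 - 2 * th).
  have -> : h k ^+ 2 * (N k)%:R = ((N k)%:R `^ th * h k) ^+ 2 * (N k)%:R `^ (1 - 2 * th).
    rewrite exprMn -(@powR_mulrn _ (_ `^ th)) ?powR_ge0// -powRrM [RHS]mulrAC -powRD ?(gt_eqF (NR k)) ?implybT//.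
    by rewrite (_ : th * 2 + (1 - 2 * th) = 1) ?powRr1 ?(ltW (NR k)) 1?mulrC//; ring.
  rewrite ler_wpM2r ?powR_ge0// lerXn2r ?nnegrE//.
  by rewrite mulr_ge0 ?powR_ge0.
have {}E : (\prod_k h k) ^+ 2 * \prod_k (N k)%:R <=
    b ^+ (2 * m) * \prod_k (N k)%:R `^ (1 - 2 * th).
  have -> : b ^+ (2 * m) * \prod_k (N k)%:R `^ (1 - 2 * th) =
     \prod_k (b ^+ 2 * (N k)%:R `^ (1 - 2 * th)).
    by rewrite big_split/= prodr_const card_ord exprM.
  rewrite -prodrXl -big_split/=; apply: ler_prod => k _.
  by rewrite mulr_ge0 ?sqr_ge0//= E.
have F l : (N l)%:R * \prod_k (N k)%:R `^ (1 - 2 * th) <= n%:R `^ (2 * e) :> R.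
  have [th2|th2] := lerP th (1 / 2).
    apply: (@le_trans _ _ (n%:R * \prod_(k < m) n%:R `^ (1 - 2 * th))).
      rewrite ler_pM ?prodr_ge0 ?ler_nat//.
      apply: ler_prod => k _; rewrite powR_ge0/= ge0_ler_powR ?nnegrE ?ler_nat//; lra.
    rewrite prodr_const card_ord -powR_mulrn ?powR_ge0// -powRrM.
    rewrite -{1}[n%:R](powRr1 (ler0n _ n)) -powRD ?(gt_eqF (lt_le_trans ltr01 nR)) ?implybT//.
    by apply: ler_powR => //; lra.
  apply: (@le_trans _ _ ((N l)%:R `^ (2 - 2 * th))).
    rewrite (bigD1 l)//= mulrA -{1}[(N l)%:R](powRr1 (ltW (NR l))) -powRD ?(gt_eqF (NR l)) ?implybT//.
    rewrite (_ : 1 + (1 - 2 * th) = 2 - 2 * th); last by ring.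
    rewrite ler_piMr ?powR_ge0//; apply: prodr_ile1 => k _; rewrite powR_ge0/=.
    rewrite -[leRHS](powRr0 (N k)%:R) ler_powR ?ler1n//; lra.
  apply: (@le_trans _ _ (n%:R `^ (2 - 2 * th))).
    by rewrite ge0_ler_powR ?nnegrE ?ler_nat//; lra.
  by apply: ler_powR => //; lra.
have {}F : \prod_k (N k)%:R `^ (1 - 2 * th) * \sum_k (N k)%:R <= m%:R * n%:R `^ (2 * e) :> R.
  have -> : m%:R * n%:R `^ (2 * e) = \sum_(k < m) n%:R `^ (2 * e) :> R.
    by rewrite sumr_const card_ord mulr_natl.
  by rewrite mulrC mulr_suml; apply: ler_sum.
have b2 : 0 <= b ^+ (2 * m) by rewrite exprn_ge0.
have S0 : 0 <= \sum_k (N k)%:R :> R by apply: sumr_ge0.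
move: (\prod_k h k) (\prod_k (N k)%:R) (\prod_k _ `^ _) (\sum_k _) (b ^+ _) E F b2 S0 => X Y Z S B E F b2 S0.
have -> : X ^+ 2 * (c * Y * S) = c * (X ^+ 2 * Y * S) by ring.
have -> : B * (c * m%:R) * n%:R `^ (2 * e) = c * (B * (m%:R * n%:R `^ (2 * e))) by ring.
rewrite ler_wpM2l//; apply: le_trans (_ : _ <= B * Z * S) _; first by rewrite ler_wpM2r.
by rewrite -mulrA ler_wpM2l.
Qed.

End Levels.

Section SignedForm.
Context {R : realType}.
Variable s : scalars.
Local Notation K := (base_field R s).

(** Real and imaginary parts, with a number of modulus at most 1 in place of
    the imaginary unit so that real scalars are included. *)
Lemma real_coordinates : exists2 iota : K, modulus iota <= 1 &
  forall z : K, exists2 ab : R * R, z = emb s ab.1 + iota * emb s ab.2 &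
    `|ab.1| <= modulus z /\ `|ab.2| <= modulus z.
Proof.
case: s => /=.
  exists 0; rewrite ?normr0// => z; exists (z, 0); first by rewrite mul0r addr0.
  by rewrite normr0.
exists (Complex 0 1); first by rewrite /= expr0n expr1n/= add0r sqrtr1.
move=> [x y]; exists (x, y) => /=.
  by apply/eqP; rewrite eq_complex/=; apply/andP; split; apply/eqP; ring.
by split; rewrite -sqrtr_sqr ler_wsqrtr// ?lerDl ?lerDr sqr_ge0.
Qed.

Context {m n : nat}.
Local Notation J := {ffun 'I_m -> 'I_n}.
Local Notation U := {ffun 'I_m -> {ffun 'I_n -> 'I_3}}.
Variable w : {ffun J -> bool}.
Hypotheses (n0 : (0 < n)%N).

Definition signed_form (x : 'I_m -> 'rV[K]_n) : K :=
  \sum_j emb s (sgn (w j)) * \prod_k x k 0 (j k).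

Lemma signed_form_multilinear : multilinear_form signed_form.
Proof.
move=> k x a u v; rewrite /signed_form mulr_sumr -big_split/=; apply: eq_bigr => j _.
have E (t : 'rV[K]_n) : \prod_l @dfwith _ (fun=> 'rV[K]_n) x k t l 0 (j l) =
    t 0 (j k) * \prod_(l | l != k) x l 0 (j l).
  rewrite (bigD1 k)//= dfwithin; congr (_ * _).
  by apply: eq_bigr => l lk; rewrite dfwithout// eq_sym.
by rewrite !E !mxE; ring.
Qed.

Lemma signed_form_unimodular : unimodular signed_form.
Proof.
move=> j; rewrite /coef /signed_form (bigD1 j)//= [X in _ + X]big1 ?addr0.
  rewrite big1 ?mulr1; last by move=> k _; rewrite mxE !eqxx.
  by rewrite modulus_emb /sgn; case: (w j); rewrite ?normrN normr1.
move=> j' jj'; have [k jk] : exists k, j' k != j k.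
  apply: contrapT => H; move/eqP: jj'; apply; apply/ffunP => k; apply/eqP.
  by apply: contrapT => jk; apply: H; exists k; apply/negP.
by rewrite (bigD1 k)//= mxE eqxx/= (negPf jk) mul0r mulr0.
Qed.

Variable (c : R).
Hypothesis c0 : 0 <= c.
Hypothesis wP : forall u : U, (\sum_j sgn (w j) * \prod_k trit (u k (j k))) ^+ 2 <=
    c * (\prod_k @supp R n (u k)) * (\sum_k supp (u k)).

(** Every entry is split into its real and imaginary parts, and the entries of a
    vector are grouped into N + 1 levels by modulus, with ratio b = n^(1/N)
    between consecutive levels. Every vector is then a sum of 2 (N + 1) flat
    pieces, and within each piece the loss against constant modulus is at most
    a factor b. *)
Lemma signed_form_bound (p : \bar R) (N : nat) (e : R) (x : 'I_m -> 'rV[K]_n) :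
  (0 < N)%N -> (0 < p)%E -> inv_exponent p <= 1 ->
  (m%:R + 1) / 2 - m%:R * inv_exponent p <= e -> 1 - inv_exponent p <= e ->
  (forall k, lp_norm p (x k) <= 1) ->
  modulus (signed_form x) <= (2 * N.+1)%:R ^+ m *
    ((n%:R `^ N%:R^-1) ^+ m * Num.sqrt (c * m%:R) * n%:R `^ e).
Proof.
move=> N0 p0 th1 e1 e2 x1.
have nR : (1 : R) <= n%:R by rewrite ler1n.
set th := inv_exponent p; set b := n%:R `^ N%:R^-1; pose r := b^-1.
have th0 : 0 <= th.
  by rewrite /th; case: (p) p0 => [q| |//] q0 //=; rewrite invr_ge0 ltW.
have b1 : 1 <= b by rewrite /b -[leLHS](powRr0 n%:R) ler_powR// invr_ge0.
have b0 : 0 < b by apply: lt_le_trans b1.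
have r0 : 0 < r by rewrite invr_gt0.
have r1 : r <= 1 by rewrite invf_le1.
have rN : r ^+ N = n%:R^-1.
  by rewrite exprVn -powR_mulrn ?powR_ge0// -powRrM mulVf ?powRr1 ?ler0n// pnatr_eq0 -lt0n.
have [iota iota1 parts] := real_coordinates.
have /choice[part partP] (z : K) : exists ab : R * R, z = emb s ab.1 + iota * emb s ab.2 /\
    (`|ab.1| <= modulus z /\ `|ab.2| <= modulus z).
  by have [ab ? ?] := parts z; exists ab.
have /choice[lev levP] (ki : 'I_m * 'I_n) : exists t : 'I_N.+1,
    modulus (x ki.1 0 ki.2) <= r ^+ t /\ ((t < N)%N -> r ^+ t.+1 < modulus (x ki.1 0 ki.2)).
  by apply: level_exists; exact: (lp_coord _ p0).
pose A k (l : 'I_N.+1 * bool) : {set 'I_n} := finset (fun i => lev (k, i) == l.1).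
pose zeta (l : 'I_N.+1 * bool) : K := if l.2 then iota else 1.
pose z k (l : 'I_N.+1 * bool) i : R :=
  if i \in A k l then (if l.2 then (part (x k 0 i)).2 else (part (x k 0 i)).1) else 0.
have xE k i : x k 0 i = \sum_l zeta l * emb s (z k l i).
  rewrite -(pair_bigA _ (fun t d => zeta (t, d) * emb s (z k (t, d) i)))/=.
  rewrite (bigD1 (lev (k, i)))//= [X in _ + X]big1 ?addr0.
    rewrite big_bool /zeta /z !finset.inE /= eqxx mul1r addrC.
    by case: (partP (x k 0 i)).
  move=> t tk; rewrite big1// => d _.
  by rewrite /z finset.inE /= eq_sym (negPf tk) emb0 mulr0.
have A_size k l : #|A k l|%:R `^ th * r ^+ l.1 <= b.
  have [tN|tN] := ltnP l.1 N.
    have : #|A k l|%:R `^ th * r ^+ l.1.+1 <= 1.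
      apply: (lp_norm_many p0 (x1 k)).
        by rewrite exprn_ge0 ?exprn_ile1// ltW.
      move=> i; rewrite finset.inE => /eqP li; apply: ltW.
      by have [_] := levP (k, i); rewrite li; apply.
    by rewrite exprSr mulrA ler_pdivrMr// mul1r.
  have -> : nat_of_ord l.1 = N by apply/eqP; rewrite eqn_leq tN andbT -ltnS.
  rewrite rN; apply: le_trans b1; rewrite ler_pdivrMr ?mul1r; last exact: lt_le_trans nR.
  apply: (@le_trans _ _ (n%:R `^ th)).
    rewrite ge0_ler_powR ?nnegrE// ler_nat -[leqRHS]card_ord; exact: max_card.
  by rewrite -[leRHS](powRr1 (ler0n _ n)) ler_powR.
have -> : signed_form x = \sum_(v : {ffun 'I_m -> 'I_N.+1 * bool}) (\prod_k zeta (v k)) *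
    emb s (\sum_j sgn (w j) * \prod_k z k (v k) (j k)).
  under [RHS]eq_bigr do rewrite emb_sum mulr_sumr.
  rewrite exchange_big/=; apply: eq_bigr => j _.
  under eq_bigr do rewrite xE.
  rewrite (bigA_distr_bigA (fun k l => zeta l * emb s (z k l (j k)))) mulr_sumr.
  by apply: eq_bigr => v _; rewrite big_split/= mulrCA embM emb_prod.
apply: le_trans (modulus_sum _ _ _) _.
have -> : (2 * N.+1)%:R ^+ m * (b ^+ m * Num.sqrt (c * m%:R) * n%:R `^ e) =
    \sum_(v : {ffun 'I_m -> 'I_N.+1 * bool}) b ^+ m * Num.sqrt (c * m%:R) * n%:R `^ e.
  rewrite sumr_const card_ffun card_prod card_bool !card_ord -[RHS]mulr_natl natrX.
  by rewrite (mulnC 2).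
apply: ler_sum => v _; rewrite modulusM modulus_emb -[leRHS]mul1r.
rewrite ler_pM ?modulus_ge0//.
  rewrite modulus_prod; apply: prodr_ile1 => k _; rewrite modulus_ge0/= /zeta.
  by case: (v k).2; rewrite ?modulus1.
apply: le_trans (_ : _ <= \prod_k r ^+ (v k).1 *
    Num.sqrt (c * (\prod_k #|A k (v k)|%:R) * \sum_k #|A k (v k)|%:R)) _.
  apply: (@flat_bound R m n w c wP (fun k => A k (v k)) (fun k => r ^+ (v k).1)
    (fun k => z k (v k))) => [k|k i iA|k i]; first exact: exprn_gt0.
    by rewrite /z (negPf iA).
  rewrite /z finset.inE; case: eqP => [lk|_]; last by rewrite normr0 exprn_ge0// ltW.
  have [xr _] := levP (k, i); rewrite lk in xr; apply: le_trans xr.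
  by have [_ [? ?]] := partP (x k 0 i); case: (v k).2.
apply: (@flat_piece_bound R m n th e b c (fun k => #|A k (v k)|) (fun k => r ^+ (v k).1)) => //.
- by rewrite th0.
- exact: ltW.
- by move=> k; rewrite -[leqRHS]card_ord; exact: max_card.
- by move=> k; rewrite exprn_ge0// ltW.
Qed.

End SignedForm.

(** * Optimal exponents *)

Section LowerBound.
Context {R : realType}.
Variable s : scalars.
Local Notation K := (base_field R s).

Lemma powR_growth (a b C : R) : 0 < C ->
  (forall n : nat, (0 < n)%N -> n%:R `^ a <= C * n%:R `^ b) -> a <= b.
Proof.
move=> C0 H; rewrite leNgt; apply/negP => ba.
have d0 : 0 < a - b by rewrite subr_gt0.
pose n := (Num.truncn (C `^ (a - b)^-1)).+1.
have nC : C `^ (a - b)^-1 < n%:R by exact: truncnS_gt.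
have nR : (0 : R) < n%:R by rewrite ltr0n.
have := H n isT; rewrite leNgt => /negP; apply.
have -> : a = (a - b) + b by rewrite subrK.
rewrite powRD ?(gt_eqF nR) ?implybT// ltr_pM2r ?powR_gt0//.
have -> : C = (C `^ (a - b)^-1) `^ (a - b).
  by rewrite -powRrM mulVf ?gt_eqF// powRr1// ltW.
by rewrite gt0_ltr_powR ?nnegrE ?powR_ge0// ltW.
Qed.

Variable m : nat.
Hypothesis m0 : (0 < m)%N.
Let mR : (0 : R) < m%:R. Proof. by rewrite ltr0n. Qed.

Variables (p : \bar R) (e : R).
Hypotheses (p0 : (0 < p)%E) (p1 : inv_exponent p <= 1).
Hypotheses (e1 : (m%:R + 1) / 2 - m%:R * inv_exponent p <= e) (e2 : 1 - inv_exponent p <= e).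

(** The logarithm in the bound for random signs is absorbed by one more factor
    n^(1/N). *)
Lemma small_norm_form (N : nat) : (0 < N)%N -> exists2 C : R, 0 < C &
  forall n, (0 < n)%N -> exists T : ('I_m -> 'rV[K]_n) -> K,
    [/\ multilinear_form T, unimodular T & form_norm p T <= C * n%:R `^ (e + (m%:R + 1) / N%:R)].
Proof.
move=> N0; have NR : (0 : R) < N%:R by rewrite ltr0n.
pose D : R := 2 * (ln (8 * m)%:R + 2 + N%:R) * m%:R.
have l0 : 0 <= ln (8 * m)%:R :> R by apply: ln_ge0; rewrite ler1n muln_gt0.
have D0 : 0 < D by rewrite !mulr_gt0//; lra.
exists ((2 * N.+1)%:R ^+ m * Num.sqrt D); first by rewrite mulr_gt0 ?exprn_gt0 ?sqrtr_gt0.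
move=> n n0; have nR : (0 : R) < n%:R by rewrite ltr0n.
have [w wP] := @random_signs R m n m0 n0.
exists (@signed_form R s m n w); split; [exact: signed_form_multilinear|exact: signed_form_unimodular|].
have L0 : 0 <= ln (8 * n * m)%:R :> R by apply: ln_ge0; rewrite ler1n !muln_gt0 n0.
set b : R := n%:R `^ N%:R^-1.
have b1 : 1 <= b by rewrite /b -[leLHS](powRr0 n%:R) ler_powR ?invr_ge0// ler1n.
have b0 : 0 < b by apply: lt_le_trans b1.
have LE : ln (8 * n * m)%:R <= ln (8 * m)%:R + N%:R * b.
  rewrite mulnAC natrM lnM ?posrE ?ltr0n ?muln_gt0 ?m0// lerD2l.
  have -> : n%:R = b `^ N%:R by rewrite /b -powRrM mulVf ?gt_eqF// powRr1// ltW.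
  by rewrite ln_powR ler_wpM2l// ltW// ln_sublinear.
apply: form_norm_le => // x x1.
have c0 : 0 <= 2 * (ln (8 * n * m)%:R + 2) :> R by lra.
have := signed_form_bound n0 c0 wP N0 p0 p1 e1 e2 x1; rewrite -/b => /le_trans; apply.
rewrite -[leRHS]mulrA ler_wpM2l ?exprn_ge0//.
have -> : n%:R `^ (e + (m%:R + 1) / N%:R) = b ^+ m * b * n%:R `^ e.
  rewrite powRD ?(gt_eqF nR) ?implybT// mulrC; congr (_ * _).
  by rewrite -exprSr -powR_mulrn ?powR_ge0// -powRrM mulrC -natr1.
have -> : Num.sqrt D * (b ^+ m * b * n%:R `^ e) = b ^+ m * (Num.sqrt D * b) * n%:R `^ e by ring.
rewrite ler_wpM2r ?powR_ge0// ler_wpM2l ?exprn_ge0 ?(ltW b0)//.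
have -> : Num.sqrt D * b = Num.sqrt (D * b ^+ 2).
  by rewrite [RHS]sqrtrM ?(ltW D0)// sqrtr_sqr gtr0_norm.
have -> : D * b ^+ 2 = 2 * ((ln (8 * m)%:R + 2 + N%:R) * b ^+ 2) * m%:R by rewrite /D; ring.
apply: ler_wsqrtr; rewrite ler_wpM2r ?(ltW mR)// ler_wpM2l//.
move: (ln _) (ln _) l0 L0 LE => l l' l0 L0 LE.
have bb : b <= b ^+ 2 by nra.
have := ler_wpM2l l0 (le_trans b1 bb); have := ler_wpM2l (ltW NR) bb; nra.
Qed.

(** The loss (m + 1) / N in the exponent disappears as N tends to infinity. *)
Lemma admissible_ge (r : R) : admissible s m p r -> m%:R / r <= e.
Proof.
move=> [r0 [C C0 HC]].
have main N : (0 < N)%N -> m%:R / r <= e + (m%:R + 1) / N%:R.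
  move=> N0; have [D D0 HD] := small_norm_form N0.
  apply: (@powR_growth _ _ (C * D)); first exact: mulr_gt0.
  move=> n n0; have [T [mT uT TD]] := HD n n0.
  rewrite -mulrA -(coef_sum_normE _ uT); apply: le_trans (HC n T n0 mT uT) _.
  by rewrite ler_wpM2l// ltW.
rewrite leNgt; apply/negP => er.
have d0 : 0 < m%:R / r - e by rewrite subr_gt0.
pose N := (Num.truncn ((m%:R + 1) / (m%:R / r - e))).+1.
have NR : (0 : R) < N%:R by rewrite ltr0n.
have : (m%:R + 1) / (m%:R / r - e) < N%:R by exact: truncnS_gt.
rewrite ltr_pdivrMr// mulrC -ltr_pdivrMr// => H.
have := main N isT; lra.
Qed.

Lemma optimal_exponent_ge : 0 < e -> ((m%:R / e)%:E <= optimal_exponent s m p)%E.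
Proof.
move=> e0; apply: le_ereal_inf_tmp => _ /= [r rA <-]; rewrite lee_fin.
have r0 : 0 < r by case: rA.
by have := admissible_ge rA; rewrite ler_pdivrMr// ler_pdivrMr// mulrC.
Qed.

Lemma optimal_exponent_le : ((2 * m%:R / (m%:R + 1))%:E < p)%E ->
  (optimal_exponent s m p <= (HL_exponent m p)%:E)%E.
Proof.
move=> Hp; apply: ereal_inf_lbound; exists (HL_exponent m p) => //; split.
  by have [] := HL_exponentE m0 Hp.
exists (13 / 10 * m%:R `^ (365 / 1000)); first by rewrite mulr_gt0 ?powR_gt0.
by move=> n T n0 mT uT; exact: unimodular_HL.
Qed.

End LowerBound.

Unset Implicit Arguments.

Theorem theorem2p3 (R : realType) (s : scalars) (m : nat) (hm : (0 < m)%N) :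
  (forall p : \bar R, ((2 * m%:R / (m%:R + 1))%:E < p)%E ->
    forall (n : nat) (T : ('I_m -> 'rV[base_field R s]_n) -> base_field R s),
      (0 < n)%N -> multilinear_form T -> unimodular T ->
      coef_sum_norm (HL_exponent m p) T
        <= (13 / 10) * m%:R `^ (365 / 1000) * form_norm p T)
  /\ (forall p : \bar R, (2%:E <= p)%E ->
        optimal_exponent s m p = (HL_exponent m p)%:E)
  /\ (forall p : R, 1 < p -> p <= 2 * m%:R / (m%:R + 1) ->
        ((m%:R * p / (p - 1))%:E <= optimal_exponent s m p%:E)%E)
  /\ (forall p : R, 2 * m%:R / (m%:R + 1) < p -> p <= 2 ->
        ((m%:R * p / (p - 1))%:E <= optimal_exponent s m p%:E
           <= (HL_exponent m p%:E)%:E)%E).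
Proof.
have mR : (1 : R) <= m%:R by rewrite ler1n.
have c1 : 1 <= 2 * m%:R / (m%:R + 1) :> R by rewrite ler_pdivlMr; lra.
have c2 : 2 * m%:R / (m%:R + 1) < 2 :> R by rewrite ltr_pdivrMr; lra.
have low (p : R) : 1 < p -> p <= 2 -> ((m%:R * p / (p - 1))%:E <= optimal_exponent s m p%:E)%E.
  move=> p1 p2; have p0 : 0 < p by lra.
  have th2 : 1 / 2 <= p^-1 by rewrite div1r lef_pV2 ?posrE.
  have th1 : p^-1 < 1 by rewrite invf_lt1.
  have -> : m%:R * p / (p - 1) = m%:R / (1 - p^-1).
    by field; rewrite !gt_eqF//; lra.
  apply: optimal_exponent_ge => //=; [exact: ltW|nra|lra].
split.
  by move=> p Hp n T n0 mT uT; exact: unimodular_HL.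
split; last first.
  split=> p; first by move=> p1 p2; apply: low => //; lra.
  move=> p1 p2; apply/andP; split; first by apply: low => //; lra.
  exact: optimal_exponent_le.
move=> p p2; have Hp : ((2 * m%:R / (m%:R + 1))%:E < p)%E by apply: lt_le_trans p2; rewrite lte_fin.
apply/eqP; rewrite eq_le optimal_exponent_le//=.
have [h0 hE] := HL_exponentE hm Hp.
have th : 0 <= inv_exponent p <= 1 / 2.
  case: (p) p2 => [q| |//]; rewrite ?lee_fin => q2 /=; last by rewrite lexx divr_ge0.
  have q0 : 0 < q by lra.
  by rewrite invr_ge0 ltW//= div1r lef_pV2 ?posrE.
have -> : HL_exponent m p = m%:R / ((m%:R + 1) / 2 - m%:R * inv_exponent p).
  rewrite -hE invfM invrK mulrA divff ?mul1r// gt_eqF//; lra.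
apply: optimal_exponent_ge => //.
- exact: lt_exponent_gt0 Hp.
- lra.
- by case/andP: th => a b; nra.
- by rewrite -hE mulr_gt0 ?invr_gt0//; lra.
Qed.
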